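(* Let $n\ge 1$, $L\ge 1$, and let $\{\psi^{(\epsilon)}_{j,k}\}$, $\{\tilde\psi^{(\epsilon)}_{j,k}\}$ ($1\le\epsilon\le L$, $j\in\mathbb{Z}$, $k\in\mathbb{Z}^n$) be a pair of band-limited biorthogonal Riesz wavelet bases of $L^2(\mathbb{R}^n)$ (see context). Let $s>0$, $1<p<\infty$, $0<q<\infty$, and take the weight $w\equiv1$, writing $L^p=L^p_w$ and $\dot B^s_{p,q}=\dot B^s_{p,q}(w)$. Let $\psi:=\psi^{(1)}$, $\tilde\psi:=\tilde\psi^{(1)}$, $K_L:=K_L(\tilde\psi)$, $K_\eta:=\max_{|i|\le M}K_U(\varphi_i*\psi)$ (see context). For $N\ge1$ put $$f_N:=\sum_{k\in K_N}\psi_{0,k},\qquad K_N:=\{1,\dots,2N\}\times\{0\}^{n-1}.$$ Then for every integer $N\ge 1$, $f_N\in L^p\cap\dot B^s_{p,q}$, $E_N^{\mathcal{F}}(f_N)_{L^p}\ge K_L^{-1}N^{1/p}$, $\|f_N\|_{\dot B^s_{p,q}}\le C'_MK_\eta(2N)^{1/p}$, and hence $$E_N^{\mathcal{F}}(f_N)_{L^p}\ge\bigl(2^{1/p}K_LK_\eta C'_M\bigr)^{-1}\|f_N\|_{\dot B^s_{p,q}}.$$ Consequently there do not exist $\kappa>0$ and a constant $C$ independent of $N$ and $f$ such that $E_N^{\mathcal{F}}(f)_{L^p}\le CN^{-\kappa}\|f\|_{\dot B^s_{p,q}}$ for all $f\in L^p\cap\dot B^s_{p,q}$ and all integers $N\ge1$.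 Moreover, for $n=1$, $p=q=2$ and the orthonormal Meyer system, $E_N^{\mathcal{F}}(f_N)_{L^2}=2^{-1/2}\|f_N\|_{L^2}$ for every $N\ge 1$.
   Context: Conventions. $\hat f(\xi)=\int_{\mathbb{R}^n} f(x)e^{-2\pi i x\cdot\xi}dx$. $|\cdot|_\infty$ is the maximum norm. $\langle f,g\rangle=\int f\,\overline{g}$. $1/p+1/p'=1$. $\mathcal{S}$ denotes Schwartz functions, $\mathcal{S}'$ tempered distributions, $\mathcal{P}$ polynomials on $\mathbb{R}^n$. For a function $h$, $h_{j,k}(x):=2^{jn/2}h(2^jx-k)$ for $j\in\mathbb{Z}$, $k\in\mathbb{Z}^n$. Wavelet system. Generators $\psi^{(1)},\dots,\psi^{(L)}$ and dual generators $\tilde\psi^{(1)},\dots,\tilde\psi^{(L)}$ have Fourier transforms in $C_c^\infty(\mathbb{R}^n)$ supported in $\{a\le|\xi|\le b\}$ for fixed $0<a<b$ (band-limited). Each of the systems $\{\psi^{(\epsilon)}_{j,k}\}$, $\{\tilde\psi^{(\epsilon)}_{j,k}\}$ is a Riesz basis of $L^2(\mathbb{R}^n)$: closed linear span $L^2$ and $A\sum|c|^2\le\|\sum c^{(\epsilon)}_{j,k}\psi^{(\epsilon)}_{j,k}\|_{L^2}^2\le B\sum|c|^2$ for finitely supported coefficients (Riesz bounds $A,B>0$), similarly for the dual system; $\langle\psi^{(\epsilon)}_{j,k},\tilde\psi^{(\epsilon')}_{j',k'}\rangle=\delta_{\epsilon,\epsilon'}\delta_{j,j'}\delta_{k,k'}$;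 and every $f\in L^2$ satisfies $f=\sum_{\epsilon,j,k}\langle f,\tilde\psi^{(\epsilon)}_{j,k}\rangle\psi^{(\epsilon)}_{j,k}$ in $L^2$. $\mathcal{F}$ denotes the system $\{\psi^{(\epsilon)}_{j,k}\}$. $N$-term error. $E_N^{\mathcal{F}}(f)_{L^p}:=\inf\|f-\sum_{(\epsilon,j,k)\in\Lambda}d^{(\epsilon)}_{j,k}\psi^{(\epsilon)}_{j,k}\|_{L^p}$ over all index sets $\Lambda$ with $\#\Lambda\le N$ and all complex coefficients. Littlewood–Paley and Besov space. Fix $\varphi\in\mathcal{S}(\mathbb{R}^n)$ with $\hat\varphi$ real-valued, radial, supported in $\{c_1\le|\xi|\le c_2\}$ ($0<c_1<c_2$), $\sum_{j\in\mathbb{Z}}\hat\varphi(2^{-j}\xi)=1$ for $\xi\neq0$; $\varphi_j(x):=2^{jn}\varphi(2^jx)$, $\Delta_jf:=\varphi_j*f$. $\dot B^s_{p,q}$ is the set of $f\in\mathcal{S}'/\mathcal{P}$ with $\|f\|_{\dot B^s_{p,q}}:=(\sum_{j\in\mathbb{Z}}2^{jsq}\|\Delta_jf\|_{L^p}^q)^{1/q}<\infty$; $L^p\cap\dot B^s_{p,q}$ consists of $f\in L^p$ whose class modulo polynomials is in $\dot B^s_{p,q}$. Finite-band quantities. $M:=\lceil\max\{\log_2(b/c_1),\log_2(c_2/a),0\}\rceil$, $C'_M:=(\sum_{|i|\le M}2^{isq})^{1/q}$ ($i$ integer). Decay quantities. For a function $h$, its decay envelope is $\beta_0(h):=\sup|h|$,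 $\beta_m(h):=\sup\{|h(z)|:|z|_\infty\ge m-1\}$ for $m\ge1$, and $K_U(h):=\sum_{i\ge0}(\beta_i(h)-\beta_{i+1}(h))(2i+1)^{n+n/p'}$, $K_L(h):=\sum_{i\ge0}(\beta_i(h)-\beta_{i+1}(h))(2i+1)^{n+n/p}$. Meyer system ($n=1$). $L=1$, $\tilde\psi=\psi$, where $\hat\psi(\xi)=e^{i\pi\xi}\sin(\frac{\pi}{2}\nu(3|\xi|-1))$ for $1/3\le|\xi|\le2/3$, $\hat\psi(\xi)=e^{i\pi\xi}\cos(\frac{\pi}{2}\nu(\frac32|\xi|-1))$ for $2/3\le|\xi|\le4/3$, and $\hat\psi=0$ otherwise, with $\nu\in C^\infty(\mathbb{R})$, $\nu=0$ on $(-\infty,0]$, $\nu=1$ on $[1,\infty)$, $\nu(x)+\nu(1-x)=1$. The system $\{\psi_{j,k}\}$ is an orthonormal basis of $L^2(\mathbb{R})$. *)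

(* Defs.v *)
From HB Require Import structures.
From mathcomp Require Import all_boot all_order all_algebra finmap.
From mathcomp Require Import complex.
From mathcomp Require Import all_classical all_reals all_analysis.

Set Implicit Arguments.
Unset Strict Implicit.
Unset Printing Implicit Defensive.

Import Order.TTheory GRing.Theory Num.Def Num.Theory.
Import numFieldNormedType.Exports.

Local Open Scope classical_set_scope.
Local Open Scope ring_scope.
Local Open Scope complex_scope.

Section rV_measurable.
Context {R : realType} {n : nat}.

Let coord : 'I_n -> 'rV[R]_n -> R := fun i x => x ord0 i.

Let rV_set0 : g_sigma_preimage coord set0.
Proof. exact: sigma_algebra0. Qed.

Let rV_setC A : g_sigma_preimage coord A -> g_sigma_preimage coord (~` A).
Proof. exact: sigma_algebraC. Qed.

Let rV_bigcup (F : (set 'rV[R]_n)^nat) :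
  (forall i, g_sigma_preimage coord (F i)) ->
  g_sigma_preimage coord (\bigcup_i (F i)).
Proof. exact: sigma_algebra_bigcup. Qed.

(* Generated by the coordinates, this is the Borel sigma-algebra. *)
HB.instance Definition _ := @isMeasurable.Build default_measure_display
  'rV[R]_n (g_sigma_preimage coord) rV_set0 rV_setC rV_bigcup.

End rV_measurable.

Lemma measurable_coord (R : realType) n (i : 'I_n) :
  measurable_fun [set: 'rV[R]_n] (fun x : 'rV[R]_n => x ord0 i).
Proof.
move=> _ Y mY; rewrite setTI; apply: sub_sigma_algebra => /=.
rewrite -bigcup_seq/=; exists i => /=; first by rewrite mem_index_enum.
by exists Y => //; rewrite setTI.
Qed.

Lemma measurable_rV d (T : measurableType d) (R : realType) n
    (f : T -> 'rV[R]_n) :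
  (forall i, measurable_fun setT (fun t => f t ord0 i)) ->
  measurable_fun setT f.
Proof.
move=> mf; apply: (@measurability _ _ _ _ setT f (\big[setU/set0]_(i < n)
  preimage_set_system setT (fun x : 'rV[R]_n => x ord0 i) measurable)) => //.
move=> _ [B + <-]; rewrite setTI -bigcup_seq => -[i _ [C mC <-]].
by have := mf i measurableT C mC; rewrite !setTI.
Qed.

(* Lebesgue measure on R^n by recursion on n: it is the product of Lebesgue
   measure on the first coordinate with Lebesgue measure on the others. *)
Section lebesgue_rV.
Context {R : realType}.
Local Open Scope ereal_scope.

Definition cons_rV n (z : R * 'rV[R]_n) : 'rV[R]_n.+1 :=
  row_mx (z.1%:M : 'rV_1) z.2.

Definition uncons_rV n (x : 'rV[R]_n.+1) : R * 'rV[R]_n :=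
  (x ord0 ord0, \row_i x ord0 (lift ord0 i)).

Lemma cons_rVK n : cancel (@cons_rV n) (@uncons_rV n).
Proof.
move=> [x y]; rewrite /uncons_rV /cons_rV; congr pair.
  by rewrite mxE; case: splitP => j; rewrite ?ord1 ?mxE ?eqxx ?mulr1n// => /eqP.
apply/rowP => i; rewrite mxE -rshift1 (@row_mxEr _ 1 1).
by [].
Qed.

Lemma measurable_cons_rV n : measurable_fun setT (@cons_rV n).
Proof.
apply: measurable_rV => i; rewrite /cons_rV.
have [->|[j ->]] : i = ord0 \/ exists j, i = lift ord0 j.
  by case: (unliftP ord0 i) => [j ->|->]; [right; exists j|left].
- rewrite (_ : (fun _ => _) = fst); first exact: measurable_fst.
  apply/funext => -[x y] /=; rewrite mxE.
  by case: splitP => j; rewrite ?ord1 ?mxE ?eqxx ?mulr1n// => /eqP.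
- rewrite (_ : (fun _ => _) = (fun y : 'rV[R]_n => y ord0 j) \o snd).
    by apply: measurableT_comp => //; exact: measurable_coord.
  by apply/funext => -[x y] /=; rewrite -rshift1 (@row_mxEr _ 1 1).
Qed.

Lemma measurable_uncons_rV n : measurable_fun setT (@uncons_rV n).
Proof.
apply/measurable_fun_pairP; split; first exact: (measurable_coord ord0).
apply: measurable_rV => i.
rewrite (_ : (fun _ => _) = fun x : 'rV[R]_n.+1 => x ord0 (lift ord0 i)).
  exact: measurable_coord.
by apply/funext => x /=; rewrite mxE.
Qed.

Section step.
Variables (n : nat) (mu : {sigma_finite_measure set 'rV[R]_n -> \bar R}).

Definition lebesgue_rVS : set 'rV[R]_n.+1 -> \bar R :=
  pushforward (lebesgue_measure \x mu) (@cons_rV n).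

Let P : {measure set 'rV[R]_n.+1 -> \bar R}.
Proof.
apply: (pushforward (lebesgue_measure \x mu) (@cons_rV n)).
exact: measurable_cons_rV.
Defined.

Let lebesgue_rVS0 : lebesgue_rVS set0 = 0.
Proof. exact: (measure0 P). Qed.

Let lebesgue_rVS_ge0 A : 0 <= lebesgue_rVS A.
Proof. exact: (measure_ge0 P). Qed.

Let lebesgue_rVS_sigma_additive : semi_sigma_additive lebesgue_rVS.
Proof. exact: (@measure_semi_sigma_additive _ _ _ P). Qed.

HB.instance Definition _ := isMeasure.Build _ _ _ lebesgue_rVS
  lebesgue_rVS0 lebesgue_rVS_ge0 lebesgue_rVS_sigma_additive.

Let lebesgue_rVS_sigma_finite : sigma_finite setT lebesgue_rVS.
Proof.
have /sigma_finiteP[F [TF ndF Foo]] := sigma_finiteT (@lebesgue_measure R).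
have /sigma_finiteP[G [TG ndG Goo]] := sigma_finiteT mu.
exists (fun k => @uncons_rV n @^-1` (F k `*` G k)).
  rewrite -preimage_bigcup -[LHS](preimage_setT (@uncons_rV n)).
  congr preimage; apply/seteqP; split=> // -[x y] _.
  have [k _ Fkx] : (\bigcup_k F k) x by rewrite -TF.
  have [l _ Gly] : (\bigcup_k G k) y by rewrite -TG.
  exists (maxn k l) => //; split => /=.
  - by move: Fkx; exact/subsetPset/ndF/leq_maxl.
  - by move: Gly; exact/subsetPset/ndG/leq_maxr.
move=> k; have [mF Fk] := Foo k; have [mG Gk] := Goo k; split.
  rewrite -[X in measurable X]setTI.
  by apply: (@measurable_uncons_rV n measurableT); exact: measurableX.
rewrite /lebesgue_rVS /pushforward.
rewrite (_ : _ @^-1` _ = F k `*` G k); last first.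
  by apply/seteqP; split => z; rewrite /preimage /mkset cons_rVK.
by rewrite product_measure1E// lte_mul_pinfty// ge0_fin_numE.
Qed.

HB.instance Definition _ := Measure_isSigmaFinite.Build _ _ _ lebesgue_rVS
  lebesgue_rVS_sigma_finite.

End step.

Fixpoint lebesgue_rV n : {sigma_finite_measure set 'rV[R]_n -> \bar R} :=
  if n is m.+1 then lebesgue_rVS (lebesgue_rV m) else dirac (0%R : 'rV[R]_0).

End lebesgue_rV.

Section complex_functions.
Context {R : realType} {n : nat}.
Implicit Types (f g h : 'rV[R]_n -> R[i]) (x y xi : 'rV[R]_n) (p : R).

Definition cmod (z : R[i]) : R := ComplexField.Normc.normc z.

Definition cexp (t : R) : R[i] := cos t +i* sin t.

Definition cmeasurable f :=
  measurable_fun setT (fun x => complex.Re (f x)) /\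
  measurable_fun setT (fun x => complex.Im (f x)).

Definition cintegrable f :=
  (lebesgue_rV n).-integrable setT (fun x => (complex.Re (f x))%:E) /\
  (lebesgue_rV n).-integrable setT (fun x => (complex.Im (f x))%:E).

Definition cint f : R[i] :=
  (\int[lebesgue_rV n]_x complex.Re (f x)) +i* (\int[lebesgue_rV n]_x complex.Im (f x)).

Definition ccontinuous f :=
  continuous (fun x => complex.Re (f x)) /\ continuous (fun x => complex.Im (f x)).

Definition Lp_norm p f : \bar R :=
  Lnorm (lebesgue_rV n) p%:E (fun x => (cmod (f x))%:E).

Definition Lp p : set ('rV[R]_n -> R[i]) :=
  [set f | cmeasurable f /\ (Lp_norm p f < +oo)%E].

Definition inner f g : R[i] := cint (fun x => f x * conjc (g x)).

Definition conv f g : 'rV[R]_n -> R[i] :=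
  fun x => cint (fun y => f (x - y) * g y).

Definition dotp x y : R := \sum_(i < n) x ord0 i * y ord0 i.

(* The norm carried by 'rV[R]_n is the maximum norm. *)
Definition enorm x : R := Num.sqrt (dotp x x).

Definition fourier f : 'rV[R]_n -> R[i] :=
  fun xi => cint (fun x => f x * cexp (- (2 * pi * dotp x xi))).

Definition partial (i : 'I_n) f : 'rV[R]_n -> R[i] := fun x =>
  ('D_(delta_mx ord0 i) (fun y => complex.Re (f y)) x) +i*
  ('D_(delta_mx ord0 i) (fun y => complex.Im (f y)) x).

Definition partials (s : seq 'I_n) f : 'rV[R]_n -> R[i] := foldr partial f s.

Definition smooth f := forall s : seq 'I_n,
  ccontinuous (partials s f) /\
  forall i x,
    derivable (fun y => complex.Re (partials s f y)) x (delta_mx ord0 i) /\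
    derivable (fun y => complex.Im (partials s f y)) x (delta_mx ord0 i).

Definition schwartz f := smooth f /\
  forall (s : seq 'I_n) (k : nat), exists C : R, forall x,
    (1 + `|x|) ^+ k * cmod (partials s f x) <= C.

(* Since the annulus is closed, this bounds the support (a closure). *)
Definition supported_in_annulus (a b : R) f :=
  forall xi, f xi != 0 -> a <= enorm xi <= b.

End complex_functions.

Section besov.
Context {R : realType} {n : nat}.
Implicit Types (f g h phi : 'rV[R]_n -> R[i]) (u : ('rV[R]_n -> R[i]) -> R[i]).
Implicit Types (s p q : R) (j : int).

(* Functionals are total; only their values on Schwartz functions matter. *)
Definition tempered u :=
  (forall (a : R[i]) g h, schwartz g -> schwartz h ->
     u (fun x => a * g x + h x) = a * u g + u h) /\
  exists (C : R) (k : nat), forall g (B : R), schwartz g ->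
    (forall (l : seq 'I_n) (x : 'rV[R]_n), (size l <= k)%N ->
       (1 + `|x|) ^+ k * cmod (partials l g x) <= B) ->
    cmod (u g) <= C * B.

Definition regular f : ('rV[R]_n -> R[i]) -> R[i] :=
  fun g => cint (fun x => f x * g x).

Definition littlewood_paley (c1 c2 : R) phi :=
  [/\ schwartz phi,
      forall xi, complex.Im (fourier phi xi) = 0,
      forall xi eta, enorm xi = enorm eta -> fourier phi xi = fourier phi eta,
      supported_in_annulus c1 c2 (fourier phi) &
      forall xi : 'rV[R]_n, xi != 0 ->
        \sum_(j \in [set: int]) fourier phi ((2 : R) ^ (- j) *: xi) = 1].

Definition dyadic phi j : 'rV[R]_n -> R[i] :=
  fun x => ((2 : R) ^ (j * n%:Z))%:C * phi ((2 : R) ^ j *: x).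

(* The convolution of phi_j with a tempered distribution is a function. *)
Definition block phi j u : 'rV[R]_n -> R[i] :=
  fun x => u (fun y => dyadic phi j (x - y)).

Definition besov_norm phi s p q u : \bar R :=
  ((\esum_(j in [set: int])
      ((2 `^ (j%:~R * s * q))%:E * Lp_norm p (block phi j u) `^ q)) `^ q^-1)%E.

(* Members are given by representatives: the functions phi_j (x - .) have all
   moments zero, so [besov_norm] only depends on u modulo polynomials. *)
Definition besov phi s p q : set (('rV[R]_n -> R[i]) -> R[i]) :=
  [set u | tempered u /\ (besov_norm phi s p q u < +oo)%E].

Definition Lp_besov phi s p q : set ('rV[R]_n -> R[i]) :=
  [set f | Lp p f /\ besov phi s p q (regular f)].

End besov.

Section wavelets.
Context {R : realType} {n : nat}.
Implicit Types (f g h psi : 'rV[R]_n -> R[i]) (j : int) (k : 'rV[int]_n).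

Definition wavelet h j k : 'rV[R]_n -> R[i] := fun x =>
  (2 `^ (j%:~R * n%:R / 2))%:C * h ((2 : R) ^ j *: x - map_mx intr k).

Definition windex (L : nat) : Type := ('I_L * int * 'rV[int]_n)%type.
HB.instance Definition _ L := Choice.on (windex L).

Definition wsystem L (psi : 'I_L -> 'rV[R]_n -> R[i]) (l : windex L) :=
  wavelet (psi l.1.1) l.1.2 l.2.

Definition lincomb (I : choiceType) (e : I -> 'rV[R]_n -> R[i])
    (Lam : {fset I}) (c : I -> R[i]) : 'rV[R]_n -> R[i] :=
  fun x => \sum_(l <- Lam) c l * e l x.

Definition total_L2 (I : choiceType) (e : I -> 'rV[R]_n -> R[i]) :=
  (forall l, Lp 2 (e l)) /\
  forall f, Lp 2 f -> forall eps : R, 0 < eps ->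
    exists (Lam : {fset I}) (c : I -> R[i]),
      (Lp_norm 2 (f \- lincomb e Lam c)%R < eps%:E)%E.

Definition riesz_basis (I : choiceType) (e : I -> 'rV[R]_n -> R[i]) :=
  total_L2 e /\
  exists A B : R, [/\ 0 < A, 0 < B &
    forall (Lam : {fset I}) (c : I -> R[i]),
      ((A * \sum_(l <- Lam) cmod (c l) ^+ 2)%:E <=
         Lp_norm 2 (lincomb e Lam c) `^ 2 <=
       (B * \sum_(l <- Lam) cmod (c l) ^+ 2)%:E)%E].

Definition biorthogonal (I : choiceType) (e e' : I -> 'rV[R]_n -> R[i]) :=
  forall l m, inner (e l) (e' m) = (l == m)%:R.

Definition orthonormal_basis (I : choiceType) (e : I -> 'rV[R]_n -> R[i]) :=
  total_L2 e /\ biorthogonal e e.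

(* The series converges unconditionally in L^2. *)
Definition expands_in (I : choiceType) (e e' : I -> 'rV[R]_n -> R[i]) :=
  forall f, Lp 2 f -> forall eps : R, 0 < eps ->
    exists Lam0 : {fset I}, forall Lam : {fset I}, (Lam0 `<=` Lam)%fset ->
      (Lp_norm 2 (f \- lincomb e Lam (fun l => inner f (e' l)))%R < eps%:E)%E.

(* A function whose Fourier transform is in C_c^infty agrees almost everywhere
   with a unique continuous function, which is integrable; decay envelopes
   involve pointwise values, so this representative is the generator. *)
Definition band_limited (a b : R) psi :=
  [/\ ccontinuous psi, cintegrable psi, smooth (fourier psi) &
      supported_in_annulus a b (fourier psi)].

Definition biorthogonal_wavelets L (a b : R)
    (psi dpsi : 'I_L -> 'rV[R]_n -> R[i]) :=
  [/\ forall e, band_limited a b (psi e) /\ band_limited a b (dpsi e),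
      riesz_basis (wsystem psi), riesz_basis (wsystem dpsi),
      biorthogonal (wsystem psi) (wsystem dpsi) &
      expands_in (wsystem psi) (wsystem dpsi)].

Definition nterm_error L (psi : 'I_L -> 'rV[R]_n -> R[i]) (N : nat) (p : R) f :
    \bar R :=
  ereal_inf [set Lp_norm p (f \- lincomb (wsystem psi) z.1 z.2) |
    z in [set z : {fset windex L} * (windex L -> R[i]) | (#|` z.1| <= N)%N]].

(* The sum of psi_{0,k} over k in {1, ..., 2N} x {0}^(n-1). *)
Definition fN psi (N : nat) : 'rV[R]_n -> R[i] := fun x =>
  \sum_(1 <= m < (2 * N).+1)
    wavelet psi 0 (\row_(i < n) (if i == 0%N :> nat then m%:Z else 0)) x.

End wavelets.

Section constants.
Context {R : realType} {n : nat}.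
Implicit Types (h phi psi : 'rV[R]_n -> R[i]) (s p q : R).

(* For m = 0 the constraint is void, giving sup |h|. *)
Definition envelope h (m : nat) : \bar R :=
  ereal_sup [set (cmod (h z))%:E | z in [set z | m%:R - 1 <= `|z| :> R]].

(* Extended-real valued, with x^-1 = 0 at +oo; finite for the band-limited
   functions it is applied to, as these are rapidly decreasing. *)
Definition envelope_sum h (r : R) : \bar R :=
  (\sum_(0 <= i <oo)
     (envelope h i - envelope h i.+1) * ((2 * i + 1)%:R `^ r)%:E)%E.

(* p / (p - 1) is the conjugate exponent of p. *)
Definition K_U p h : \bar R := envelope_sum h (n%:R + n%:R / (p / (p - 1))).

Definition K_L p h : \bar R := envelope_sum h (n%:R + n%:R / p).

Definition band_radius (a b c1 c2 : R) : int :=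
  Num.ceil (Num.max (Num.max (ln (b / c1) / ln 2) (ln (c2 / a) / ln 2)) 0).

Definition C_band s q (M : int) : R :=
  (\sum_(i \in [set i : int | `|i| <= M]) 2 `^ (i%:~R * s * q)) `^ q^-1.

Definition K_eta p phi psi (M : int) : \bar R :=
  ereal_sup [set K_U p (conv (dyadic phi i) psi) |
    i in [set i : int | `|i| <= M]].

End constants.

Section meyer.
Context {R : realType}.

Definition meyer_cutoff (nu : R -> R) :=
  [/\ forall (k : nat) x, derivable (derive1n k nu) x 1,
      forall x, x <= 0 -> nu x = 0,
      forall x, 1 <= x -> nu x = 1 &
      forall x, nu x + nu (1 - x) = 1].

Definition meyer_hat (nu : R -> R) (xi : R) : R[i] :=
  if 1 / 3 <= `|xi| <= 2 / 3 then
    cexp (pi * xi) * (sin (pi / 2 * nu (3 * `|xi| - 1)))%:C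
  else if 2 / 3 <= `|xi| <= 4 / 3 then
    cexp (pi * xi) * (cos (pi / 2 * nu (3 / 2 * `|xi| - 1)))%:C
  else 0.

Definition meyer_wavelet (nu : R -> R) (psi : 'rV[R]_1 -> R[i]) :=
  [/\ meyer_cutoff nu, ccontinuous psi, cintegrable psi &
      forall xi, fourier psi xi = meyer_hat nu (xi ord0 ord0)].

End meyer.

(* Main.v *)
(** The lower bound is duality.  If [Lam] has at most [N] elements, at least [N]
    of the [2N] shifts [k] in the sum [f_N] satisfy [(1,0,k) \notin Lam]; let
    [G] be the sum of the dual translates over these shifts.  Biorthogonality
    gives [<f_N - g, G> = #G] for every combination [g] over [Lam], and
    Hoelder's inequality together with [|G|_(p') <= K_L #G^(1/p')] concludes.
    The [L^p] norm of a sum of translates of [h] is controlled by writing [|h|]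
    as a superposition of indicators of balls, weighted by the steps of the
    decay envelope.  The same estimate applied to [phi_j * psi] bounds the Besov
    norm, as these convolutions vanish for [|j| > M].

    The decay of the generators requires Fourier inversion on R^n.  No Gaussian
    is needed: the Littlewood-Paley function [phi] is itself a summability
    kernel, since its transform has compact support.  This yields the inversion
    formula up to a constant independent of the function, which is enough both
    for decay and for the vanishing of [phi_j * psi]. *)

Require Import Defs.
From HB Require Import structures.
From mathcomp Require Import all_boot all_order all_algebra finmap.
From mathcomp Require Import complex.
From mathcomp Require Import all_classical all_reals all_analysis.
From mathcomp Require Import measurable_realfun zify ring lra.

Set Implicit Arguments.
Unset Strict Implicit.
Unset Printing Implicit Defensive.

Import Order.TTheory GRing.Theory Num.Def Num.Theory.
Import numFieldNormedType.Exports.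

Local Open Scope classical_set_scope.
Local Open Scope ring_scope.
Local Open Scope complex_scope.

(** * Lebesgue measure on R^n *)

(** Every term of f_N lives at scale 0, so only the blocks |j| <= M see it and the smoothness s
    enters merely through the constant C'_M. Norm and error therefore both grow like N^(1/p), which
    leaves no room for a rate. The length 2N is exactly what leaves N shifts free whichever N
    indices are removed. For sums of translates no interpolation theorem is used. If W is the
    envelope sum of h with an exponent r >= n, then the sum H of the translates of |h| is at most W
    pointwise, and its integral is at most W times the number of translates. From |f|^p <= W^(p-1) H
    one gets the bound W times that number to the power 1/p. The exponents n + n/p of [K_L] and n +
    n/p' of [K_U] are both at least n, so one lemma serves both constants. The constants are
    extended reals, so they must be shown finite, and [K_L] positive, before anything is divided.
    Finiteness comes from rapid decrease, positivity from Hoelder's inequality for a single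
    shift. *)

Section affine_change_of_variables.
Context {R : realType}.
Local Open Scope ereal_scope.

(** Packages a scaled pushforward as a measure, so that the uniqueness theorems for Lebesgue and
    product measures apply to it. *)
Lemma scaled_pushforward d1 d2 (T1 : measurableType d1) (T2 : measurableType d2)
    (m : {measure set T1 -> \bar R}) (f : T1 -> T2) (c : R) :
  (0 <= c)%R -> measurable_fun setT f ->
  exists m' : {measure set T2 -> \bar R}, forall A, m' A = c%:E * m (f @^-1` A).
Proof.
move=> c0 mf.
by exists (mscale (NngNum c0) (measure_function_pushforward__canonical__measure_function_Measure m mf)).
Qed.

(** By uniqueness of Lebesgue measure: |r| times the pushforward gives half-open intervals their
    length. *)
Lemma lebesgue_measure_affine (r v : R) (A : set R) : r != 0%R ->
  measurable A ->
  lebesgue_measure ((fun x => r * x + v)%R @^-1` A) =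
    (`|r|^-1)%:E * lebesgue_measure A.
Proof.
move=> r0 mA.
have mf : measurable_fun setT (fun x : measurableTypeR R => (r * x + v)%R : measurableTypeR R).
  apply: measurable_funD => //; exact: measurable_funM.
have [mu muE] := scaled_pushforward lebesgue_measure (normr_ge0 r) mf.
have E : lebesgue_measure A = `|r|%:E * lebesgue_measure ((fun x => r * x + v)%R @^-1` A).
  rewrite -[RHS]muE; apply: (@lebesgue_measure_unique R mu) => //.
  move=> X oX; rewrite [RHS]muE; case: oX => -[a b] _ <- /=.
  have [rp|rn'|] := ltrgt0P r; last by move/eqP; rewrite (negbTE r0).
    have -> : (fun x => r * x + v)%R @^-1` `]a, b] = `]((a - v) / r)%R, ((b - v) / r)%R]%classic.
      apply/seteqP; split => x /=; rewrite !in_itv/= ltr_pdivrMr// ler_pdivlMr// (mulrC x) ltrBlDr lerBrDr//.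
    rewrite !lebesgue_measure_itv/= !lte_fin ltr_pM2r ?invr_gt0// ltrD2r.
    case: ifPn => _; last by rewrite mule0.
    by rewrite -!EFinD -EFinM; congr EFin; field; rewrite gt_eqF.
  (* A negative slope swaps the endpoints and moves the closed end to the left; the length is
     unaffected. *)
  have -> : (fun x => r * x + v)%R @^-1` `]a, b] = `[((b - v) / r)%R, ((a - v) / r)%R[%classic.
    apply/seteqP; split => x /=; rewrite !in_itv/= ler_ndivrMr// ltr_ndivlMr// (mulrC x) ltrBlDr lerBrDr// andbC//.
  rewrite !lebesgue_measure_itv/= !lte_fin ltr_nM2r ?invr_lt0// ltrD2r.
  case: ifPn => _; last by rewrite mule0.
  by rewrite -!EFinD -EFinM; congr EFin; field; rewrite lt_eqF.
by rewrite [in RHS]E muleA -EFinM mulVf ?normr_eq0// mul1e.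
Qed.

Lemma cons_rV0 n (z : R * 'rV[R]_n) : cons_rV z ord0 ord0 = z.1.
Proof.
rewrite mxE; case: splitP => j; first by rewrite ord1 mxE eqxx mulr1n.
by move/eqP.
Qed.

Lemma cons_rVS n (z : R * 'rV[R]_n) j : cons_rV z ord0 (lift ord0 j) = z.2 ord0 j.
Proof. by rewrite /cons_rV -rshift1 (@row_mxEr _ 1 1). Qed.

(** One family for translations (r = 1), dilations (v = 0) and reflections (r = -1), so that a
    single change of variables covers them all. *)
Definition affine_rV n (r : R) (v x : 'rV[R]_n) : 'rV[R]_n := (r *: x + v)%R.

Lemma measurable_affine_rV n r v : measurable_fun setT (@affine_rV n r v).
Proof.
apply: measurable_rV => i; rewrite /affine_rV.
rewrite (_ : (fun _ => _) = (fun x : 'rV[R]_n => r * x ord0 i + v ord0 i)%R).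
  apply: measurable_funD => //; apply: measurable_funM => //.
  exact: measurable_coord.
by apply/funext => x; rewrite !mxE.
Qed.

(** Induction on the dimension: [cons_rV] conjugates the affine map to a product map [P], and
    |r|^(n+1) times the pushforward of the product measure by [P] is identified on rectangles, where
    the one-dimensional case and the induction hypothesis apply. *)
Lemma lebesgue_rV_affine n (r : R) (v : 'rV[R]_n) (A : set 'rV[R]_n) :
  r != 0%R -> measurable A ->
  lebesgue_rV n (affine_rV r v @^-1` A) = (`|r| ^- n)%:E * lebesgue_rV n A.
Proof.
move=> r0; elim: n v A => [|n IH] v A mA.
  rewrite expr0 invr1 mul1e; congr (lebesgue_rV 0 _).
  by apply/seteqP; split => x; rewrite /preimage /mkset;
    rewrite (_ : affine_rV r v x = x)//; apply/rowP => -[].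
have mc := @measurable_cons_rV R n.
have mcA : measurable (@cons_rV R n @^-1` A).
  by rewrite -[X in measurable X]setTI; exact: (mc measurableT).
pose v0 := v ord0 ord0; pose v1 : 'rV[R]_n := (\row_i v ord0 (lift ord0 i))%R.
pose P (z : measurableTypeR R * 'rV[R]_n) : measurableTypeR R * 'rV[R]_n :=
  ((r * z.1 + v0)%R, affine_rV r v1 z.2).
have mP : measurable_fun setT P.
  apply/measurable_fun_pairP; split.
    apply: measurable_funD => //; apply: measurable_funM => //.
  exact: (measurableT_comp (@measurable_affine_rV n r v1) measurable_snd).
have PE z : cons_rV (P z) = affine_rV r v (cons_rV z).
  apply/rowP => i; case: (unliftP ord0 i) => [j ->|->].
    apply: etrans (cons_rVS _ _) _; rewrite /affine_rV [RHS]mxE [X in _ = (X + _)%R]mxE.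
    by rewrite /P/= mxE /v1 ![in LHS]mxE; congr (_ * _ + _)%R; exact/esym/cons_rVS.
  apply: etrans (cons_rV0 _) _; rewrite /affine_rV [RHS]mxE [X in _ = (X + _)%R]mxE.
  by congr (_ * _ + _)%R; exact/esym/cons_rV0.
pose mu := (@lebesgue_measure R \x lebesgue_rV n).
have rn : (0 <= `|r| ^+ n.+1)%R by rewrite exprn_ge0.
have [m' m'E] := scaled_pushforward mu rn mP.
rewrite /= /lebesgue_rVS /pushforward.
rewrite (_ : @cons_rV R n @^-1` (affine_rV r v @^-1` A) = P @^-1` (@cons_rV R n @^-1` A)); last first.
  by apply/seteqP; split => z; rewrite /preimage/mkset PE.
have -> : (lebesgue_measure \x lebesgue_rV n) (@cons_rV R n @^-1` A) = m' (@cons_rV R n @^-1` A).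
  apply: product_measure_unique => // B C mB mC.
  rewrite m'E.
  rewrite (_ : P @^-1` _ = ((fun x => r * x + v0)%R @^-1` B) `*` (affine_rV r v1 @^-1` C))//.
  have mB' : measurable ((fun x : measurableTypeR R => r * x + v0)%R @^-1` B).
    rewrite -[X in measurable X]setTI.
    by apply: (measurable_funD _ _ ) => //; exact: measurable_funM.
  have mC' : measurable (affine_rV r v1 @^-1` C).
    by rewrite -[X in measurable X]setTI; exact: (@measurable_affine_rV n r v1 measurableT).
  rewrite /mu; have /= -> := product_measure1E (@lebesgue_measure R) (lebesgue_rV n) mB' mC'; rewrite [lebesgue_measure _]lebesgue_measure_affine// IH//.
  rewrite muleACA !muleA -!EFinM exprS.
  rewrite (_ : _ * _ * _ / _ = 1)%R ?mul1e//.
  by rewrite -mulrA mulrACA !mulfV ?mulr1// ?expf_neq0 ?normr_eq0.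
rewrite m'E muleA -EFinM mulVf ?mul1e//.
by rewrite expf_neq0 ?normr_eq0.
Qed.

End affine_change_of_variables.

(** * Measurability of continuous functions and volume of balls *)

Section rV_norm_measurability.
Context {R : realType}.

Lemma rV_norm_leP n (x : 'rV[R]_n) (r : R) : 0 <= r ->
  reflect (forall i, `|x ord0 i| <= r) (`|x| <= r).
Proof.
move=> r0; rewrite [X in X <= r]/Num.norm/= mx_normrE; apply: (iffP idP).
  move=> /bigmax_leP[_ xr] i; exact: (xr (ord0, i)).
by move=> xr; apply/bigmax_leP; split => // -[i j] _ /=; rewrite ord1.
Qed.

Lemma rV_norm_coord n (x : 'rV[R]_n) i : `|x ord0 i| <= `|x|.
Proof. exact: (elimT (rV_norm_leP _ _) (lexx _)). Qed.

(** Rounding down to the grid of mesh 1/(m+1) leaves countably many points, each reached from a box,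
    so measurability holds for an arbitrary [f]. *)
Lemma measurable_rV_comp_floor n m (f : 'rV[R]_n -> R) :
  measurable_fun setT (fun x : 'rV[R]_n =>
    f (\row_i ((floor (m.+1%:R * x ord0 i))%:~R / m.+1%:R))).
Proof.
move=> _ Y mY; rewrite setTI.
pose q (z : 'rV[int]_n) : 'rV[R]_n := \row_i ((z ord0 i)%:~R / m.+1%:R).
pose k (x : 'rV[R]_n) : 'rV[int]_n := \row_i floor (m.+1%:R * x ord0 i).
pose F (z : 'rV[int]_n) : set 'rV[R]_n := if f (q z) \in Y then [set x | k x = z] else set0.
have -> : (fun x : 'rV[R]_n => f (\row_i ((floor (m.+1%:R * x ord0 i))%:~R / m.+1%:R))) @^-1` Y = \bigcup_z F z.
  have E (x : 'rV[R]_n) : \row_i ((floor (m.+1%:R * x ord0 i))%:~R / m.+1%:R) = q (k x).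
    by apply/rowP => i; rewrite !mxE.
  apply/seteqP; split => x; rewrite /preimage /mkset.
    by rewrite E => Yx; exists (k x) => //; rewrite /F mem_set.
  by move=> [z _]; rewrite /F; case: ifPn => // /set_mem Yz /= kz; rewrite E kz.
apply: countable_bigcupT_measurable; first exact: countableP.
move=> z; rewrite /F; case: ifPn => // _.
have -> : [set x | k x = z] = \bigcap_(i in [set: 'I_n])
    ((fun x : 'rV[R]_n => x ord0 i) @^-1` (`[((z ord0 i)%:~R / m.+1%:R)%R, ((z ord0 i + 1)%:~R / m.+1%:R)%R[)%classic).
  have m0 : 0 < m.+1%:R :> R by [].
  apply/seteqP; split => x /=.
    move=> kz i _ /=; rewrite in_itv/= -kz mxE ler_pdivrMr// ltr_pdivlMr// mulrC.
    exact: floor_itv.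
  move=> xz; apply/rowP => i; rewrite mxE; apply: floor_def.
  by have := xz i I; rewrite /= in_itv/= ler_pdivrMr// ltr_pdivlMr// mulrC.
apply: fin_bigcap_measurable => // i _.
by rewrite -[X in measurable X]setTI; apply: measurable_coord.
Qed.

(** The sigma-algebra is generated by the coordinates, so continuity is used through the grid
    approximations of [f], which converge to it pointwise. *)
Lemma continuous_measurable_rV n (f : 'rV[R]_n -> R) :
  continuous f -> measurable_fun setT f.
Proof.
move=> cf.
apply: (measurable_fun_cvg (fun m => @measurable_rV_comp_floor n m f)) => x _.
apply: (continuous_cvg _ (cf x)).
apply/cvgrPdist_le => e e0.
have /cvgrPdist_le/(_ _ e0) := @cvg_harmonic R.
apply: filterS => m; rewrite sub0r normrN ger0_norm ?harmonic_ge0// => me.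
apply/rV_norm_leP => [|i]; first exact: ltW.
rewrite !mxE; have m0 : 0 < m.+1%:R :> R by [].
have /andP[l u] := floor_itv (m.+1%:R * x ord0 i).
apply: le_trans me; rewrite /harmonic ler_norml; apply/andP; split.
  rewrite (le_trans (_ : _ <= 0)) ?oppr_le0 ?invr_ge0//.
  rewrite subr_ge0 ler_pdivrMr//. by rewrite [leRHS]mulrC.
rewrite lerBlDr -[X in X + _]mul1r -mulrDl ler_pdivlMr// [leLHS]mulrC addrC ltW//.
by rewrite -intrD1.
Qed.

Lemma measurable_rV_norm n : measurable_fun setT (fun x : 'rV[R]_n => `|x| : R).
Proof. by apply: continuous_measurable_rV; exact: norm_continuous. Qed.

Lemma measurable_rV_ball n (r : R) : measurable [set x : 'rV[R]_n | `|x| <= r].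
Proof.
rewrite [X in measurable X](_ : _ = (fun x : 'rV[R]_n => `|x| : R) @^-1` `]-oo, r]%classic).
  by rewrite -[X in measurable X]setTI; apply: measurable_rV_norm.
by apply/seteqP; split => x /=; rewrite in_itv.
Qed.

(** Balls of the maximum norm are cubes, so [cons_rV] splits off one interval at a time. *)
Lemma lebesgue_rV_ball n (r : R) : 0 <= r ->
  lebesgue_rV n [set x : 'rV[R]_n | `|x| <= r] = ((2 * r) ^+ n)%:E.
Proof.
move=> r0; elim: n => [|n IH].
  rewrite /= diracE expr0 mem_set//=; apply/rV_norm_leP => // -[].
  by [].
rewrite /= /lebesgue_rVS /pushforward.
rewrite (_ : _ @^-1` _ = `[- r, r]%classic `*` [set x : 'rV[R]_n | `|x| <= r]).
  rewrite product_measure1E//; last exact: measurable_rV_ball.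
  rewrite /= IH lebesgue_measure_itv/= lte_fin.
  case: ltrP => rr.
    by rewrite -EFinD -EFinM opprK exprS; congr EFin; congr (_ * _); ring.
  have -> : r = 0 by lra.
  by rewrite mul0e mulr0 exprS mul0r.
apply/seteqP; split => -[t y]; rewrite /preimage /setX/= in_itv/= -ler_norml.
  move=> /(rV_norm_leP _ r0) H; split; first by have := H ord0; rewrite (cons_rV0 (t, y)).
  by apply/rV_norm_leP => // i; have := H (lift ord0 i); rewrite (cons_rVS (t, y)).
move=> [tr /(rV_norm_leP _ r0) yr]; apply/rV_norm_leP => // i.
by case: (unliftP ord0 i) => [j ->|->]; rewrite ?(cons_rVS (t,y)) ?(cons_rV0 (t, y))//=.
Qed.

End rV_norm_measurability.

(** * Integration of complex functions *)

Section complex_modulus.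
Context {R : realType}.
Implicit Types x y z : R[i].

Lemma ReD x y : complex.Re (x + y) = complex.Re x + complex.Re y.
Proof. by case: x; case: y. Qed.

Lemma ImD x y : complex.Im (x + y) = complex.Im x + complex.Im y.
Proof. by case: x; case: y. Qed.

Lemma ReN x : complex.Re (- x) = - complex.Re x.
Proof. by case: x. Qed.

Lemma ImN x : complex.Im (- x) = - complex.Im x.
Proof. by case: x. Qed.

Lemma ReM x y : complex.Re (x * y) =
  complex.Re x * complex.Re y - complex.Im x * complex.Im y.
Proof. by case: x; case: y. Qed.

Lemma ImM x y : complex.Im (x * y) =
  complex.Re x * complex.Im y + complex.Im x * complex.Re y.
Proof. by case: x; case: y. Qed.

Lemma ReJ x : complex.Re (conjc x) = complex.Re x.
Proof. by case: x. Qed.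

Lemma ImJ x : complex.Im (conjc x) = - complex.Im x.
Proof. by case: x. Qed.

Lemma complex_eq x y : complex.Re x = complex.Re y ->
  complex.Im x = complex.Im y -> x = y.
Proof. by case: x; case: y => a b c d /= -> ->. Qed.

Lemma cmodE z : cmod z = Num.sqrt (complex.Re z ^+ 2 + complex.Im z ^+ 2).
Proof. by case: z. Qed.

Lemma cmod_ge0 z : 0 <= cmod z.
Proof. by rewrite cmodE sqrtr_ge0. Qed.

Lemma sqr_cmod z : cmod z ^+ 2 = complex.Re z ^+ 2 + complex.Im z ^+ 2.
Proof. by rewrite cmodE sqr_sqrtr// addr_ge0// sqr_ge0. Qed.

Lemma cmodM x y : cmod (x * y) = cmod x * cmod y.
Proof. exact: ComplexField.Normc.normcM. Qed.

Lemma cmodD x y : cmod (x + y) <= cmod x + cmod y.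
Proof. exact: le_normcD. Qed.

Lemma cmod0 : cmod (0 : R[i]) = 0.
Proof. exact: ComplexField.Normc.normc0. Qed.

Lemma cmodJ x : cmod (conjc x) = cmod x.
Proof. by rewrite !cmodE ReJ ImJ sqrrN. Qed.

Lemma cmod_real (r : R) : cmod r%:C = `|r|.
Proof. by rewrite cmodE/= expr0n addr0 sqrtr_sqr. Qed.

Lemma cmod_eq0 z : (cmod z == 0) = (z == 0).
Proof.
apply/eqP/eqP => [|->]; last exact: cmod0.
exact: ComplexField.Normc.eq0_normc.
Qed.

Lemma cmod_sum (I : Type) (r : seq I) (P : pred I) (F : I -> R[i]) :
  cmod (\sum_(i <- r | P i) F i) <= \sum_(i <- r | P i) cmod (F i).
Proof.
elim/big_ind2 : _ => // [|x a y b xa yb]; first by rewrite cmod0.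
by rewrite (le_trans (cmodD _ _))// lerD.
Qed.

Lemma le_Re_cmod z : `|complex.Re z| <= cmod z.
Proof.
by rewrite cmodE -sqrtr_sqr ler_sqrt ?lerDl ?sqr_ge0// addr_ge0// sqr_ge0.
Qed.

Lemma le_Im_cmod z : `|complex.Im z| <= cmod z.
Proof.
by rewrite cmodE -sqrtr_sqr ler_sqrt ?lerDr ?sqr_ge0// addr_ge0// sqr_ge0.
Qed.

Lemma le_cmod_ReIm z : cmod z <= `|complex.Re z| + `|complex.Im z|.
Proof.
rewrite -(@ler_pXn2r _ 2)// ?nnegrE ?cmod_ge0 ?addr_ge0//.
rewrite sqr_cmod sqrrD !real_normK ?num_real// [leRHS]addrAC.
by rewrite lerDl mulrn_wge0// mulr_ge0.
Qed.

Lemma cexpD (s t : R) : cexp (s + t) = cexp s * cexp t.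
Proof. by apply: complex_eq; rewrite ?ReM ?ImM /= ?cosD ?sinD//; ring. Qed.

Lemma cmod_cexp (t : R) : cmod (cexp t) = 1.
Proof. by rewrite cmodE /= cos2Dsin2 sqrtr1. Qed.

Lemma conj_cexp (t : R) : conjc (cexp t) = cexp (- t).
Proof. by rewrite /cexp cosN sinN. Qed.

End complex_modulus.

Section complex_measurability.
Context d (T : measurableType d) {R : realType}.
Implicit Types f g : T -> R[i].

(** [cmeasurable] over an arbitrary domain: Fubini needs it on products. *)
Definition cmeas f :=
  measurable_fun setT (fun x => complex.Re (f x)) /\
  measurable_fun setT (fun x => complex.Im (f x)).

Lemma cmeas_cst (a : R[i]) : cmeas (fun _ => a).
Proof. by split; exact: measurable_cst. Qed.

Lemma cmeasD f g : cmeas f -> cmeas g -> cmeas (fun x => f x + g x).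
Proof.
move=> [fr fi] [gr gi]; split.
  by under eq_fun do rewrite ReD; exact: measurable_funD.
by under eq_fun do rewrite ImD; exact: measurable_funD.
Qed.

Lemma cmeasN f : cmeas f -> cmeas (fun x => - f x).
Proof.
move=> [fr fi]; split.
  by under eq_fun do rewrite ReN; exact: measurable_funN.
by under eq_fun do rewrite ImN; exact: measurable_funN.
Qed.

Lemma cmeasB f g : cmeas f -> cmeas g -> cmeas (fun x => f x - g x).
Proof. by move=> mf mg; apply: cmeasD => //; exact: cmeasN. Qed.

Lemma cmeasM f g : cmeas f -> cmeas g -> cmeas (fun x => f x * g x).
Proof.
move=> [fr fi] [gr gi]; split.
  by under eq_fun do rewrite ReM; apply: measurable_funB; exact: measurable_funM.
by under eq_fun do rewrite ImM; apply: measurable_funD; exact: measurable_funM.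
Qed.

Lemma cmeasJ f : cmeas f -> cmeas (fun x => conjc (f x)).
Proof.
move=> [fr fi]; split.
  by under eq_fun do rewrite ReJ.
by under eq_fun do rewrite ImJ; exact: measurable_funN.
Qed.

Lemma cmeas_sum (I : Type) (r : seq I) (F : I -> T -> R[i]) :
  (forall i, cmeas (F i)) -> cmeas (fun x => \sum_(i <- r) F i x).
Proof.
move=> mF; elim: r => [|i r IH].
  by under [X in cmeas X]eq_fun do rewrite big_nil; exact: cmeas_cst.
by under [X in cmeas X]eq_fun do rewrite big_cons; exact: cmeasD.
Qed.

Lemma cmeas_cexp (h : T -> R) : measurable_fun setT h -> cmeas (fun x => cexp (h x)).
Proof.
move=> mh; split => /=.
  by apply: measurableT_comp mh; apply: continuous_measurable_fun; exact: continuous_cos.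
by apply: measurableT_comp mh; apply: continuous_measurable_fun; exact: continuous_sin.
Qed.

Lemma measurable_cmod f : cmeas f -> measurable_fun setT (fun x => cmod (f x)).
Proof.
move=> [fr fi]; under eq_fun do rewrite cmodE.
apply: (@measurableT_comp _ _ _ _ _ _ (@Num.sqrt R)).
  by apply: continuous_measurable_fun; exact: sqrt_continuous.
by apply: measurable_funD; exact: measurable_funX.
Qed.

End complex_measurability.

Lemma cmeas_comp d1 d2 (T1 : measurableType d1) (T2 : measurableType d2)
    (R : realType) (f : T2 -> R[i]) (h : T1 -> T2) :
  cmeas f -> measurable_fun setT h -> cmeas (fun x => f (h x)).
Proof. by move=> [fr fi] mh; split; [exact: (measurableT_comp fr)|exact: (measurableT_comp fi)]. Qed.

Lemma continuous_cmeasurable (R : realType) n (f : 'rV[R]_n -> R[i]) :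
  ccontinuous f -> cmeasurable f.
Proof. by move=> [fr fi]; split; exact: continuous_measurable_rV. Qed.

Lemma measurable_dotp (R : realType) n d (T : measurableType d) (f g : T -> 'rV[R]_n) :
  measurable_fun setT f -> measurable_fun setT g ->
  measurable_fun setT (fun t => dotp (f t) (g t)).
Proof.
move=> mf mg; rewrite /dotp; apply: measurable_sum => i.
apply: measurable_funM; first exact: (measurableT_comp (measurable_coord i) mf).
exact: (measurableT_comp (measurable_coord i) mg).
Qed.

Lemma measurable_rVD (R : realType) n d (T : measurableType d) (f g : T -> 'rV[R]_n) :
  measurable_fun setT f -> measurable_fun setT g ->
  measurable_fun setT (fun t => f t + g t).
Proof.
move=> mf mg; apply: measurable_rV => i; under eq_fun do rewrite mxE.
apply: measurable_funD; first exact: (measurableT_comp (measurable_coord i) mf).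
exact: (measurableT_comp (measurable_coord i) mg).
Qed.

Lemma measurable_rVZ (R : realType) n d (T : measurableType d) (r : R) (f : T -> 'rV[R]_n) :
  measurable_fun setT f -> measurable_fun setT (fun t => r *: f t).
Proof.
move=> mf; apply: measurable_rV => i; under eq_fun do rewrite mxE.
by apply: measurable_funM => //; exact: (measurableT_comp (measurable_coord i) mf).
Qed.

Section integration_rV.
Context {R : realType} {n : nat}.
Notation mu := (lebesgue_rV n).
Notation rintegrable f := (mu.-integrable setT (fun x => (f x)%:E)).
Implicit Types f g : 'rV[R]_n -> R[i].
Implicit Types h : 'rV[R]_n -> R.

Lemma rintegrable_measurable h : rintegrable h -> measurable_fun setT h.
Proof. by move=> /integrableP[/measurable_EFinP]. Qed.

Lemma rintegrable_le h k : measurable_fun setT h -> rintegrable k ->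
  (forall x, `|h x| <= k x) -> rintegrable h.
Proof.
move=> mh ik hk; apply: (le_integrable measurableT _ _ ik).
  exact/measurable_EFinP.
by move=> x _; rewrite lee_fin (le_trans (hk x)) ?ler_norm.
Qed.

Lemma rintegrableZ (k : R) h : rintegrable h -> rintegrable (fun x => k * h x).
Proof. exact: integrableZl. Qed.

Lemma ge0_integral_affine (r : R) (v : 'rV[R]_n) (F : 'rV[R]_n -> \bar R) :
  r != 0 -> measurable_fun setT F -> (forall x, 0 <= F x)%E ->
  (\int[mu]_x F (affine_rV r v x) = (`|r| ^- n)%:E * \int[mu]_x F x)%E.
Proof.
move=> r0 mF F0.
have c0 : 0 <= `|r| ^- n by rewrite invr_ge0 exprn_ge0.
have := @ge0_integral_pushforward _ _ _ _ R _ (@measurable_affine_rV R n r v) mu setT F measurableT mF (fun y _ => F0 y).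
rewrite preimage_setT => <-.
have := @ge0_integral_mscale _ _ R mu setT measurableT (NngNum c0) F mF (fun y _ => F0 y).
move=> /= <-; apply: eq_measure_integral; first exact: measurable_affine_rV.
by move=> ? A mA _; exact: lebesgue_rV_affine.
Qed.

Lemma rintegrable_affine (r : R) (v : 'rV[R]_n) h : r != 0 ->
  rintegrable h -> rintegrable (fun x => h (affine_rV r v x)).
Proof.
move=> r0 /[dup] /rintegrable_measurable mh /integrableP[mh' fh].
apply/integrableP; split.
  by apply/measurable_EFinP; exact: (measurableT_comp mh (@measurable_affine_rV R n r v)).
have := @ge0_integral_affine r v (fun x => `|(h x)%:E|%E) r0.
move=> -> //; last exact: measurableT_comp.
by rewrite lte_mul_pinfty// lee_fin invr_ge0 exprn_ge0.
Qed.

Lemma Rintegral_affine (r : R) (v : 'rV[R]_n) h : r != 0 -> rintegrable h ->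
  \int[mu]_x h (affine_rV r v x) = `|r| ^- n * \int[mu]_x h x.
Proof.
move=> r0 ih; rewrite /Rintegral.
have mh : measurable_fun setT (fun x => (h x)%:E) by apply: measurable_int ih.
rewrite integralE [in RHS]integralE.
rewrite (_ : (fun x => (h (affine_rV r v x))%:E)^\+%E = (fun x => ((EFin \o h)^\+ (affine_rV r v x))%E)); last first.
  exact: (funepos_comp (EFin \o h) (affine_rV r v)).
rewrite (_ : (fun x => (h (affine_rV r v x))%:E)^\-%E = (fun x => ((EFin \o h)^\- (affine_rV r v x))%E)); last first.
  exact: (funeneg_comp (EFin \o h) (affine_rV r v)).
have := @ge0_integral_affine r v ((fun x => (h x)%:E)^\+)%E r0.
move=> /(_ (measurable_funepos mh) (fun=> funepos_ge0 _ _)).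
have := @ge0_integral_affine r v ((fun x => (h x)%:E)^\-)%E r0.
move=> /(_ (measurable_funeneg mh) (fun=> funeneg_ge0 _ _)).
move=> -> ->.
have p1 := integrable_pos_fin_num measurableT ih.
have p2 := integrable_neg_fin_num measurableT ih.
move: p1 p2; set a := integral _ _ _; set b := integral _ _ _ => p1 p2.
by rewrite -(fineK p1) -(fineK p2) -!EFinM -!EFinB /= mulrBr.
Qed.

Lemma cintegrable_meas f : cintegrable f -> cmeasurable f.
Proof. by move=> [? ?]; split; exact: rintegrable_measurable. Qed.

Lemma cintegrable_le f h : cmeasurable f -> rintegrable h ->
  (forall x, cmod (f x) <= h x) -> cintegrable f.
Proof.
move=> [mr mi] ih fh; split; apply: (rintegrable_le _ ih) => // x.
  exact: le_trans (le_Re_cmod _) (fh x).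
exact: le_trans (le_Im_cmod _) (fh x).
Qed.

Lemma rintegrable_cmod f : cintegrable f -> rintegrable (fun x => cmod (f x)).
Proof.
move=> [ir ii].
have H : rintegrable (fun x => `|complex.Re (f x)| + `|complex.Im (f x)|).
  exact: (integrableD measurableT (integrable_abse ir) (integrable_abse ii)).
apply: (rintegrable_le _ H) => [|x].
  by apply: measurable_cmod; split; exact: rintegrable_measurable.
by rewrite ger0_norm ?cmod_ge0// le_cmod_ReIm.
Qed.

Lemma cintegrableD f g : cintegrable f -> cintegrable g ->
  cintegrable (fun x => f x + g x).
Proof.
move=> [fr fi] [gr gi]; split.
  by under eq_fun do rewrite ReD EFinD; exact: integrableD.
by under eq_fun do rewrite ImD EFinD; exact: integrableD.
Qed.

Lemma cintegrableZ (a : R[i]) f : cintegrable f -> cintegrable (fun x => a * f x).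
Proof.
move=> If; have := integrableZl measurableT (cmod a) (rintegrable_cmod If).
move=> /cintegrable_le; apply.
  by apply: cmeasM; [exact: cmeas_cst|exact: cintegrable_meas].
by move=> x; rewrite cmodM.
Qed.

Lemma cintegrable_sum (I : Type) (s : seq I) (F : I -> 'rV[R]_n -> R[i]) :
  (forall i, cintegrable (F i)) -> cintegrable (fun x => \sum_(i <- s) F i x).
Proof.
move=> iF; elim: s => [|i s IH].
  under [X in cintegrable X]eq_fun do rewrite big_nil.
  by split => /=; exact: integrable0.
by under [X in cintegrable X]eq_fun do rewrite big_cons; exact: cintegrableD.
Qed.

Lemma cintD f g : cintegrable f -> cintegrable g ->
  cint (fun x => f x + g x) = cint f + cint g.
Proof.
move=> [fr fi] [gr gi]; apply: complex_eq; rewrite /cint.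
  by rewrite ReD/=; under [LHS]eq_Rintegral do rewrite ReD; rewrite RintegralD.
by rewrite ImD/=; under [LHS]eq_Rintegral do rewrite ImD; rewrite RintegralD.
Qed.

Lemma cint0 : cint (fun _ : 'rV[R]_n => 0 : R[i]) = 0.
Proof. by rewrite /cint /Rintegral/= !integral0. Qed.

Lemma cintZ (a : R[i]) f : cintegrable f -> cint (fun x => a * f x) = a * cint f.
Proof.
move=> [fr fi]; apply: complex_eq; rewrite /cint.
  rewrite ReM/=; under [LHS]eq_Rintegral do rewrite ReM.
  by rewrite RintegralB ?RintegralZl//; exact: rintegrableZ.
rewrite ImM/=; under [LHS]eq_Rintegral do rewrite ImM.
by rewrite RintegralD ?RintegralZl//; exact: rintegrableZ.
Qed.

Lemma cint_sum (I : Type) (s : seq I) (F : I -> 'rV[R]_n -> R[i]) :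
  (forall i, cintegrable (F i)) ->
  cint (fun x => \sum_(i <- s) F i x) = \sum_(i <- s) cint (F i).
Proof.
move=> iF; elim: s => [|i s IH].
  by rewrite big_nil; under [X in cint X]eq_fun do rewrite big_nil; exact: cint0.
rewrite big_cons -IH -cintD//; last exact: cintegrable_sum.
by congr cint; apply/funext => x; rewrite big_cons.
Qed.

Lemma cintJ f : cintegrable f -> cint (fun x => conjc (f x)) = conjc (cint f).
Proof.
move=> [fr fi]; apply: complex_eq; rewrite /cint.
  by rewrite ReJ/=; under [LHS]eq_Rintegral do rewrite ReJ.
rewrite ImJ/=; under [LHS]eq_Rintegral do rewrite ImJ -mulN1r.
by rewrite RintegralZl// mulN1r.
Qed.

Lemma cintegrable_affine (r : R) (v : 'rV[R]_n) f : r != 0 ->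
  cintegrable f -> cintegrable (fun x => f (affine_rV r v x)).
Proof.
move=> r0 [fr fi]; split; first exact: (rintegrable_affine v r0 fr).
exact: (rintegrable_affine v r0 fi).
Qed.

Lemma cint_affine (r : R) (v : 'rV[R]_n) f : r != 0 -> cintegrable f ->
  cint (fun x => f (affine_rV r v x)) = (`|r| ^- n)%:C * cint f.
Proof.
move=> r0 [fr fi]; apply: complex_eq; rewrite /cint ?ReM ?ImM /=.
  by rewrite (Rintegral_affine v r0 fr) mul0r subr0.
by rewrite (Rintegral_affine v r0 fi) mul0r addr0.
Qed.

(** The factor 2 comes from bounding real and imaginary parts separately; it is harmless where only
    some finite bound is wanted. *)
Lemma le_cmod_cint f h : cintegrable f -> rintegrable h ->
  (forall x, cmod (f x) <= h x) -> cmod (cint f) <= 2 * \int[mu]_x h x.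
Proof.
move=> [fr fi] ih fh; rewrite (le_trans (le_cmod_ReIm _))//= mulr2n mulrDl mul1r.
apply: lerD; rewrite (le_trans (le_normr_Rintegral _ _))//; apply: le_Rintegral => //.
- exact: integrable_norm.
- by move=> x _; exact: le_trans (le_Re_cmod _) (fh x).
- exact: integrable_norm.
- by move=> x _; exact: le_trans (le_Im_cmod _) (fh x).
Qed.

End integration_rV.

(** * Layers, polynomial decay, dominated convergence and Fubini *)

Section limits_of_integrals.
Context {R : realType}.
Notation mu := (lebesgue_rV _).
Notation rintegrable f := (mu.-integrable setT (fun x => (f x)%:E)).

(** Serves twice: for the integrability of (1 + |x|)^-(n+2) and for the L^1 bound by the envelope
    sum. Both dominate a function by a superposition of indicators of balls. *)
Lemma integral_layers n (c r : nat -> R) :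
  (forall i, 0 <= c i) -> (forall i, 0 <= r i) ->
  (\int[lebesgue_rV n]_x \sum_(0 <= i <oo) (c i * \1_[set y : 'rV[R]_n | (`|y| <= r i)%R] x)%:E =
   \sum_(0 <= i <oo) (c i * (2 * r i) ^+ n)%:E)%E.
Proof.
move=> c0 r0; rewrite integral_nneseries//.
- apply: eq_eseriesr => i _.
  rewrite (integralZl_indic measurableT (fun=> [set y : 'rV[R]_n | `|y| <= r i])).
  + rewrite integral_indic//; last exact: measurable_rV_ball.
    by rewrite setIT EFinM; congr (_ * _)%E; exact: lebesgue_rV_ball.
  + by move=> ci; have := c0 i; rewrite leNgt ci.
  + exact: measurable_rV_ball.
- move=> i; apply/measurable_EFinP; apply: measurable_funM => //.
  by apply: measurable_indic; exact: measurable_rV_ball.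
- by move=> i x _; rewrite lee_fin mulr_ge0// indicE.
Qed.

(** Telescoping: 1/(i+1)^2 <= 2/(i+1) - 2/(i+2). *)
Lemma nneseries_inv_sqr_le (C : R) : 0 <= C ->
  (\sum_(0 <= i <oo) (C * i.+1%:R ^- 2)%:E <= (C * 2)%:E)%E.
Proof.
move=> C0; apply: lime_le.
  by apply: is_cvg_nneseries => i _ _; rewrite lee_fin mulr_ge0// invr_ge0 exprn_ge0.
apply: nearW => m; rewrite sumEFin lee_fin -mulr_sumr ler_wpM2l//.
apply: (@le_trans _ _ (\sum_(0 <= i < m) (- (2 / i.+2%:R) - - (2 / i.+1%:R)))).
  apply: ler_sum => i _; rewrite opprK addrC.
  have i1 : 0 < i.+1%:R :> R by [].
  have i2 : 0 < i.+2%:R :> R by [].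
  rewrite -subr_ge0.
  have -> : 2 / i.+1%:R - 2 / i.+2%:R - i.+1%:R ^- 2 = i%:R / (i.+2%:R * i.+1%:R ^+ 2) :> R.
    have e2 : i.+2%:R = i%:R + 2 :> R by rewrite -addn2 natrD.
    have e1 : i.+1%:R = i%:R + 1 :> R by rewrite -addn1 natrD.
    rewrite e1 e2 in i1 i2 *; field.
    by rewrite !gt_eqF.
  by rewrite divr_ge0// mulr_ge0// exprn_ge0.
rewrite (telescope_sumr (fun i => - (2 / i.+1%:R)))// opprK invr1 mulr1.
by rewrite gerDr oppr_le0 divr_ge0.
Qed.

(** Layers of height (i+1)^-(n+2) on balls of radius i + 1 have total mass 2^n times the sum of
    (i+1)^-2; with exponent n + 1 this majorant would be harmonic. *)
Lemma rintegrable_poly n :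
  rintegrable (fun x : 'rV[R]_n => (1 + `|x|) ^- (n + 2)).
Proof.
have p0 (x : 'rV[R]_n) : 0 < 1 + `|x| by rewrite ltr_wpDr.
have mf : measurable_fun setT (fun x : 'rV[R]_n => (1 + `|x|) ^- (n + 2)).
  apply: continuous_measurable_rV => x.
  have H : (1 + `|y|) ^+ (n + 2) @[y --> x] --> (1 + `|x|) ^+ (n + 2).
    have H1 : `|y| @[y --> x] --> `|x| by exact: norm_continuous.
    have H2 : (1 + `|y|) @[y --> x] --> 1 + `|x|.
      by apply: cvgD H1; exact: cvg_cst.
    exact: (continuous_cvg _ (@exprn_continuous R (n + 2) _) H2).
  by apply: (cvgV _ H); rewrite expf_neq0// gt_eqF.
apply/integrableP; split; first exact/measurable_EFinP.
pose c i : R := i.+1%:R ^- (n + 2).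
have c0 i : 0 <= c i by rewrite invr_ge0 exprn_ge0.
apply: (@le_lt_trans _ _ (\sum_(0 <= i <oo) (c i * (2 * i.+1%:R) ^+ n)%:E)%E).
  rewrite -integral_layers//; apply: ge0_le_integral => //.
  - by apply: measurableT_comp => //; exact/measurable_EFinP.
  - apply: ge0_emeasurable_sum => [i x _ _|i _].
      by rewrite lee_fin mulr_ge0.
    apply/measurable_EFinP; apply: measurable_funM => //.
    by apply: measurable_indic; exact: measurable_rV_ball.
  (* The layer [i0] alone dominates: |x| < i0 + 1 puts x in its ball, and 1 + |x| >= i0 + 1 compares
     the heights. *)
  move=> x _; pose i0 := Num.truncn `|x|.
  have /andP[i0x xi0] := truncn_itv (normr_ge0 x).
  have T0 i : (0 <= (c i * \1_[set y : 'rV[R]_n | (`|y| <= i.+1%:R)%R] x)%:E)%E.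
    by rewrite lee_fin mulr_ge0.
  apply: le_trans (nneseries_lim_ge i0.+1 (fun i _ _ => T0 i)).
  rewrite big_nat_recr//=; apply: le_trans (leeDr _ _).
    rewrite lee_fin indicE mem_set/=; last exact: ltW.
    rewrite mulr1 ger0_norm; last by rewrite invr_ge0 exprn_ge0// ltW.
    rewrite /c lef_pV2 ?posrE ?exprn_gt0//.
    by rewrite lerXn2r ?nnegrE ?(ltW (p0 _))// -nat1r lerD2l.
  by apply: sume_ge0.
apply: le_lt_trans (ltry (2 ^+ n * 2)).
apply: le_trans (nneseries_inv_sqr_le _); last by rewrite exprn_ge0.
apply: lee_nneseries => i _; first by rewrite lee_fin mulr_ge0// exprn_ge0// mulr_ge0.
by rewrite lee_fin /c exprMn exprD invfM mulrCA [X in _ * X <= _]mulrAC mulVf ?mul1r//.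
Qed.

Lemma rintegrable_decay n (f : 'rV[R]_n -> R) (C : R) : measurable_fun setT f ->
  (forall x, (1 + `|x|) ^+ (n + 2) * `|f x| <= C) -> rintegrable f.
Proof.
move=> mf fC; apply: (rintegrable_le mf (rintegrableZ C (@rintegrable_poly n))) => x.
by rewrite ler_pdivlMr ?exprn_gt0 ?ltr_wpDr// mulrC.
Qed.

Lemma Rintegral_dct n (F : nat -> 'rV[R]_n -> R) (f G : 'rV[R]_n -> R) :
  (forall m, measurable_fun setT (F m)) ->
  (forall x, F ^~ x @ \oo --> f x) -> rintegrable G ->
  (forall m x, `|F m x| <= G x) ->
  \int[lebesgue_rV n]_x F m x @[m --> \oo] --> \int[lebesgue_rV n]_x f x.
Proof.
move=> mF Ff iG FG.
have mf : measurable_fun setT f by apply: (measurable_fun_cvg mF) => x _; exact: Ff.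
have := @dominated_convergence _ _ R (lebesgue_rV n) setT measurableT
  (fun m x => (F m x)%:E) (fun x => (f x)%:E) (fun x => (G x)%:E).
case.
- by move=> m; exact/measurable_EFinP.
- exact/measurable_EFinP.
- by apply: aeW => x _; apply: cvg_EFin; [exact: nearW|exact: Ff].
- by [].
- by apply: aeW => x m _; rewrite lee_fin.
move=> fi _ H; apply: fine_cvg; rewrite /Rintegral fineK//.
exact: integrable_fin_num.
Qed.

(** Tonelli gives measurability for nonnegative integrands, hence the split into positive and
    negative parts. *)
Lemma measurable_Rintegral_param d (T : measurableType d) m (F : T -> 'rV[R]_m -> R) :
  measurable_fun setT (fun z : T * 'rV[R]_m => F z.1 z.2) ->
  measurable_fun setT (fun x => \int[lebesgue_rV m]_y F x y).
Proof.
move=> mF; rewrite /Rintegral.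
have mE : measurable_fun setT (fun z : T * 'rV[R]_m => (F z.1 z.2)%:E) by exact/measurable_EFinP.
have mE2 : measurable_fun setT (fun x => \int[lebesgue_rV m]_y (F x y)%:E)%E.
  under eq_fun do rewrite integralE.
  apply: emeasurable_funB.
    have := @measurable_fun_fubini_tonelli_F _ _ T _ R (lebesgue_rV m) _ (measurable_funepos mE).
    rewrite /fubini_F => H.
    rewrite (_ : (fun _ => _) = (fun x => \int[lebesgue_rV m]_y ((fun z : T * 'rV[R]_m => (F z.1 z.2)%:E)^\+ (x, y))))%E.
      by apply: H => z; exact: funepos_ge0.
    by apply/funext => x; apply: eq_integral => y _; rewrite !funeposE.
  have := @measurable_fun_fubini_tonelli_F _ _ T _ R (lebesgue_rV m) _ (measurable_funeneg mE).
  rewrite /fubini_F => H.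
  rewrite (_ : (fun _ => _) = (fun x => \int[lebesgue_rV m]_y ((fun z : T * 'rV[R]_m => (F z.1 z.2)%:E)^\- (x, y))))%E.
    by apply: H => z; exact: funeneg_ge0.
  by apply/funext => x; apply: eq_integral => y _; rewrite !funenegE.
by apply: measurableT_comp mE2; exact: fine_measurable.
Qed.

(** A product majorant makes [F] integrable on the product space. It fits the Fourier integrals
    below, whose phases have modulus one. *)
Lemma Rintegral_fubini n m (F : 'rV[R]_n -> 'rV[R]_m -> R) G1 G2 :
  measurable_fun setT (fun z : 'rV[R]_n * 'rV[R]_m => F z.1 z.2) ->
  rintegrable G1 -> rintegrable G2 ->
  (forall x, 0 <= G1 x) -> (forall x, 0 <= G2 x) ->
  (forall x y, `|F x y| <= G1 x * G2 y) ->
  \int[lebesgue_rV n]_x \int[lebesgue_rV m]_y F x y =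
  \int[lebesgue_rV m]_y \int[lebesgue_rV n]_x F x y.
Proof.
move=> mF i1 i2 G10 G20 FG.
have mE : measurable_fun setT (fun z : 'rV[R]_n * 'rV[R]_m => (F z.1 z.2)%:E) by exact/measurable_EFinP.
have iF1 x : rintegrable (F x).
  apply: (rintegrable_le _ (rintegrableZ (G1 x) i2)) => [|y]; last exact: FG.
  exact: (measurableT_comp mF (measurable_pair1 x)).
have iF2 y : rintegrable (F ^~ y).
  apply: (rintegrable_le _ (rintegrableZ (G2 y) i1)) => [|x]; last by rewrite mulrC; exact: FG.
  exact: (measurableT_comp mF (measurable_pair2 y)).
have := @Fubini _ _ _ _ R (lebesgue_rV n) (lebesgue_rV m) (fun z => (F z.1 z.2)%:E).
rewrite /Rintegral => H.
under eq_integral do rewrite fineK ?(integrable_fin_num measurableT (iF1 _))//.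
under [in RHS]eq_integral do rewrite fineK ?(integrable_fin_num measurableT (iF2 _))//.
rewrite H//; apply/integrable12ltyP => //.
apply: (@le_lt_trans _ _ (\int[lebesgue_rV n]_x ((G1 x)%:E * \int[lebesgue_rV m]_y (G2 y)%:E))%E).
  apply: ge0_le_integral => //.
  - by move=> x _; exact: integral_ge0.
  - apply: (@measurable_fun_fubini_tonelli_F _ _ _ _ R (lebesgue_rV m) (fun z => `|(F z.1 z.2)%:E|%E)) => //.
    exact: measurableT_comp.
  - apply: emeasurable_funM => //; exact: measurable_int i1.
  move=> x _; rewrite -ge0_integralZl//; last 3 first.
  - exact: measurable_int i2.
  - by move=> y _; rewrite lee_fin.
  - by rewrite lee_fin.
  apply: ge0_le_integral => //.
  - by apply: measurableT_comp => //; exact: measurable_int (iF1 x).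
  - by apply: emeasurable_funM => //; exact: measurable_int i2.
  - by move=> y _; rewrite lee_fin; exact: FG.
have fG2 := integrable_fin_num measurableT i2.
rewrite -(fineK fG2) (integralZr measurableT i1).
by rewrite -(fineK (integrable_fin_num measurableT i1)) ltry.
Qed.

End limits_of_integrals.

(** * Fourier inversion *)

Section complex_fubini.
Context {R : realType}.
Notation mu := (lebesgue_rV _).
Notation rintegrable f := (mu.-integrable setT (fun x => (f x)%:E)).

Lemma cint_param_measurable n m (F : 'rV[R]_n -> 'rV[R]_m -> R[i]) :
  cmeas (fun z : 'rV[R]_n * 'rV[R]_m => F z.1 z.2) ->
  cmeasurable (fun x => cint (F x)).
Proof.
by move=> [mr mi]; split; rewrite /cint/=; [apply: measurable_Rintegral_param mr|
  apply: measurable_Rintegral_param mi].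
Qed.

Lemma cint_fubini n m (F : 'rV[R]_n -> 'rV[R]_m -> R[i]) G1 G2 :
  cmeas (fun z : 'rV[R]_n * 'rV[R]_m => F z.1 z.2) ->
  rintegrable G1 -> rintegrable G2 ->
  (forall x, 0 <= G1 x) -> (forall x, 0 <= G2 x) ->
  (forall x y, cmod (F x y) <= G1 x * G2 y) ->
  cint (fun x => cint (F x)) = cint (fun y => cint (F ^~ y)).
Proof.
move=> [mr mi] i1 i2 G10 G20 FG; apply: complex_eq => /=.
  apply: (Rintegral_fubini mr i1 i2) => // x y.
  exact: le_trans (le_Re_cmod _) (FG x y).
apply: (Rintegral_fubini mi i1 i2) => // x y.
exact: le_trans (le_Im_cmod _) (FG x y).
Qed.

(** Dominated convergence on both sides of an identity between integrals, each side with its own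
    majorant. *)
Lemma cint_lim_eq n (F H : nat -> 'rV[R]_n -> R[i]) (f h : 'rV[R]_n -> R[i]) GF GH :
  (forall m, cmeasurable (F m)) -> (forall m, cmeasurable (H m)) ->
  rintegrable GF -> rintegrable GH ->
  (forall m x, cmod (F m x) <= GF x) -> (forall m x, cmod (H m x) <= GH x) ->
  (forall x, complex.Re (F m x) @[m --> \oo] --> complex.Re (f x)) ->
  (forall x, complex.Im (F m x) @[m --> \oo] --> complex.Im (f x)) ->
  (forall x, complex.Re (H m x) @[m --> \oo] --> complex.Re (h x)) ->
  (forall x, complex.Im (H m x) @[m --> \oo] --> complex.Im (h x)) ->
  (forall m, cint (F m) = cint (H m)) ->
  cint f = cint h.
Proof.
move=> mF mH iF iH FG HG Fr Fi Hr Hi FH; apply: complex_eq; rewrite /cint/=.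
  have A := Rintegral_dct (fun m => (mF m).1) Fr iF (fun m x => le_trans (le_Re_cmod _) (FG m x)).
  have B := Rintegral_dct (fun m => (mH m).1) Hr iH (fun m x => le_trans (le_Re_cmod _) (HG m x)).
  have E : (fun m => \int[lebesgue_rV n]_x complex.Re (F m x)) = (fun m => \int[lebesgue_rV n]_x complex.Re (H m x)).
    by apply/funext => m; exact: (congr1 (@complex.Re R) (FH m)).
  by rewrite E in A; exact: (cvg_unique _ A B).
have A := Rintegral_dct (fun m => (mF m).2) Fi iF (fun m x => le_trans (le_Im_cmod _) (FG m x)).
have B := Rintegral_dct (fun m => (mH m).2) Hi iH (fun m x => le_trans (le_Im_cmod _) (HG m x)).
have E : (fun m => \int[lebesgue_rV n]_x complex.Im (F m x)) = (fun m => \int[lebesgue_rV n]_x complex.Im (H m x)).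
  by apply/funext => m; exact: (congr1 (@complex.Im R) (FH m)).
by rewrite E in A; exact: (cvg_unique _ A B).
Qed.

End complex_fubini.

Section dot_product.
Context {R : realType} {n : nat}.
Implicit Types x y z : 'rV[R]_n.

Lemma dotpC x y : dotp x y = dotp y x.
Proof. by apply: eq_bigr => i _; rewrite mulrC. Qed.

Lemma dotpDl x y z : dotp (x + y) z = dotp x z + dotp y z.
Proof. by rewrite /dotp -big_split; apply: eq_bigr => i _; rewrite mxE mulrDl. Qed.

Lemma dotpDr x y z : dotp x (y + z) = dotp x y + dotp x z.
Proof. by rewrite dotpC dotpDl !(dotpC x). Qed.

Lemma dotpZl (r : R) x y : dotp (r *: x) y = r * dotp x y.
Proof. by rewrite /dotp mulr_sumr; apply: eq_bigr => i _; rewrite mxE mulrA. Qed.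

Lemma dotpZr (r : R) x y : dotp x (r *: y) = r * dotp x y.
Proof. by rewrite dotpC dotpZl dotpC. Qed.

Lemma dotpNl x y : dotp (- x) y = - dotp x y.
Proof. by rewrite -scaleN1r dotpZl mulN1r. Qed.

Lemma dotp_norm_le x y : `|dotp x y| <= n%:R * (`|x| * `|y|).
Proof.
apply: le_trans (ler_norm_sum _ _ _) _.
apply: (@le_trans _ _ (\sum_(i < n) `|x| * `|y|)).
  by apply: ler_sum => i _; rewrite normrM ler_pM// rV_norm_coord.
by rewrite sumr_const card_ord mulr_natl.
Qed.

Lemma rV_coord_le_enorm x i : `|x ord0 i| <= enorm x.
Proof.
rewrite /enorm -sqrtr_sqr ler_sqrt; last first.
  by apply: sumr_ge0 => j _; rewrite -expr2 sqr_ge0.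
rewrite /dotp (bigD1 i)//= expr2 lerDl.
by apply: sumr_ge0 => j _; rewrite -expr2 sqr_ge0.
Qed.

Lemma rV_norm_le_enorm x : `|x| <= enorm x.
Proof. by apply/rV_norm_leP => [|i]; [exact: sqrtr_ge0|exact: rV_coord_le_enorm]. Qed.

Lemma enormZ (r : R) x : 0 <= r -> enorm (r *: x) = r * enorm x.
Proof.
move=> r0; rewrite /enorm dotpZl dotpZr mulrA -expr2 sqrtrM ?sqr_ge0//.
by rewrite sqrtr_sqr ger0_norm.
Qed.

End dot_product.

Section fourier_inversion.
Context {R : realType} {n : nat}.
Notation mu := (lebesgue_rV n).
Notation rintegrable f := (mu.-integrable setT (fun x => (f x)%:E)).
Implicit Types f g phi : 'rV[R]_n -> R[i].

Definition ifourier g : 'rV[R]_n -> R[i] :=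
  fun x => cint (fun xi => g xi * cexp (2 * pi * dotp x xi)).

Lemma cmeas_phase (a : R) (y : 'rV[R]_n) : cmeasurable (fun x => cexp (a * dotp x y)).
Proof. by apply: cmeas_cexp; apply: measurable_funM => //; apply: measurable_dotp. Qed.

Lemma cmeas_phaseN (y : 'rV[R]_n) : cmeasurable (fun x => cexp (- (2 * pi * dotp x y))).
Proof. by under [X in cmeasurable X]eq_fun do rewrite -mulNr; exact: cmeas_phase. Qed.

Lemma cintegrable_phase f (h : 'rV[R]_n -> R) : cintegrable f ->
  measurable_fun setT h -> cintegrable (fun x => f x * cexp (h x)).
Proof.
move=> If mh; apply: (cintegrable_le _ (rintegrable_cmod If)) => [|x].
  by apply: cmeasM; [exact: cintegrable_meas|exact: cmeas_cexp].
by rewrite cmodM cmod_cexp mulr1.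
Qed.

Lemma measurable_phase (a : R) (y : 'rV[R]_n) : measurable_fun setT (fun x => a * dotp x y).
Proof. by apply: measurable_funM => //; apply: measurable_dotp. Qed.

Lemma measurable_phaseN (y : 'rV[R]_n) : measurable_fun setT (fun x => - (2 * pi * dotp x y)).
Proof. by under eq_fun do rewrite -mulNr; exact: measurable_phase. Qed.

Lemma cvg_affine_harmonic (z v : 'rV[R]_n) :
  affine_rV (m.+1%:R^-1) v z @[m --> \oo] --> v.
Proof.
rewrite /affine_rV -[X in _ --> X]add0r; apply: cvgD; last exact: cvg_cst.
rewrite -(scale0r z); apply: cvgZr_tmp; exact: cvg_harmonic.
Qed.

Lemma ccontinuous_cvg f (z v : 'rV[R]_n) : ccontinuous f ->
  complex.Re (f (affine_rV (m.+1%:R^-1) v z)) @[m --> \oo] --> complex.Re (f v) /\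
  complex.Im (f (affine_rV (m.+1%:R^-1) v z)) @[m --> \oo] --> complex.Im (f v).
Proof.
move=> [cr ci]; split; have H := @cvg_affine_harmonic z v.
  exact: (continuous_cvg _ (cr v) H).
exact: (continuous_cvg _ (ci v) H).
Qed.

Lemma continuous_ball_bounded (h : 'rV[R]_n -> R) (c : R) : continuous h ->
  exists B, 0 <= B /\ forall y, `|y| <= c -> `|h y| <= B.
Proof.
move=> ch; pose A := [set y : 'rV[R]_n | `|y| <= c].
have cA : compact A.
  apply: bounded_closed_compact.
    exists c; split; first exact: num_real.
    by move=> M cM y /= yc; rewrite (le_trans yc)// ltW.
  rewrite (_ : A = (fun y : 'rV[R]_n => `|y| : R) @^-1` [set t | t <= c])//.
  by apply: closed_comp => [y _|]; [exact: norm_continuous|exact: closed_le].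
have [M [_ HM]] : bounded_set (h @` A).
  by apply: compact_bounded; apply: continuous_compact => //; exact: continuous_subspaceT.
exists (`|M| + 1); split; first by rewrite addr_ge0.
move=> y yc; apply: (HM (`|M| + 1)); last by exists y.
by rewrite (le_lt_trans (ler_norm _))// ltrDl.
Qed.

Lemma ccontinuous_ball_bounded f (c : R) : ccontinuous f ->
  exists B, 0 <= B /\ forall y, `|y| <= c -> cmod (f y) <= B.
Proof.
move=> [/(continuous_ball_bounded c)[B1 [B10 b1]] /(continuous_ball_bounded c)[B2 [B20 b2]]].
exists (B1 + B2); split; first exact: addr_ge0.
by move=> y yc; rewrite (le_trans (le_cmod_ReIm _))// lerD// ?b1 ?b2.
Qed.

End fourier_inversion.

Section fourier_inversion_theorem.
Context {R : realType} {n : nat}.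
Notation mu := (lebesgue_rV n).
Notation rintegrable f := (mu.-integrable setT (fun x => (f x)%:E)).
Implicit Types f g phi : 'rV[R]_n -> R[i].

Lemma realCM (a b : R) : (a * b)%:C = a%:C * b%:C :> R[i].
Proof. by apply: complex_eq; rewrite ?ReM ?ImM /=; ring. Qed.

Lemma affine_rVE (r : R) (v x : 'rV[R]_n) : affine_rV r v x = r *: x + v.
Proof. by []. Qed.

Lemma ccontinuous_cvg0 f (z : 'rV[R]_n) : ccontinuous f ->
  complex.Re (f (m.+1%:R^-1 *: z)) @[m --> \oo] --> complex.Re (f 0) /\
  complex.Im (f (m.+1%:R^-1 *: z)) @[m --> \oo] --> complex.Im (f 0).
Proof.
move=> /(ccontinuous_cvg z 0)[H1 H2].
have Em m : m.+1%:R^-1 *: z = affine_rV (m.+1%:R^-1) 0 z by rewrite affine_rVE addr0.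
by split; [under eq_fun do rewrite Em|under eq_fun do rewrite Em].
Qed.

Lemma cint_dilation (r : R) f : 0 < r -> cintegrable f ->
  cint (fun x => f (r *: x)) = (r ^- n)%:C * cint f.
Proof.
move=> r0 If; rewrite -[in RHS](gtr0_norm r0) -(cint_affine 0) ?gt_eqF//.
by congr cint; apply/funext => x; rewrite affine_rVE addr0.
Qed.

(** Fubini moves the transform from [f] to the dilated and translated [phi]; the substitutions eta =
    e xi + v and y = e z then collect the dilation inside [f]. Letting e tend to 0 freezes [f] at 0
    on one side and [phi] at v on the other. *)
Lemma multiplication_formula f phi (v : 'rV[R]_n) (e : R) : 0 < e ->
  cintegrable f -> cintegrable phi ->
  (forall r, 0 < r -> cintegrable (fun z => f (r *: z) * (cexp (2 * pi * dotp v z) * fourier phi z))) ->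
  cint (fun xi => fourier f xi * phi (affine_rV e v xi)) =
  cint (fun z => f (e *: z) * (cexp (2 * pi * dotp v z) * fourier phi z)).
Proof.
move=> e0 If Ip Ig; have e0' : e != 0 by rewrite gt_eqF.
have mf := cintegrable_meas If; have mp := cintegrable_meas Ip.
pose F (xi y : 'rV[R]_n) := f y * cexp (- (2 * pi * dotp y xi)) * phi (affine_rV e v xi).
have Ipa := cintegrable_affine v e0' Ip.
transitivity (cint (fun xi => cint (F xi))).
  congr cint; apply/funext => xi; rewrite /F /fourier mulrC -cintZ.
    by congr cint; apply/funext => y; rewrite mulrC.
  by apply: cintegrable_phase => //; exact: measurable_phaseN.
rewrite (@cint_fubini _ _ _ F (fun xi => cmod (phi (affine_rV e v xi))) (fun y => cmod (f y))); last 6 first.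
- apply: cmeasM; first apply: cmeasM.
  + exact: (cmeas_comp mf measurable_snd).
  + apply: cmeas_cexp; apply: measurable_funN; apply: measurable_funM => //.
    by apply: measurable_dotp; [exact: measurable_snd|exact: measurable_fst].
  + exact: (cmeas_comp mp (measurableT_comp (@measurable_affine_rV R n e v) measurable_fst)).
- exact: rintegrable_cmod.
- exact: rintegrable_cmod.
- by move=> x; exact: cmod_ge0.
- by move=> x; exact: cmod_ge0.
- by move=> x y; rewrite /F !cmodM cmod_cexp mulr1 mulrC.
have inner y : cint (F ^~ y) =
    (e ^- n)%:C * (f (e *: (e^-1 *: y)) * (cexp (2 * pi * dotp v (e^-1 *: y)) * fourier phi (e^-1 *: y))).
  rewrite /F; under [X in cint X]eq_fun do rewrite -mulrA.
  (* The integrand after eta = e xi + v; the translation by v leaves the phase split off in [E]. *)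
  pose H (eta : 'rV[R]_n) := phi eta * cexp (- (2 * pi * dotp eta (e^-1 *: y))).
  have IH : cintegrable H by apply: cintegrable_phase => //; exact: measurable_phaseN.
  have E xi : cexp (- (2 * pi * dotp y xi)) * phi (affine_rV e v xi) =
      cexp (2 * pi * dotp v (e^-1 *: y)) * H (affine_rV e v xi).
    rewrite /H mulrCA -cexpD mulrC; congr (_ * cexp _).
    rewrite affine_rVE dotpDl dotpZl !dotpZr (dotpC y xi); field.
    by rewrite e0'.
  under [X in cint X]eq_fun do rewrite E.
  have Ic : cintegrable (fun xi => cexp (2 * pi * dotp v (e^-1 *: y)) * H (affine_rV e v xi)).
    by apply: cintegrableZ; exact: cintegrable_affine.
  rewrite cintZ// cintZ; last exact: cintegrable_affine.
  rewrite cint_affine// (gtr0_norm e0) scalerA mulfV// scale1r -/(fourier phi (e^-1 *: y)).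
  by rewrite [in LHS](mulrCA (cexp _)) [LHS]mulrCA.
under [X in cint X]eq_fun do rewrite inner.
have e1 : 0 < e^-1 by rewrite invr_gt0.
pose g z := f (e *: z) * (cexp (2 * pi * dotp v z) * fourier phi z).
have Ig' : cintegrable g := Ig e e0.
rewrite cintZ; last first.
  have := cintegrable_affine 0 (lt0r_neq0 e1) Ig'.
  by under [X in cintegrable X]eq_fun do rewrite affine_rVE addr0.
(* The substitution y = e z produces e^n, which cancels the Jacobian of the first one. *)
rewrite (@cint_dilation e^-1 g)// mulrA -realCM exprVn invrK mulVf ?mul1r//.
by rewrite expf_neq0.
Qed.

(* The dilates of [fourier phi] are the approximate identity: the limit along
   [e = 1 / (m + 1)] is taken on both sides of the multiplication formula. *)
Lemma fourier_inversion0 f phi (v : 'rV[R]_n) (c B : R) :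
  ccontinuous f -> cintegrable f -> cintegrable (fourier f) ->
  ccontinuous phi -> cintegrable phi -> (forall x, cmod (phi x) <= B) ->
  ccontinuous (fourier phi) -> cintegrable (fourier phi) ->
  (forall y, c < `|y| -> fourier phi y = 0) ->
  f 0 * ifourier (fourier phi) v = cint (fourier f) * phi v.
Proof.
move=> cf If Iff cp Ip pB cfp Ifp sfp.
have mf := cintegrable_meas If; have mp := cintegrable_meas Ip.
have mfp := cintegrable_meas Ifp; have mff := cintegrable_meas Iff.
have mK : cmeasurable (fun z => cexp (2 * pi * dotp v z) * fourier phi z).
  by apply: cmeasM => //; under [X in cmeas X]eq_fun do rewrite dotpC; exact: cmeas_phase.
have maff r w : measurable_fun setT (fun z : 'rV[R]_n => r *: z + w) := @measurable_affine_rV R n r w.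
have mfr r : cmeasurable (fun z => f (r *: z)).
  apply: (cmeas_comp mf); have := maff r 0.
  by under eq_fun do rewrite addr0.
have mg r : cmeasurable (fun z => f (r *: z) * (cexp (2 * pi * dotp v z) * fourier phi z)).
  exact: cmeasM (mfr r) mK.
(* As [fourier phi] has bounded support, f (e z) matters only for z in a fixed ball, and compactness
   bounds it there uniformly in e <= r. *)
have dom r : exists B', 0 <= B' /\ forall e, 0 < e -> e <= r -> forall z,
    cmod (f (e *: z) * (cexp (2 * pi * dotp v z) * fourier phi z)) <= B' * cmod (fourier phi z).
  have [B' [B'0 HB']] := ccontinuous_ball_bounded (r * `|c|) cf.
  exists B'; split => // e e0 er z.
  rewrite !cmodM cmod_cexp mul1r; have [zc|zc] := ltP c `|z|.
    by rewrite sfp// cmod0 !mulr0.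
  rewrite ler_wpM2r ?cmod_ge0// HB'// normrZ ler_pM// ?(gtr0_norm e0)//.
  exact: le_trans zc (ler_norm _).
have dom2 r : 0 < r -> cintegrable (fun z => f (r *: z) * (cexp (2 * pi * dotp v z) * fourier phi z)).
  move=> r0; have [B' [B'0 HB']] := dom r.
  apply: (cintegrable_le _ (rintegrableZ B' (rintegrable_cmod Ifp))) => [//|x].
  exact: HB'.
have [B' [B'0 HB']] := dom 1.
pose e m : R := m.+1%:R^-1.
have e0 m : 0 < e m by rewrite invr_gt0.
have e1 m : e m <= 1 by rewrite invf_le1// ler1n.
transitivity (cint (fun z => f 0 * (cexp (2 * pi * dotp v z) * fourier phi z))).
  rewrite cintZ.
    by congr (_ * _); congr cint; apply/funext => z; rewrite mulrC.
  have := dom2 1 ltr01 => _.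
  apply: (cintegrable_le mK (rintegrable_cmod Ifp)) => x.
  by rewrite cmodM cmod_cexp mul1r.
transitivity (cint (fun xi => fourier f xi * phi v)); last first.
  under [X in cint X]eq_fun do rewrite mulrC.
  by rewrite cintZ// mulrC.
symmetry.
apply: (@cint_lim_eq R n (fun m xi => fourier f xi * phi (affine_rV (e m) v xi))
  (fun m z => f (e m *: z) * (cexp (2 * pi * dotp v z) * fourier phi z)) _ _
  (fun xi => B * cmod (fourier f xi)) (fun z => B' * cmod (fourier phi z))).
- move=> m; apply: cmeasM => //; exact: (cmeas_comp mp (@measurable_affine_rV R n (e m) v)).
- by move=> m; exact: mg.
- by apply: rintegrableZ; exact: rintegrable_cmod.
- by apply: rintegrableZ; exact: rintegrable_cmod.
- by move=> m x; rewrite cmodM mulrC ler_wpM2r ?cmod_ge0.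
- by move=> m x; exact: HB'.
- move=> x; under eq_fun do rewrite ReM; rewrite ReM.
  have [H1 H2] := ccontinuous_cvg x v cp.
  by apply: cvgB; apply: cvgMl_tmp.
- move=> x; under eq_fun do rewrite ImM; rewrite ImM.
  have [H1 H2] := ccontinuous_cvg x v cp.
  by apply: cvgD; apply: cvgMl_tmp.
- move=> x; under eq_fun do rewrite ReM; rewrite ReM.
  have [H1 H2] := ccontinuous_cvg0 x cf.
  by apply: cvgB; apply: cvgMr_tmp.
- move=> x; under eq_fun do rewrite ImM; rewrite ImM.
  have [H1 H2] := ccontinuous_cvg0 x cf.
  by apply: cvgD; apply: cvgMr_tmp.
- move=> m; exact: multiplication_formula.
Qed.

End fourier_inversion_theorem.

(** * Rapid decrease and continuity of the transform *)

Section rapid_decrease.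
Context {R : realType} {n : nat}.
Notation mu := (lebesgue_rV n).
Notation rintegrable f := (mu.-integrable setT (fun x => (f x)%:E)).
Implicit Types f g phi : 'rV[R]_n -> R[i].

(** The derivative-free part of the Schwartz condition: it passes to dilates and convolutions, and
    it is what the envelope estimates consume. *)
Definition rapid f :=
  forall k : nat, exists C : R, forall x, (1 + `|x|) ^+ k * cmod (f x) <= C.

Lemma onePnorm_gt0 (x : 'rV[R]_n) : 0 < 1 + `|x|.
Proof. by rewrite ltr_wpDr. Qed.

Lemma rapid_bounded f : rapid f -> exists C, forall x, cmod (f x) <= C.
Proof. by move=> /(_ 0%N)[C HC]; exists C => x; have := HC x; rewrite expr0 mul1r. Qed.

Lemma rapid_cintegrable f : cmeasurable f -> rapid f -> cintegrable f.
Proof.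
move=> mf /(_ (n + 2)%N)[C HC].
apply: (cintegrable_le mf (rintegrableZ C (@rintegrable_poly R n))) => x.
by rewrite ler_pdivlMr ?exprn_gt0 ?onePnorm_gt0// mulrC.
Qed.

Lemma rapid_norm_rintegrable f : cmeasurable f -> rapid f ->
  rintegrable (fun x => `|x| * cmod (f x)).
Proof.
move=> mf /(_ (n + 2).+1)[C HC].
apply: (@rintegrable_decay R n _ C) => [|x].
  by apply: measurable_funM; [exact: measurable_rV_norm|exact: measurable_cmod].
apply: le_trans (HC x); rewrite normrM normr_id ger0_norm ?cmod_ge0//.
rewrite mulrA ler_wpM2r ?cmod_ge0// exprSr ler_wpM2l ?exprn_ge0 ?(ltW (onePnorm_gt0 _))//.
by rewrite lerDr.
Qed.

Lemma schwartz_rapid f : schwartz f -> rapid f.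
Proof. by move=> [_ /(_ [::])]. Qed.

Lemma schwartz_ccontinuous f : schwartz f -> ccontinuous f.
Proof. by move=> [/(_ [::])[]]. Qed.

Lemma compact_rapid g (c : R) : ccontinuous g -> (forall y, c < `|y| -> g y = 0) -> rapid g.
Proof.
move=> cg g0 k; have [B [B0 HB]] := ccontinuous_ball_bounded c cg.
exists ((1 + `|c|) ^+ k * B) => x; have [xc|xc] := ltP c `|x|.
  by rewrite g0// cmod0 mulr0 mulr_ge0// exprn_ge0// addr_ge0.
rewrite ler_pM ?exprn_ge0 ?cmod_ge0 ?HB ?(ltW (onePnorm_gt0 _))//.
by rewrite lerXn2r ?nnegrE ?addr_ge0// lerD2l (le_trans xc)// ler_norm.
Qed.

Lemma lipschitz_continuous_rV (h : 'rV[R]_n -> R) (C : R) :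
  (forall x y, `|h x - h y| <= C * `|x - y|) -> continuous h.
Proof.
move=> hC x; apply/(@cvgrPdist_lt _ _ _ (nbhs x) (nbhs_filter x)) => e e0.
have C1 : 0 < `|C| + 1 by rewrite ltr_wpDl.
have d0 : 0 < e / (`|C| + 1) by rewrite divr_gt0.
apply: filterS (nbhsx_ballx x _ d0) => y; rewrite -ball_normE/= ltr_pdivlMr// mulrC => xy.
apply: le_lt_trans (hC x y) _; apply: le_lt_trans xy.
by rewrite ler_wpM2r// (le_trans (ler_norm _))// lerDl.
Qed.

Lemma cos_lipschitz (a b : R) : `|cos a - cos b| <= `|a - b|.
Proof.
wlog ab : a b / a <= b.
  by move=> H; case: (leP a b) => [/H//|/ltW/H]; rewrite distrC (distrC b).
rewrite distrC (distrC a).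
have [] := @MVT_segment R (@cos R) (fun x => - sin x) a b ab.
  by apply: continuous_subspaceT; exact: continuous_cos.
move=> c cab ->.
by rewrite normrM -[leRHS]mul1r ler_wpM2r// normrN ler_norml sin_geN1 sin_le1.
Qed.

Lemma sin_lipschitz (a b : R) : `|sin a - sin b| <= `|a - b|.
Proof.
have E x : sin x = cos (x - pi / 2) :> R.
  by rewrite cosB cos_pihalf sin_pihalf mulr0 mulr1 add0r.
by rewrite !E (le_trans (cos_lipschitz _ _))// opprD opprK addrACA addNr addr0.
Qed.

Lemma cexp_lipschitz (a b : R) : cmod (cexp a - cexp b) <= 2 * `|a - b|.
Proof.
rewrite (le_trans (le_cmod_ReIm _))// ReD ImD ReN ImN/= mulr2n mulrDl mul1r.
by rewrite lerD ?cos_lipschitz ?sin_lipschitz.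
Qed.

(** The phase is Lipschitz in xi with a constant proportional to |x|, so the first absolute moment
    of [phi] makes the transform Lipschitz. *)
Lemma fourier_ccontinuous phi : cmeasurable phi -> rapid phi -> ccontinuous (fourier phi).
Proof.
move=> mp rp; have Ip := rapid_cintegrable mp rp.
pose I := \int[mu]_x (`|x| * cmod (phi x)).
have H xi eta : cmod (fourier phi xi - fourier phi eta) <= 2 * (4 * pi * n%:R * I) * `|xi - eta|.
  have Ix z := cintegrable_phase Ip (measurable_phaseN z).
  have -> : fourier phi xi - fourier phi eta = cint (fun x => phi x *
      (cexp (- (2 * pi * dotp x xi)) - cexp (- (2 * pi * dotp x eta)))).
    under [X in _ = cint X]eq_fun do rewrite mulrBr -[X in _ + X]mulN1r.
    rewrite cintD ?cintZ ?mulN1r//; exact: cintegrableZ.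
  pose G x := (4 * pi * n%:R * `|xi - eta|) * (`|x| * cmod (phi x)).
  have IG : rintegrable G by apply: rintegrableZ; exact: rapid_norm_rintegrable.
  have le x : cmod (phi x * (cexp (- (2 * pi * dotp x xi)) - cexp (- (2 * pi * dotp x eta)))) <= G x.
    rewrite cmodM /G mulrA [leLHS]mulrC ler_wpM2r ?cmod_ge0//.
    rewrite (le_trans (cexp_lipschitz _ _))// opprK addrC -mulrBr normrM.
    have -> : dotp x eta - dotp x xi = dotp x (eta - xi).
      by rewrite dotpDr (dotpC x (- xi)) dotpNl (dotpC xi).
    have pi2 : 0 <= 2 * pi :> R by rewrite mulr_ge0// pi_ge0.
    rewrite ger0_norm// mulrA.
    have -> : 4 * pi * n%:R * `|xi - eta| * `|x| = 2 * (2 * pi) * (n%:R * (`|x| * `|eta - xi|)).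
      by rewrite (distrC eta); ring.
    by apply: ler_wpM2l; [rewrite mulr_ge0|exact: dotp_norm_le].
  have IF : cintegrable (fun x => phi x * (cexp (- (2 * pi * dotp x xi)) - cexp (- (2 * pi * dotp x eta)))).
    apply: (cintegrable_le _ IG le); apply: cmeasM => //.
    by apply: cmeasB; exact: cmeas_phaseN.
  apply: le_trans (le_cmod_cint IF IG le) _.
  rewrite /G RintegralZl//; last exact: rapid_norm_rintegrable.
  by rewrite -/I [leLHS](_ : _ = 2 * (4 * pi * n%:R * I) * `|xi - eta|)//; ring.
split; apply: lipschitz_continuous_rV => x y.
  by apply: le_trans (H x y); rewrite -ReN -ReD le_Re_cmod.
by apply: le_trans (H x y); rewrite -ImN -ImD le_Im_cmod.
Qed.

End rapid_decrease.

Section inversion_constant.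
Context {R : realType} {n : nat}.
Notation mu := (lebesgue_rV n).
Notation rintegrable f := (mu.-integrable setT (fun x => (f x)%:E)).
Implicit Types f g phi : 'rV[R]_n -> R[i].

Lemma conjcM (x y : R[i]) : conjc (x * y) = conjc x * conjc y.
Proof. by apply: complex_eq; rewrite ?ReJ ?ImJ ?ReM ?ImM ?ReJ ?ImJ; ring. Qed.

Lemma measurable_phaser (a : R) (x : 'rV[R]_n) :
  measurable_fun setT (fun xi => a * dotp x xi).
Proof. by under eq_fun do rewrite dotpC; exact: measurable_phase. Qed.

Lemma fourier_shift f (x xi : 'rV[R]_n) : cintegrable f ->
  fourier (fun y => f (affine_rV 1 x y)) xi = cexp (2 * pi * dotp x xi) * fourier f xi.
Proof.
move=> If; rewrite /fourier.
pose h z := cexp (2 * pi * dotp x xi) * (f z * cexp (- (2 * pi * dotp z xi))).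
have Ip := cintegrable_phase If (measurable_phaseN xi).
transitivity (cint (fun y => h (affine_rV 1 x y))).
  congr cint; apply/funext => y; rewrite /h mulrCA -cexpD; congr (_ * cexp _).
  by rewrite affine_rVE scale1r dotpDl; ring.
rewrite cint_affine ?oner_eq0//; last exact: cintegrableZ.
by rewrite normr1 expr1n invr1 mul1r cintZ.
Qed.

Lemma ccontinuous_affine f (r : R) (x : 'rV[R]_n) : ccontinuous f ->
  ccontinuous (fun y => f (affine_rV r x y)).
Proof.
move=> [cr ci].
have ca : continuous (affine_rV r x).
  move=> y; apply: (continuousD (f := fun z : 'rV[R]_n => r *: z) (g := cst x)).
    exact: scaler_continuous.
  exact: cst_continuous.
split=> y; first exact: (continuous_comp (ca y) (cr _)).
exact: (continuous_comp (ca y) (ci _)).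
Qed.

(** The identity at the origin, applied to the translate of [f] by x, whose transform carries
    exactly the phase of the inverse transform at x. *)
Lemma fourier_inversion_kernel f phi (x v : 'rV[R]_n) (c : R) :
  ccontinuous f -> cintegrable f -> cintegrable (fourier f) ->
  schwartz phi -> (forall y, c < `|y| -> fourier phi y = 0) ->
  f x * ifourier (fourier phi) v = ifourier (fourier f) x * phi v.
Proof.
move=> cf If Iff sp pc.
have cp := schwartz_ccontinuous sp; have rp := schwartz_rapid sp.
have mp := continuous_cmeasurable cp.
have cfp := fourier_ccontinuous mp rp.
have [B HB] := rapid_bounded rp.
have Ifp : cintegrable (fourier phi).
  apply: rapid_cintegrable; first exact: continuous_cmeasurable.
  exact: compact_rapid pc.
have one0 : (1 : R) != 0 := oner_neq0 R.
have E : fourier (fun y => f (affine_rV 1 x y)) =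
    (fun xi => fourier f xi * cexp (2 * pi * dotp x xi)).
  by apply/funext => xi; rewrite fourier_shift// mulrC.
have := @fourier_inversion0 R n (fun y => f (affine_rV 1 x y)) phi v c B.
rewrite E affine_rVE scaler0 add0r => -> //.
- exact: ccontinuous_affine.
- exact: cintegrable_affine.
- exact: (cintegrable_phase Iff (measurable_phaser (2 * pi) x)).
- exact: rapid_cintegrable.
Qed.

(** A continuous function that is nonzero at a point stays away from zero on a ball, which has
    positive measure. *)
Lemma Rintegral_sqr_cmod_eq0 g : ccontinuous g ->
  rintegrable (fun x => cmod (g x) ^+ 2) -> \int[mu]_x (cmod (g x) ^+ 2) = 0 ->
  forall x, cmod (g x) = 0.
Proof.
move=> cg I2 I0 xi0; apply/eqP; rewrite eq_le cmod_ge0 andbT leNgt; apply/negP => e0.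
have m2 : measurable_fun setT (fun xi => cmod (g xi) ^+ 2) := rintegrable_measurable I2.
(* Real and imaginary parts may each move by e, so one third of the modulus survives nearby. *)
pose e := cmod (g xi0) / 3.
have e0' : 0 < e by rewrite divr_gt0.
have [d d0 Hd] : exists2 d : R, 0 < d & forall x, `|x - xi0| <= d -> e <= cmod (g x).
  case: cg => cr ci.
  have /(@cvgrPdist_lt _ _ _ (nbhs xi0) (nbhs_filter xi0))/(_ _ e0') H1 := cr xi0.
  have /(@cvgrPdist_lt _ _ _ (nbhs xi0) (nbhs_filter xi0))/(_ _ e0') H2 := ci xi0.
  have := @filterI _ (nbhs xi0) (nbhs_filter xi0) _ _ H1 H2.
  move=> /(@nbhs_ballP R)[d d0 Hd].
  exists (d / 2); first by rewrite divr_gt0.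
  move=> x xd; have [|h1 h2] := Hd x.
    rewrite -ball_normE/= distrC (le_lt_trans xd)// ltr_pdivrMr// ltr_pMr// ltr1n.
    by [].
  have h : cmod (g xi0 - g x) <= e + e.
    by rewrite (le_trans (le_cmod_ReIm _))// ReD ImD ReN ImN lerD// ltW.
  have := cmodD (g xi0 - g x) (g x).
  rewrite subrK => h3; have := le_trans h3 (lerD h (lexx _)).
  have -> : cmod (g xi0) = e + e + e by rewrite /e; field.
  by rewrite lerD2l.
rewrite /Rintegral in I0.
have : ((e ^+ 2)%:E * lebesgue_rV n [set x | (`|affine_rV 1 (- xi0) x| <= d)%R] <=
    \int[mu]_x (cmod (g x) ^+ 2)%:E)%E.
  pose A := [set x : 'rV[R]_n | `|affine_rV 1 (- xi0) x| <= d].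
  have mA : measurable A.
    have := @measurable_affine_rV R n 1 (- xi0) measurableT _ (@measurable_rV_ball R n d).
    by rewrite setTI.
  rewrite -[X in (_ * lebesgue_rV n X)%E]setIT -(integral_indic _ measurableT mA).
  rewrite -(integralZl_indic measurableT (fun=> A))//; last by rewrite ltNge sqr_ge0.
  apply: ge0_le_integral => //.
  - by move=> x _; rewrite lee_fin mulr_ge0// sqr_ge0.
  - apply/measurable_EFinP; apply: measurable_funM => //; exact: measurable_indic.
  - by apply/measurable_EFinP.
  move=> x _; rewrite lee_fin indicE; case: (boolP (x \in A)) => [/set_mem|_].
    rewrite /A/= affine_rVE scale1r => /Hd h.
    by rewrite mulr1 lerXn2r// nnegrE ?cmod_ge0// ltW.
  by rewrite mulr0 sqr_ge0.
have -> : lebesgue_rV n [set x | `|affine_rV 1 (- xi0) x| <= d] = ((2 * d) ^+ n)%:E.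
  have := @lebesgue_rV_affine R n 1 (- xi0) [set x | `|x| <= d] (oner_neq0 R) (@measurable_rV_ball R n d).
  by rewrite normr1 expr1n invr1 mul1e lebesgue_rV_ball ?ltW.
rewrite -(fineK (integrable_fin_num measurableT I2)) I0 -EFinM lee_fin leNgt.
by rewrite mulr_gt0// exprn_gt0// mulr_gt0.
Qed.

(* Otherwise [int |phi^|^2 = int conj(phi) * ifourier(phi^) = 0], although
   [phi^] is continuous and nonzero. *)
Lemma ifourier_fourier_neq0 phi (c : R) :
  schwartz phi -> (forall y, c < `|y| -> fourier phi y = 0) ->
  (exists xi, fourier phi xi != 0) -> exists v, ifourier (fourier phi) v != 0.
Proof.
move=> sp pc [xi0 nz].
apply: contrapT => /forallNP all0.
have {}all0 v : ifourier (fourier phi) v = 0.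
  by apply/eqP; apply: contrapT => /negP; exact: all0.
have cp := schwartz_ccontinuous sp; have rp := schwartz_rapid sp.
have mp := continuous_cmeasurable cp.
have cfp := fourier_ccontinuous mp rp.
have mfp := continuous_cmeasurable cfp.
have Ip := rapid_cintegrable mp rp.
have rfp := compact_rapid cfp pc.
have Ifp := rapid_cintegrable mfp rfp.
have [B HB] := rapid_bounded rfp.
have B0 : 0 <= B by exact: le_trans (cmod_ge0 _) (HB 0).
pose F (xi x : 'rV[R]_n) := fourier phi xi * (conjc (phi x) * cexp (2 * pi * dotp x xi)).
have Fub : cint (fun xi => cint (F xi)) = cint (fun x => cint (F ^~ x)).
  apply: (@cint_fubini R n n F (fun xi => cmod (fourier phi xi)) (fun x => cmod (phi x))).
  - apply: cmeasM; first exact: (cmeas_comp mfp measurable_fst).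
    apply: cmeasM; first exact: (cmeas_comp (cmeasJ mp) measurable_snd).
    apply: cmeas_cexp; apply: measurable_funM => //.
    by apply: measurable_dotp; [exact: measurable_snd|exact: measurable_fst].
  - exact: rintegrable_cmod.
  - exact: rintegrable_cmod.
  - by move=> x; exact: cmod_ge0.
  - by move=> x; exact: cmod_ge0.
  - by move=> xi x; rewrite !cmodM cmodJ cmod_cexp mulr1.
have R0 x : cint (F ^~ x) = 0.
  rewrite /F; under [X in cint X]eq_fun do rewrite mulrCA.
  rewrite cintZ; first by rewrite -/(ifourier (fourier phi) x) all0 mulr0.
  exact: (cintegrable_phase Ifp (measurable_phaser (2 * pi) x)).
have L xi : cint (F xi) = (cmod (fourier phi xi) ^+ 2)%:C.
  rewrite /F cintZ; last first.
    apply: cintegrable_phase; last exact: measurable_phase.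
    apply: (cintegrable_le (cmeasJ mp) (rintegrable_cmod Ip)) => x.
    by rewrite cmodJ.
  have -> : cint (fun x => conjc (phi x) * cexp (2 * pi * dotp x xi)) = conjc (fourier phi xi).
    rewrite /fourier -(cintJ (cintegrable_phase Ip (measurable_phaseN xi))).
    congr cint; apply/funext => x; by rewrite conjcM conj_cexp opprK.
  by rewrite sqr_cmod; apply: complex_eq; rewrite ?ReM ?ImM ReJ ImJ /=; ring.
have E1 : cint (fun xi => cint (F xi)) = cint (fun xi => (cmod (fourier phi xi) ^+ 2)%:C).
  by congr cint; apply/funext => xi; exact: L.
have E2 : cint (fun x => cint (F ^~ x)) = 0.
  by rewrite -[RHS](@cint0 R n); congr cint; apply/funext => x; exact: R0.
have I0 : \int[mu]_xi (cmod (fourier phi xi) ^+ 2) = 0.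
  transitivity (complex.Re (cint (fun xi => (cmod (fourier phi xi) ^+ 2)%:C))); first reflexivity.
  rewrite -E1 Fub E2; reflexivity.
have I2 : rintegrable (fun xi => cmod (fourier phi xi) ^+ 2).
  apply: (rintegrable_le (measurable_funX 2 (measurable_cmod mfp)) (rintegrableZ B (rintegrable_cmod Ifp))) => x.
  rewrite (ger0_norm (exprn_ge0 2 (cmod_ge0 _))) expr2.
  exact: ler_wpM2r (cmod_ge0 _) _ _ (HB x).
move: nz; rewrite -cmod_eq0 => /negP; apply; apply/eqP.
exact: (Rintegral_sqr_cmod_eq0 cfp I2 I0).
Qed.

(** The dilates of the transform sum to 1 at any nonzero point, and such a point exists because n >
    0. *)
Lemma littlewood_paley_fourier_neq0 (c1 c2 : R) phi : (0 < n)%N ->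
  littlewood_paley c1 c2 phi -> exists xi, fourier phi xi != 0.
Proof.
move=> n0 [_ _ _ _ sum1]; apply: contrapT => /forallNP all0.
have := sum1 (const_mx 1); rewrite fsbig1.
  have nz : (const_mx 1 : 'rV[R]_n) != 0.
    apply/eqP => /rowP/(_ (Ordinal n0)); rewrite !mxE => /eqP; apply/negP.
    exact: oner_neq0.
  by move=> /(_ nz)/eqP; rewrite eq_sym oner_eq0.
by move=> j _; apply/eqP; apply: contrapT => /negP; exact: all0.
Qed.

Lemma supported_in_annulus_out (a b : R) g y :
  supported_in_annulus a b g -> b < `|y| -> g y = 0.
Proof.
move=> sg yb; apply/eqP; apply: contrapT => /negP /sg/andP[_ yb'].
by have := lt_le_trans yb (le_trans (rV_norm_le_enorm y) yb'); rewrite ltxx.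
Qed.

(** The kernel identity is divided by the inverse transform of [fourier phi] at a point v where it
    does not vanish; v depends on [phi] alone, hence so does kappa. *)
Theorem fourier_inversion (c1 c2 : R) phi : (0 < n)%N ->
  littlewood_paley c1 c2 phi ->
  exists kappa : R[i], forall f, ccontinuous f -> cintegrable f ->
    cintegrable (fourier f) -> forall x, f x = kappa * ifourier (fourier f) x.
Proof.
move=> n0 lp; have nz := littlewood_paley_fourier_neq0 n0 lp.
case: lp => sp _ _ supp _.
have pc y := @supported_in_annulus_out c1 c2 (fourier phi) y supp.
have [v v0] := ifourier_fourier_neq0 sp pc nz.
exists (phi v / ifourier (fourier phi) v) => f cf If Iff x.
have E := fourier_inversion_kernel x v cf If Iff sp pc.
by rewrite [RHS]mulrAC (mulrC (phi v)) -E mulfK.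
Qed.

End inversion_constant.

(** * Decay of band-limited functions *)

Section derivative_decay.
Context {R : realType} {n : nat}.
Notation mu := (lebesgue_rV n).
Notation rintegrable f := (mu.-integrable setT (fun x => (f x)%:E)).
Implicit Types f g : 'rV[R]_n -> R[i].
Implicit Types h dh : 'rV[R]_n -> R.

(** Both difference quotients are the same function of the increment. This gives access to the
    one-variable mean value theorem and chain rule. *)
Lemma is_derive_lineP h (a v : 'rV[R]_n) (t d : R) :
  is_derive (t *: v + a) v h d <-> is_derive t 1 (fun s : R => h (s *: v + a)) d.
Proof.
have E : (fun s : R => s^-1 *: ((h \o shift (t *: v + a)) (s *: v) - h (t *: v + a))) =
    (fun s : R => s^-1 *: (((fun s : R => h (s *: v + a)) \o shift t) (s *: (1 : R)) - h (t *: v + a))).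
  apply/funext => s /=; congr (_ *: (h _ - _)).
  have -> : s *: (1 : R) = s by exact: mulr1.
  by rewrite addrA scalerDl.
split => -[D V].
  by split; [rewrite /derivable -E|rewrite -V /derive -E].
by split; [rewrite /derivable E|rewrite -V /derive E].
Qed.

Lemma rintegrable_bounded_support h (B c : R) : measurable_fun setT h ->
  (forall x, `|h x| <= B) -> (forall x, c < `|x| -> h x = 0) -> rintegrable h.
Proof.
move=> mh hB h0; apply: (rintegrable_decay (C := (1 + `|c|) ^+ (n + 2) * `|B|) mh) => x.
have [xc|xc] := ltP c `|x|.
  by rewrite h0// normr0 mulr0 mulr_ge0// exprn_ge0// addr_ge0.
rewrite ler_pM ?exprn_ge0 ?(le_trans (hB x)) ?ler_norm ?(ltW (onePnorm_gt0 _))//.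
by rewrite lerXn2r ?nnegrE ?addr_ge0// lerD2l (le_trans xc)// ler_norm.
Qed.

(* Difference quotients integrate to zero by translation invariance. *)
Lemma Rintegral_derive_eq0 h dh (v : 'rV[R]_n) (c : R) : `|v| <= 1 ->
  continuous h -> continuous dh ->
  (forall x, c < `|x| -> h x = 0) -> (forall x, c < `|x| -> dh x = 0) ->
  (forall y, is_derive y v h (dh y)) -> \int[mu]_x dh x = 0.
Proof.
move=> v1 ch cdh sh sdh hdh.
have [C [C0 HC]] := continuous_ball_bounded c cdh.
have dhC x : `|dh x| <= C.
  by have [/sdh->|/HC//] := ltP c `|x|; rewrite normr0.
have [B [B0 HB]] := continuous_ball_bounded c ch.
have hB x : `|h x| <= B.
  by have [/sh->|/HB//] := ltP c `|x|; rewrite normr0.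
have mh := continuous_measurable_rV ch.
have ih : rintegrable h by apply: (rintegrable_bounded_support mh hB sh).
pose F (m : nat) y := m.+1%:R * (h (affine_rV 1 (m.+1%:R^-1 *: v) y) - h y).
have mF m : measurable_fun setT (F m).
  apply: measurable_funM => //; apply: measurable_funB => //.
  exact: (measurableT_comp mh (@measurable_affine_rV R n _ _)).
have F0 m : \int[mu]_x F m x = 0.
  have i1 := rintegrable_affine (m.+1%:R^-1 *: v) (oner_neq0 R) ih.
  have i2 : rintegrable (fun y => h (affine_rV 1 (m.+1%:R^-1 *: v) y) - h y).
    exact: (integrableB measurableT i1 ih).
  rewrite /F RintegralZl// RintegralB//.
  by rewrite (Rintegral_affine _ (oner_neq0 R) ih) normr1 expr1n invr1 mul1r subrr mulr0.
have Fcvg y : F m y @[m --> \oo] --> dh y.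
  have [D V] := hdh y.
  have /cvgr_dnbhsP/(_ (fun m => m.+1%:R^-1)) := D.
  rewrite -/(derive h y v) V => H.
  have {}H := H (conj (fun m => invr_neq0 (lt0r_neq0 (ltr0Sn R m))) (@cvg_harmonic R)).
  rewrite (_ : F^~ y = (fun m : nat => (m.+1%:R^-1)^-1 *: ((h \o shift y) (m.+1%:R^-1 *: v) - h y))).
    exact: H.
  by apply/funext => m /=; rewrite invrK /F affine_rVE scale1r [y + _]addrC.
(* The increments have norm at most 1, so all quotients are supported in the ball of radius c + 1;
   there the mean value theorem bounds them by the bound [C] on [dh]. *)
have FC m y : `|F m y| <= C * \1_[set y : 'rV[R]_n | `|y| <= c + 1] y.
  have m0 : 0 < m.+1%:R^-1 :> R by rewrite invr_gt0.
  have m1 : m.+1%:R^-1 <= 1 :> R by rewrite invf_le1// ler1n.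
  rewrite indicE; case: (boolP (_ \in _)) => [_|/negP yc].
    rewrite mulr1 /F affine_rVE scale1r normrM ger0_norm// mulrC -ler_pdivlMr//.
    have [] := @MVT_segment R (fun s : R => h (s *: v + y)) (fun s => dh (s *: v + y)) 0 m.+1%:R^-1 (ltW m0).
    - by move=> t _; apply/is_derive_lineP.
    - apply: continuous_subspaceT => t; apply: differentiable_continuous; apply/derivable1_diffP.
      by have /is_derive_lineP[] := hdh (t *: v + y).
    move=> t _; rewrite scale0r add0r subr0 [y + _]addrC => ->.
    by rewrite normrM (gtr0_norm m0) ler_wpM2r// ltW.
  have {}yc : c + 1 < `|y|.
    by rewrite ltNge; apply/negP => yc'; apply: yc; apply/mem_set.
  rewrite mulr0 /F affine_rVE scale1r (sh y); last first.
    by rewrite (le_lt_trans _ yc)// lerDl.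
  rewrite sh ?subrr ?mulr0 ?normr0//.
  have : `|m.+1%:R^-1 *: v| <= 1.
    by rewrite normrZ (gtr0_norm m0) mulr_ile1// ltW.
  have := ler_normB (y + m.+1%:R^-1 *: v) (m.+1%:R^-1 *: v); rewrite addrK.
  by lra.
have mB := @measurable_rV_ball R n (c + 1).
have iG : rintegrable (fun y => C * \1_[set y : 'rV[R]_n | `|y| <= c + 1] y).
  apply: rintegrableZ; apply: (@rintegrable_bounded_support _ 1 (c + 1)).
  - exact: measurable_indic.
  - by move=> x; rewrite indicE ger0_norm// lern1 leq_b1.
  - move=> x xc; rewrite indicE memNset//= => xc'.
    by have := lt_le_trans xc xc'; rewrite ltxx.
have := Rintegral_dct mF Fcvg iG FC.
under eq_fun do rewrite F0.
by move=> /(cvg_unique _ (cvg_cst (0 : R)))/esym; apply.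
Qed.

End derivative_decay.

Section band_limited_decay.
Context {R : realType} {n : nat}.
Notation mu := (lebesgue_rV n).
Notation rintegrable f := (mu.-integrable setT (fun x => (f x)%:E)).
Implicit Types f g : 'rV[R]_n -> R[i].

Definition test_function (c : R) g := smooth g /\ forall y, c < `|y| -> g y = 0.

Lemma test_function_ccontinuous c g : test_function c g -> ccontinuous g.
Proof. by move=> [/(_ [::])[]]. Qed.

Lemma test_function_partial c g i : test_function c g -> test_function c (partial i g).
Proof.
move=> [sg g0]; split.
  move=> s; have := sg (rcons s i).
  by rewrite /partials foldr_rcons.
move=> y yc.
(* The complement of the closed ball is open, so [g] vanishes near y and its derivatives are those
   of the zero function. *)
have near0 : \near y, g y = 0.
  have o : open [set z : 'rV[R]_n | c < `|z|].
    rewrite (_ : [set z | _] = (fun z : 'rV[R]_n => `|z| : R) @^-1` [set t | c < t])//.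
    by apply: open_comp; [move=> z _; exact: norm_continuous|exact: open_gt].
  have : nbhs y [set z : 'rV[R]_n | c < `|z|] by exact: open_nbhs_nbhs.
  by apply: filterS => z; exact: g0.
rewrite /partial (@near_eq_derive _ _ _ _ (cst (0 : R))); last first.
  by apply: filterS near0 => z ->.
rewrite (@near_eq_derive _ _ _ (fun y => complex.Im (g y)) (cst (0 : R))); last first.
  by apply: filterS near0 => z ->.
by rewrite !derive_cst.
Qed.

Lemma dotp_delta (x : 'rV[R]_n) i : dotp x (delta_mx ord0 i) = x ord0 i.
Proof.
rewrite /dotp (bigD1 i)//= mxE !eqxx mulr1 big1 ?addr0// => j ji.
by rewrite mxE eqxx (negbTE ji) mulr0.
Qed.

Lemma is_derive_affine (a b t : R) : is_derive t 1 (fun s : R => a * s + b) a.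
Proof.
have H : is_derive t (1 : R) (a *: (id : R -> R) + cst b) (a *: (1 : R) + 0).
    by apply: is_deriveD.
by apply: is_derive_eq H _; rewrite addr0 [LHS]mulr1.
Qed.

Lemma is_derive_cos_dotp (x xi : 'rV[R]_n) i :
  is_derive xi (delta_mx ord0 i) (fun y => cos (2 * pi * dotp x y))
    (- (2 * pi * x ord0 i * sin (2 * pi * dotp x xi))).
Proof.
have -> : xi = (0 : R) *: delta_mx ord0 i + xi by rewrite scale0r add0r.
apply/is_derive_lineP.
rewrite (_ : (fun s : R => _) = cos \o (fun s => 2 * pi * x ord0 i * s + 2 * pi * dotp x xi)).
  have H := is_derive1_comp (is_derive_cos _) (is_derive_affine (2 * pi * x ord0 i) (2 * pi * dotp x xi) 0).
  by apply: is_derive_eq H _; rewrite mulr0 add0r scale0r add0r; ring.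
apply/funext => s /=; rewrite dotpDr dotpZr dotp_delta.
by congr cos; ring.
Qed.

Lemma is_derive_sin_dotp (x xi : 'rV[R]_n) i :
  is_derive xi (delta_mx ord0 i) (fun y => sin (2 * pi * dotp x y))
    (2 * pi * x ord0 i * cos (2 * pi * dotp x xi)).
Proof.
have -> : xi = (0 : R) *: delta_mx ord0 i + xi by rewrite scale0r add0r.
apply/is_derive_lineP.
rewrite (_ : (fun s : R => _) = sin \o (fun s => 2 * pi * x ord0 i * s + 2 * pi * dotp x xi)).
  have H := is_derive1_comp (is_derive_sin _) (is_derive_affine (2 * pi * x ord0 i) (2 * pi * dotp x xi) 0).
  by apply: is_derive_eq H _; rewrite mulr0 add0r scale0r add0r; ring.
apply/funext => s /=; rewrite dotpDr dotpZr dotp_delta.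
by congr sin; ring.
Qed.

Lemma delta_mx_norm_le1 i : `|delta_mx ord0 i : 'rV[R]_n| <= 1.
Proof.
apply/rV_norm_leP => // j; rewrite mxE eqxx/=.
by case: (j == i); rewrite ?normr1 ?normr0.
Qed.

Lemma dotp_continuous (x : 'rV[R]_n) : continuous (dotp x).
Proof.
apply: (@lipschitz_continuous_rV R n _ (n%:R * `|x|)) => y z.
have -> : dotp x y - dotp x z = dotp x (y - z) by rewrite dotpDr (dotpC x (- z)) dotpNl (dotpC z).
by rewrite -mulrA dotp_norm_le.
Qed.

Lemma continuous_scale_rV (k : R) (h : 'rV[R]_n -> R) :
  continuous h -> continuous (fun y => k * h y).
Proof.
move=> ch y; apply: (@continuousM _ _ (cst k) h y); first exact: cst_continuous.
exact: ch.
Qed.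

Lemma ccontinuousM f g : ccontinuous f -> ccontinuous g -> ccontinuous (fun x => f x * g x).
Proof.
move=> [fr fi] [gr gi]; split => x.
  under eq_fun do rewrite ReM.
  apply: (@continuousB _ _ _ (fun x => complex.Re (f x) * complex.Re (g x))
     (fun x => complex.Im (f x) * complex.Im (g x))).
    by apply: continuousM; [exact: fr|exact: gr].
  by apply: continuousM; [exact: fi|exact: gi].
under eq_fun do rewrite ImM.
apply: (@continuousD _ _ _ (fun x => complex.Re (f x) * complex.Im (g x))
   (fun x => complex.Im (f x) * complex.Re (g x))).
  by apply: continuousM; [exact: fr|exact: gi].
by apply: continuousM; [exact: fi|exact: gr].
Qed.

Lemma ccontinuous_phase (x : 'rV[R]_n) : ccontinuous (fun xi => cexp (2 * pi * dotp x xi)).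
Proof.
have H : continuous (fun xi => 2 * pi * dotp x xi).
  by apply: continuous_scale_rV; exact: dotp_continuous.
split=> y.
  exact: (@continuous_comp _ _ _ (fun xi => 2 * pi * dotp x xi) cos y (H y) (@continuous_cos R _)).
exact: (@continuous_comp _ _ _ (fun xi => 2 * pi * dotp x xi) sin y (H y) (@continuous_sin R _)).
Qed.

(** Integration by parts: the derivative of g times the phase integrates to zero. With k = 2 pi x_i
    it equals (partial g + i k g) times the phase; [A1] and [A2] are its real and imaginary
    parts. *)
Lemma ifourier_partial c g i (x : 'rV[R]_n) : test_function c g ->
  ifourier (partial i g) x = (0 +i* (- (2 * pi * x ord0 i))) * ifourier g x.
Proof.
move=> tg; have tpg := test_function_partial i tg.
have cg := test_function_ccontinuous tg; have cpg := test_function_ccontinuous tpg.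
have Ig : cintegrable g.
  apply: rapid_cintegrable; first exact: continuous_cmeasurable.
  exact: compact_rapid cg tg.2.
have Ipg : cintegrable (partial i g).
  apply: rapid_cintegrable; first exact: continuous_cmeasurable.
  exact: compact_rapid cpg tpg.2.
have mx := measurable_phaser (2 * pi) x.
have [IgR IgI] := cintegrable_phase Ig mx.
have [IpR IpI] := cintegrable_phase Ipg mx.
have [cgR cgI] := ccontinuousM cg (ccontinuous_phase x).
have [cpR cpI] := ccontinuousM cpg (ccontinuous_phase x).
pose e y := cexp (2 * pi * dotp x y).
pose k := 2 * pi * x ord0 i.
have Dr y : is_derive y (delta_mx ord0 i) (fun y => complex.Re (g y)) (complex.Re (partial i g y)).
  by apply: derivableP; exact: ((tg.1 [::]).2 i y).1.
have Di y : is_derive y (delta_mx ord0 i) (fun y => complex.Im (g y)) (complex.Im (partial i g y)).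
  by apply: derivableP; exact: ((tg.1 [::]).2 i y).2.
have A1 : \int[mu]_y (complex.Re (partial i g y * e y) - k * complex.Im (g y * e y)) = 0.
  apply: (@Rintegral_derive_eq0 R n (fun y => complex.Re (g y * e y)) _ (delta_mx ord0 i) c).
  - exact: delta_mx_norm_le1.
  - exact: cgR.
  - move=> y; apply: (@continuousB _ _ _ (fun y => complex.Re (partial i g y * e y)) (fun y => k * complex.Im (g y * e y))); first exact: cpR.
    exact: continuous_scale_rV.
  - by move=> y yc; rewrite tg.2// mul0r.
  - by move=> y yc; rewrite tg.2// tpg.2// !mul0r mulr0 subr0.
  - move=> y; under eq_fun do rewrite ReM.
    apply: is_derive_eq.
      apply: is_deriveB; apply: is_deriveM.
        exact: is_derive_cos_dotp.
      exact: is_derive_sin_dotp.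
    by rewrite /k ReM ImM /GRing.scale/=; ring.
have A2 : \int[mu]_y (complex.Im (partial i g y * e y) + k * complex.Re (g y * e y)) = 0.
  apply: (@Rintegral_derive_eq0 R n (fun y => complex.Im (g y * e y)) _ (delta_mx ord0 i) c).
  - exact: delta_mx_norm_le1.
  - exact: cgI.
  - move=> y; apply: (@continuousD _ _ _ (fun y => complex.Im (partial i g y * e y)) (fun y => k * complex.Re (g y * e y))); first exact: cpI.
    exact: continuous_scale_rV.
  - by move=> y yc; rewrite tg.2// mul0r.
  - by move=> y yc; rewrite tg.2// tpg.2// !mul0r mulr0 addr0.
  - move=> y; under eq_fun do rewrite ImM.
    apply: is_derive_eq.
      apply: is_deriveD; apply: is_deriveM.
        exact: is_derive_sin_dotp.
      exact: is_derive_cos_dotp.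
    by rewrite /k ReM ImM /GRing.scale/=; ring.
rewrite RintegralB ?RintegralZl// in A1; last exact: rintegrableZ.
rewrite RintegralD ?RintegralZl// in A2; last exact: rintegrableZ.
rewrite /ifourier /cint; apply: complex_eq; rewrite ?ReM ?ImM/=.
  by rewrite mul0r sub0r mulNr opprK; apply/eqP; rewrite -subr_eq0; apply/eqP.
by rewrite mul0r add0r mulNr; apply/eqP; rewrite -subr_eq0 opprK; apply/eqP.
Qed.

End band_limited_decay.

Section wavelet_decay.
Context {R : realType} {n : nat}.
Notation mu := (lebesgue_rV n).
Notation rintegrable f := (mu.-integrable setT (fun x => (f x)%:E)).
Implicit Types f g phi psi : 'rV[R]_n -> R[i].

Lemma test_function_rapid c g : test_function c g -> rapid g.
Proof. by move=> tg; apply: compact_rapid tg.2; exact: test_function_ccontinuous tg. Qed.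

Lemma test_function_cintegrable c g : test_function c g -> cintegrable g.
Proof.
move=> tg; apply: rapid_cintegrable; last exact: test_function_rapid tg.
by apply: continuous_cmeasurable; exact: test_function_ccontinuous tg.
Qed.

Lemma test_function_iter c g i m : test_function c g -> test_function c (iter m (partial i) g).
Proof. by move=> tg; elim: m => //= m; exact: test_function_partial. Qed.

Lemma cmod_ifourier_iter c g i m (x : 'rV[R]_n) : test_function c g ->
  cmod (ifourier (iter m (partial i) g) x) =
  (2 * pi * `|x ord0 i|) ^+ m * cmod (ifourier g x).
Proof.
move=> tg; elim: m => [|m IH]; first by rewrite expr0 mul1r.
rewrite iterS (ifourier_partial i x (test_function_iter i m tg)) cmodM IH exprS.
have E (t : R) : cmod (0 +i* t) = `|t| by rewrite /cmod/= expr0n/= add0r sqrtr_sqr.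
rewrite -[RHS]mulrA E normrN normrM ger0_norm//.
by rewrite mulr_ge0// pi_ge0.
Qed.

Lemma cmod_ifourier_le g (x : 'rV[R]_n) : cintegrable g ->
  cmod (ifourier g x) <= 2 * \int[mu]_y cmod (g y).
Proof.
move=> Ig; apply: le_cmod_cint (rintegrable_cmod Ig) _ => [|y].
  exact: (cintegrable_phase Ig (measurable_phaser (2 * pi) x)).
by rewrite cmodM cmod_cexp mulr1.
Qed.

Lemma rV_norm_attained (x : 'rV[R]_n) : 0 < `|x| -> exists i, `|x ord0 i| = `|x|.
Proof.
move=> x0; apply: contrapT => /forallNP H.
have : `|x| < `|x|; last by rewrite ltxx.
rewrite {1}/Num.norm/= mx_normrE; apply/bigmax_ltP; split => // -[i j] _ /=.
rewrite (ord1 i) lt_neqAle rV_norm_coord andbT; apply/eqP; exact: H.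
Qed.

(** Differentiating k times along a coordinate that attains |x| gains the factor (2 pi |x|)^k, while
    the transform of the derivative is bounded by its L^1 norm. The sum over i covers every choice
    of coordinate. *)
Lemma test_function_ifourier_rapid c g : test_function c g -> rapid (ifourier g).
Proof.
move=> tg k.
pose C0 := 2 * \int[mu]_y cmod (g y).
pose C i := 2 * \int[mu]_y cmod (iter k (partial i) g y).
have C00 : 0 <= C0 by rewrite mulr_ge0// Rintegral_ge0// => y _; exact: cmod_ge0.
have Ci0 i : 0 <= C i by rewrite mulr_ge0// Rintegral_ge0// => y _; exact: cmod_ge0.
exists (2 ^+ k * (C0 + \sum_i C i)) => x.
have H0 : cmod (ifourier g x) <= C0.
  by apply: cmod_ifourier_le; exact: test_function_cintegrable tg.
have [x1|x1] := leP `|x| 1.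
  apply: ler_pM; rewrite ?exprn_ge0 ?cmod_ge0 ?(ltW (onePnorm_gt0 _))//.
    by rewrite lerXn2r ?nnegrE ?(ltW (onePnorm_gt0 _))//; lra.
  by rewrite (le_trans H0)// lerDl sumr_ge0.
have [i xi] := rV_norm_attained (lt_trans ltr01 x1).
have Hi : (2 * pi * `|x ord0 i|) ^+ k * cmod (ifourier g x) <= C i.
  rewrite -(cmod_ifourier_iter i k x tg); apply: cmod_ifourier_le.
  exact: test_function_cintegrable (test_function_iter i k tg).
(* For |x| > 1 one has 1 + |x| <= 2 |x| <= 2 (2 pi |x|), and |x| = |x_i|. *)
apply: (@le_trans _ _ (2 ^+ k * ((2 * pi * `|x ord0 i|) ^+ k * cmod (ifourier g x)))).
  rewrite mulrA ler_wpM2r ?cmod_ge0// -exprMn.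
  have p2 : 2 <= pi :> R by exact: pi_ge2.
  rewrite lerXn2r ?nnegrE ?(ltW (onePnorm_gt0 _))//.
    by rewrite !mulr_ge0// pi_ge0.
  rewrite xi mulrA (@le_trans _ _ (2 * `|x|))//; first by lra.
  by rewrite ler_wpM2r// ler_peMr// mulr_ege1//; lra.
rewrite ler_wpM2l ?exprn_ge0// (le_trans Hi)// (bigD1 i)//= addrCA lerDl.
exact: addr_ge0 C00 (sumr_ge0 _ (fun j _ => Ci0 j)).
Qed.

Lemma band_limited_test a b psi : band_limited a b psi -> test_function b (fourier psi).
Proof.
by move=> [_ _ sp supp]; split => // y yb; exact: supported_in_annulus_out supp yb.
Qed.

Lemma band_limited_inversion (c1 c2 : R) phi : (0 < n)%N ->
  littlewood_paley c1 c2 phi ->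
  exists kappa : R[i], forall a b psi, band_limited a b psi ->
    forall x, psi x = kappa * ifourier (fourier psi) x.
Proof.
move=> n0 lp; have [kappa H] := fourier_inversion n0 lp.
exists kappa => a b psi bl x; have [cp Ip _ _] := bl.
by apply: H => //; exact: test_function_cintegrable (band_limited_test bl).
Qed.

(** By inversion the generator is a multiple of the inverse transform of a test function. *)
Lemma band_limited_rapid (c1 c2 a b : R) phi psi : (0 < n)%N ->
  littlewood_paley c1 c2 phi -> band_limited a b psi -> rapid psi.
Proof.
move=> n0 lp bl k; have [kappa H] := band_limited_inversion n0 lp.
have [C HC] := test_function_ifourier_rapid (band_limited_test bl) k.
exists (cmod kappa * C) => x; rewrite (H _ _ _ bl) cmodM mulrCA.
by rewrite ler_wpM2l ?cmod_ge0.
Qed.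

End wavelet_decay.

Section dyadic_dilation.
Context {R : realType} {n : nat}.
Implicit Types phi psi : 'rV[R]_n -> R[i].

Lemma dyadicE phi (j : int) (x : 'rV[R]_n) :
  dyadic phi j x = (((2 : R) ^ j) ^+ n)%:C * phi (affine_rV ((2 : R) ^ j) 0 x).
Proof. by rewrite /dyadic affine_rVE addr0 -exprz_exp. Qed.

Lemma two_expz_gt0 (j : int) : 0 < (2 : R) ^ j.
Proof. by rewrite exprz_gt0. Qed.

Lemma ccontinuous_cst (a : R[i]) : ccontinuous (fun _ : 'rV[R]_n => a).
Proof. by split=> x; exact: cst_continuous. Qed.

Lemma dyadic_ccontinuous phi j : ccontinuous phi -> ccontinuous (dyadic phi j).
Proof.
move=> cp; rewrite (_ : dyadic phi j = fun x => (((2 : R) ^ j) ^+ n)%:C * phi (affine_rV ((2 : R) ^ j) 0 x)).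
  by apply: ccontinuousM; [exact: ccontinuous_cst|exact: ccontinuous_affine].
by apply/funext => x; rewrite dyadicE.
Qed.

Lemma dyadic_rapid phi j : rapid phi -> rapid (dyadic phi j).
Proof.
move=> rp k; have [C HC] := rp k.
pose r := (2 : R) ^ j; have r0 : 0 < r := two_expz_gt0 j.
exists ((1 + r^-1) ^+ k * r ^+ n * C) => x.
rewrite dyadicE affine_rVE addr0 cmodM cmod_real ger0_norm ?exprn_ge0 ?(ltW r0)//.
rewrite -/r mulrCA [leRHS]mulrAC [leRHS]mulrC ler_wpM2l ?exprn_ge0 ?(ltW r0)//.
(* Uses 1 + |x| <= (1 + 1/r) (1 + |r x|). *)
apply: (@le_trans _ _ ((1 + r^-1) ^+ k * ((1 + `|r *: x|) ^+ k * cmod (phi (r *: x))))).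
  have ri : 0 < r^-1 by rewrite invr_gt0.
  rewrite mulrA ler_wpM2r ?cmod_ge0// -exprMn lerXn2r ?nnegrE ?(ltW (onePnorm_gt0 _))//.
    by rewrite mulr_ge0 ?(ltW (onePnorm_gt0 _))// addr_ge0// ltW.
  rewrite normrZ (gtr0_norm r0) mulrDl !mulrDr !mul1r !mulr1 mulrA mulVf ?gt_eqF// mul1r.
  have := normr_ge0 x; set t := `|x| => t0.
  have rt : 0 <= r * t by rewrite mulr_ge0// ltW.
  by lra.
by rewrite ler_wpM2l// exprn_ge0// addr_ge0// invr_ge0 ltW.
Qed.

Lemma fourier_dyadic phi j (xi : 'rV[R]_n) : cintegrable phi ->
  fourier (dyadic phi j) xi = fourier phi ((2 : R) ^ (- j) *: xi).
Proof.
move=> Ip; pose r := (2 : R) ^ j; have r0 : 0 < r := two_expz_gt0 j.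
have -> : (2 : R) ^ (- j) = r^-1 by rewrite /r invr_expz.
pose h z := phi z * cexp (- (2 * pi * dotp z (r^-1 *: xi))).
have Ih : cintegrable h by exact: (cintegrable_phase Ip (measurable_phaseN _)).
have Ihr : cintegrable (fun x => h (r *: x)).
  have := cintegrable_affine 0 (lt0r_neq0 r0) Ih.
  by under [X in cintegrable X]eq_fun do rewrite affine_rVE addr0.
transitivity (cint (fun x => (r ^+ n)%:C * h (r *: x))).
  congr cint; apply/funext => x; rewrite dyadicE -/r affine_rVE addr0 /h -mulrA.
  congr (_ * (_ * cexp _)).
  by rewrite dotpZl dotpZr; field; rewrite gt_eqF.
rewrite cintZ// cint_dilation// mulrA -realCM mulfV ?mul1r//.
by rewrite expf_neq0// gt_eqF.
Qed.

End dyadic_dilation.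

(** * Convolution with dyadic blocks *)

Section convolution.
Context {R : realType} {n : nat}.
Notation mu := (lebesgue_rV n).
Notation rintegrable f := (mu.-integrable setT (fun x => (f x)%:E)).
Implicit Types f g phi psi : 'rV[R]_n -> R[i].

Lemma measurable_reflect (x : 'rV[R]_n) : measurable_fun setT (fun y : 'rV[R]_n => x - y).
Proof.
have := @measurable_affine_rV R n (-1) x.
by rewrite (_ : affine_rV (-1) x = (fun y => x - y))//; apply/funext => y; rewrite affine_rVE scaleN1r addrC.
Qed.

Lemma cmeas_conv_integrand phi psi : cmeasurable phi -> cmeasurable psi ->
  cmeas (fun z : 'rV[R]_n * 'rV[R]_n => phi (z.1 - z.2) * psi z.2).
Proof.
move=> mp mq; apply: cmeasM; last exact: (cmeas_comp mq measurable_snd).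
apply: (cmeas_comp mp); under eq_fun do rewrite -scaleN1r.
apply: measurable_rVD; first exact: measurable_fst.
by apply: measurable_rVZ; exact: measurable_snd.
Qed.

Lemma conv_cmeasurable phi psi : cmeasurable phi -> cmeasurable psi ->
  cmeasurable (Defs.conv phi psi).
Proof.
move=> mp mq; exact: (cint_param_measurable (cmeas_conv_integrand mp mq)).
Qed.

Lemma cintegrable_conv_integrand phi psi (x : 'rV[R]_n) : cmeasurable phi -> rapid phi ->
  cintegrable psi -> cintegrable (fun y => phi (x - y) * psi y).
Proof.
move=> mp rp Iq; have [B HB] := rapid_bounded rp.
apply: (cintegrable_le _ (rintegrableZ B (rintegrable_cmod Iq))) => [|y].
  apply: cmeasM; last exact: cintegrable_meas.
  exact: (cmeas_comp mp (measurable_reflect x)).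
by rewrite cmodM ler_wpM2r ?cmod_ge0.
Qed.

(** Each power of 1 + |x| is shared between the two factors; [psi] gives up n + 2 further powers to
    keep the integral finite. *)
Lemma conv_rapid phi psi : cmeasurable phi -> cmeasurable psi ->
  rapid phi -> rapid psi -> rapid (Defs.conv phi psi).
Proof.
move=> mp mq rp rq k; have [C1 H1] := rp k; have [C2 H2] := rq (k + (n + 2))%N.
have C10 : 0 <= C1 by apply: le_trans (H1 0); rewrite mulr_ge0 ?cmod_ge0// exprn_ge0 ?(ltW (onePnorm_gt0 _)).
have Iq := rapid_cintegrable mq rq.
pose I : R := \int[mu]_y ((1 + `|y|) ^- (n + 2)).
exists (2 * (C1 * C2 * I)) => x.
have x0 := onePnorm_gt0 x.
pose h (y : 'rV[R]_n) : R := ((1 + `|x|) ^- k * (C1 * C2)) * (1 + `|y|) ^- (n + 2).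
have ih : rintegrable h by apply: rintegrableZ; exact: rintegrable_poly.
have le y : cmod (phi (x - y) * psi y) <= h y.
  rewrite cmodM /h.
  have y0 := onePnorm_gt0 y; have xy0 := onePnorm_gt0 (x - y).
  rewrite ler_pdivlMr ?exprn_gt0// [leRHS]mulrC ler_pdivlMr ?exprn_gt0//.
  (* Peetre's inequality 1 + |x| <= (1 + |x - y|) (1 + |y|). *)
  have H3 : (1 + `|x|) ^+ k <= (1 + `|x - y|) ^+ k * (1 + `|y|) ^+ k.
    rewrite -exprMn lerXn2r ?nnegrE ?mulr_ge0 ?(ltW x0) ?(ltW y0) ?(ltW xy0)//.
    have := ler_normD (x - y) y; rewrite subrK => H.
    rewrite mulrDl !mulrDr !mul1r mulr1.
    have : 0 <= `|x - y| * `|y| by rewrite mulr_ge0.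
    by lra.
  apply: (@le_trans _ _ (((1 + `|x - y|) ^+ k * cmod (phi (x - y))) * ((1 + `|y|) ^+ (k + (n + 2)) * cmod (psi y)))).
    rewrite (exprD _ k (n + 2)) [leLHS]mulrC -(mulrA ((1 + `|y|) ^+ k)) [leRHS]mulrACA.
    rewrite (mulrC ((1 + `|y|) ^+ (n + 2))) (mulrA (cmod _)) ler_wpM2r//.
    by rewrite !mulr_ge0 ?cmod_ge0// exprn_ge0 ?(ltW y0).
  by apply: ler_pM => //; rewrite mulr_ge0 ?cmod_ge0// exprn_ge0 ?(ltW y0) ?(ltW xy0).
have IF := cintegrable_conv_integrand x mp rp Iq.
rewrite mulrC -ler_pdivlMr ?exprn_gt0//; apply: le_trans (le_cmod_cint IF ih le) _.
rewrite /h RintegralZl//; last exact: rintegrable_poly.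
rewrite -/I le_eqVlt; apply/orP; left; apply/eqP.
by rewrite -(mulrA (_ ^- k)) mulrCA mulrC.
Qed.

Lemma conv_shift phi psi (k x : 'rV[R]_n) : cmeasurable phi -> rapid phi -> cintegrable psi ->
  cint (fun y => phi (x - y) * psi (y - k)) = Defs.conv phi psi (x - k).
Proof.
move=> mp rp Iq; rewrite /Defs.conv.
pose h y := phi (x - k - y) * psi y.
have Ih : cintegrable h by exact: cintegrable_conv_integrand.
transitivity (cint (fun y => h (affine_rV 1 (- k) y))).
  congr cint; apply/funext => y; rewrite /h affine_rVE scale1r; congr (phi _ * _).
  by rewrite opprD opprK addrACA addNr addr0.
by rewrite cint_affine ?oner_eq0// normr1 expr1n invr1 mul1r.
Qed.

(* Inserting the inversion formula for [psi] turns the convolution into the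
   inverse transform of the product of the two Fourier transforms. *)
Lemma conv_eq0 phi psi (kappa : R[i]) : cmeasurable phi -> rapid phi ->
  cintegrable (fourier psi) -> (forall x, psi x = kappa * ifourier (fourier psi) x) ->
  (forall xi, fourier phi xi * fourier psi xi = 0) -> forall x, Defs.conv phi psi x = 0.
Proof.
move=> mp rp If E H0 x; rewrite /Defs.conv.
have Ip := rapid_cintegrable mp rp.
have mf := cintegrable_meas If.
pose F (y xi : 'rV[R]_n) := (kappa * phi (x - y)) * (fourier psi xi * cexp (2 * pi * dotp y xi)).
have n1 : (-1 : R) != 0 by rewrite oppr_eq0 oner_eq0.
have Ipx : cintegrable (fun y => phi (x - y)).
  have := cintegrable_affine x n1 Ip.
  by under [X in cintegrable X]eq_fun do rewrite affine_rVE scaleN1r addrC.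
transitivity (cint (fun y => cint (F y))).
  congr cint; apply/funext => y; rewrite /F cintZ; last exact: (cintegrable_phase If (measurable_phaser (2 * pi) y)).
  by rewrite E mulrCA mulrA.
rewrite (@cint_fubini _ _ _ F (fun y => cmod kappa * cmod (phi (x - y))) (fun xi => cmod (fourier psi xi))); last 6 first.
- apply: cmeasM.
    apply: cmeasM; first exact: cmeas_cst.
    exact: (cmeas_comp mp (measurableT_comp (measurable_reflect x) measurable_fst)).
  apply: cmeasM; first exact: (cmeas_comp mf measurable_snd).
  apply: cmeas_cexp; apply: measurable_funM => //.
  by apply: measurable_dotp; [exact: measurable_fst|exact: measurable_snd].
- by apply: rintegrableZ; exact: rintegrable_cmod.
- exact: rintegrable_cmod.
- by move=> y; rewrite mulr_ge0 ?cmod_ge0.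
- by move=> y; exact: cmod_ge0.
- by move=> y xi; rewrite /F !cmodM cmod_cexp mulr1.
rewrite -[RHS](@cint0 R n); congr cint; apply/funext => xi.
pose h z := phi z * cexp (- (2 * pi * dotp z xi)).
have Ih : cintegrable h := cintegrable_phase Ip (measurable_phaseN xi).
(* The substitution y -> x - y turns the inner integral into a phase times the transform of [phi],
   so the vanishing product of transforms appears. *)
transitivity (cint (fun y => (kappa * fourier psi xi * cexp (2 * pi * dotp x xi)) * h (affine_rV (-1) x y))).
  congr cint; apply/funext => y; rewrite /F /h affine_rVE scaleN1r [- y + x]addrC.
  rewrite dotpDl dotpNl.
  have -> : cexp (2 * pi * dotp y xi) = cexp (2 * pi * dotp x xi) * cexp (- (2 * pi * (dotp x xi - dotp y xi))).
    by rewrite -cexpD; congr cexp; ring.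
  by ring.
rewrite cintZ; last exact: cintegrable_affine.
rewrite cint_affine// normrN normr1 expr1n invr1 mul1r -/(fourier phi xi).
have := H0 xi; rewrite mulrC => H.
by rewrite -(mulrA kappa) [X in kappa * X]mulrC mulrA -mulrA H mulr0.
Qed.

End convolution.

(** * Decay envelopes and sums of translates *)

Section decay_envelope.
Context {R : realType} {n : nat}.
Notation mu := (lebesgue_rV n).
Notation rintegrable f := (mu.-integrable setT (fun x => (f x)%:E)).
Implicit Types h : 'rV[R]_n -> R[i].

(** The envelope as a real sequence with all that is used about it, so that the differences in
    [envelope_sum] become ordinary subtractions. *)
Record envelope_seq h (b : nat -> R) := EnvelopeSeq {
  envelope_seqE : forall i, envelope h i = (b i)%:E ;
  envelope_seq_ge0 : forall i, 0 <= b i ;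
  envelope_seq_dec : forall i, b i.+1 <= b i ;
  envelope_seq_ub : forall i z, i%:R - 1 <= `|z| -> cmod (h z) <= b i ;
  envelope_seq_rapid : forall k, exists C, forall i, i%:R ^+ k * b i <= C }.

Lemma rapid_envelope h : (0 < n)%N -> rapid h -> exists b, envelope_seq h b.
Proof.
move=> n0 rh.
pose S i := [set (cmod (h z))%:E | z in [set z | i%:R - 1 <= `|z| :> R]].
have [B HB] := rapid_bounded rh.
(* A point of norm at least i - 1 keeps each supremum over a nonempty set; over the empty set it
   would be -oo. *)
pose zi i : 'rV[R]_n := const_mx i%:R.
have zin i : i%:R - 1 <= `|zi i|.
  have := rV_norm_coord (zi i) (Ordinal n0); rewrite mxE ger0_norm// => H.
  by apply: le_trans H; rewrite gerBl.
have Ub i z : i%:R - 1 <= `|z| -> ((cmod (h z))%:E <= envelope h i)%E.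
  by move=> zz; apply: ereal_sup_ubound; exists z.
have Le i (M : R) : (forall z, i%:R - 1 <= `|z| -> cmod (h z) <= M) -> (envelope h i <= M%:E)%E.
  by move=> H; apply: ge_ereal_sup => _ [z /= zz <-]; rewrite lee_fin; exact: H.
have Ge0 i : (0 <= envelope h i)%E.
  by apply: le_trans (Ub i _ (zin i)); rewrite lee_fin cmod_ge0.
have Fin i : envelope h i \is a fin_num.
  rewrite ge0_fin_numE//; apply: le_lt_trans (ltry B).
  by apply: Le => z _; exact: HB.
exists (fun i => fine (envelope h i)); split.
- by move=> i; rewrite fineK.
- by move=> i; apply: fine_ge0.
- move=> i; rewrite -lee_fin !fineK//.
  rewrite -[leRHS]fineK//; apply: Le => z zz; rewrite -lee_fin fineK//.
  by apply: Ub; apply: le_trans zz; rewrite lerD2r ler_nat.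
- by move=> i z zz; rewrite -lee_fin fineK//; exact: Ub.
- move=> k; have [C HC] := rh k; exists C => i.
  have C0 : 0 <= C by apply: le_trans (HC 0); rewrite mulr_ge0 ?cmod_ge0// exprn_ge0 ?(ltW (onePnorm_gt0 _)).
  case: i => [|i].
    (* At i = 0 the weight 0^k vanishes except for k = 0, where 0^0 = 1 and the bound is on sup |h|.
       For larger i, |z| >= i - 1 gives 1 + |z| >= i. *)
    case: k HC => [|k] HC; last by rewrite expr0n/= mul0r.
    rewrite expr0 mul1r -lee_fin fineK//; apply: Le => z _.
    by have := HC z; rewrite expr0 mul1r.
  have i0 : 0 < i.+1%:R ^+ k :> R by rewrite exprn_gt0.
  rewrite mulrC -ler_pdivlMr// -lee_fin fineK//; apply: Le => z zz.
  rewrite ler_pdivlMr// mulrC; apply: le_trans (HC z).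
  rewrite ler_wpM2r ?cmod_ge0// lerXn2r ?nnegrE ?(ltW (onePnorm_gt0 _))//.
  by move: zz; rewrite -natr1; lra.
Qed.

Section with_sequence.
Variables (h : 'rV[R]_n -> R[i]) (b : nat -> R) (eb : envelope_seq h b).

Definition envelope_step i := b i - b i.+1.

Lemma envelope_step_ge0 i : 0 <= envelope_step i.
Proof. by rewrite subr_ge0 (envelope_seq_dec eb). Qed.

Lemma envelope_sumE r : envelope_sum h r =
  (\sum_(0 <= i <oo) (envelope_step i * (2 * i + 1)%:R `^ r)%:E)%E.
Proof.
by apply: eq_eseriesr => i _; rewrite !(envelope_seqE eb) -EFinB -EFinM.
Qed.

Lemma envelope_sum_ge0 r : (0 <= envelope_sum h r)%E.
Proof.
rewrite envelope_sumE; apply: nneseries_ge0 => i _ _.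
by rewrite lee_fin mulr_ge0 ?powR_ge0// envelope_step_ge0.
Qed.

(** With r rounded up to a natural number K, decay of order K + 2 leaves a multiple of the series of
    (i+1)^-2. *)
Lemma envelope_sum_fin_num r : envelope_sum h r \is a fin_num.
Proof.
rewrite ge0_fin_numE; last exact: envelope_sum_ge0.
pose K := `|Num.ceil r|%N.
have rK : r <= K%:R.
  rewrite (le_trans (Num.Theory.ceil_ge _))// /K.
  by rewrite natr_absz ler_int ler_norm.
have [C HC] := envelope_seq_rapid eb (K + 2).
(* The factor 2^(K+2) replaces i by i + 1 in the decay bound, and b 0 covers i = 0, where that bound
   says nothing. *)
pose D := 2 ^+ (K + 2) * (C + b 0%N).
have C0 : 0 <= C.
  apply: le_trans (HC 0%N); apply: mulr_ge0; last exact: (envelope_seq_ge0 eb).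
  by rewrite exprn_ge0.
have b00 := envelope_seq_ge0 eb 0%N.
have HD i : i.+1%:R ^+ (K + 2) * b i <= D.
  case: i => [|i].
    rewrite expr1n mul1r /D; apply: (@le_trans _ _ (1 * (C + b 0%N))).
      by rewrite mul1r lerDr.
    by rewrite ler_wpM2r ?addr_ge0// exprn_ege1// ler1n.
  apply: (@le_trans _ _ (2 ^+ (K + 2) * (i.+1%:R ^+ (K + 2) * b i.+1))).
    rewrite mulrA -exprMn; apply: ler_wpM2r; first exact: (envelope_seq_ge0 eb).
    rewrite lerXn2r ?nnegrE ?mulr_ge0//.
    by rewrite -natrM ler_nat; lia.
  by rewrite ler_wpM2l ?exprn_ge0// (le_trans (HC _))// lerDl.
have D0 : 0 <= D by rewrite mulr_ge0 ?exprn_ge0// addr_ge0.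
apply: (@le_lt_trans _ _ (2 ^+ K * D * 2)%:E); last exact: ltry.
apply: le_trans (nneseries_inv_sqr_le _); last by rewrite mulr_ge0// exprn_ge0.
rewrite envelope_sumE; apply: lee_nneseries => i _.
  by rewrite lee_fin mulr_ge0 ?powR_ge0// envelope_step_ge0.
rewrite lee_fin.
apply: (@le_trans _ _ (b i * (2 * i.+1%:R) ^+ K)).
  apply: ler_pM; rewrite ?powR_ge0 ?envelope_step_ge0//.
    by rewrite gerBl (envelope_seq_ge0 eb).
  apply: (@le_trans _ _ ((2 * i + 1)%:R `^ K%:R)).
    by apply: ler_powR => //; rewrite ler1n addn1.
  rewrite powR_mulrn// lerXn2r ?nnegrE ?mulr_ge0//.
  by rewrite -natrM ler_nat; lia.
rewrite ler_pdivlMr ?exprn_gt0// exprMn (mulrCA (b i)) -(mulrA (2 ^+ K)) -(mulrA (b i)) -exprD.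
by rewrite ler_wpM2l ?exprn_ge0// mulrC.
Qed.

Lemma envelope_seq_lim e : 0 < e -> exists m0, forall m, (m0 <= m)%N -> b m <= e.
Proof.
move=> e0; have [C HC] := envelope_seq_rapid eb 1.
pose m0 := (Num.truncn (`|C| / e)).+1; exists m0 => m m0m.
have m0p : 0 < m%:R :> R by rewrite ltr0n (leq_trans _ m0m).
have H : `|C| / e <= m%:R.
  rewrite (le_trans (ltW (truncnS_gt _)))// ler_nat//.
have := HC m; rewrite expr1 => H2.
rewrite -(ler_pM2l m0p) (le_trans H2)// (le_trans (ler_norm _))//.
by rewrite -ler_pdivrMr.
Qed.

(* For [t <= |z| < t + 1] the telescoping tail from [t + 1] is [b (t + 1)],
   which dominates [|h z|]. *)
Lemma envelope_layers z :
  ((cmod (h z))%:E <=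
   \sum_(0 <= i <oo) (envelope_step i * \1_[set y : 'rV[R]_n | (`|y| <= i%:R)%R] z)%:E)%E.
Proof.
pose t := Num.truncn `|z|; have /andP[tz zt] := truncn_itv (normr_ge0 z).
have T0 i : (0 <= (envelope_step i * \1_[set y : 'rV[R]_n | (`|y| <= i%:R)%R] z)%:E)%E.
  by rewrite lee_fin mulr_ge0// envelope_step_ge0.
apply/lee_addgt0Pr => e e0.
have [m0 Hm0] := envelope_seq_lim e0.
(* Far enough for the telescoping sum to lose only b m <= e, and past t so that it starts at b (t +
   1). *)
pose m := maxn m0 t.+1.
apply: (@le_trans _ _ ((\sum_(0 <= i < m) (envelope_step i * \1_[set y : 'rV[R]_n | (`|y| <= i%:R)%R] z)%:E) + e%:E)%E); last first.
  by rewrite leeD2r//; exact: (nneseries_lim_ge m (fun i _ _ => T0 i)).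
rewrite sumEFin -EFinD lee_fin.
have tm : (t.+1 <= m)%N by rewrite leq_maxr.
rewrite (@big_cat_nat _ _ _ t.+1)//=.
have -> : \sum_(t.+1 <= i < m) envelope_step i * \1_[set y : 'rV[R]_n | (`|y| <= i%:R)%R] z = b t.+1 - b m.
  transitivity (\sum_(t.+1 <= i < m) (- b i.+1 - - b i)).
    apply: eq_big_nat => i /andP[ti _]; rewrite indicE mem_set/=.
      by rewrite mulr1 opprK addrC.
    by rewrite (le_trans (ltW zt))// ler_nat.
  by rewrite (telescope_sumr (fun i => - b i))// opprK addrC.
have h1 : cmod (h z) <= b t.+1.
  by apply: (envelope_seq_ub eb); rewrite -natr1 addrK.
have h2 : b m <= e by apply: Hm0; rewrite leq_maxl.
have h3 : 0 <= \sum_(0 <= i < t.+1) envelope_step i * \1_[set y : 'rV[R]_n | (`|y| <= i%:R)%R] z.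
  by apply: sumr_ge0 => i _; rewrite -lee_fin.
by lra.
Qed.

End with_sequence.

End decay_envelope.

Section shift_sums.
Context {R : realType} {n : nat}.
Notation mu := (lebesgue_rV n).
Notation rintegrable f := (mu.-integrable setT (fun x => (f x)%:E)).
Implicit Types (h psi : 'rV[R]_n -> R[i]) (s : seq nat).

Definition shift_row (m : nat) : 'rV[int]_n :=
  \row_(i < n) (if i == 0%N :> nat then m%:Z else 0).

Definition shift_vec (m : nat) : 'rV[R]_n := map_mx intr (shift_row m).

Definition shift_sum h s : 'rV[R]_n -> R[i] := fun x => \sum_(m <- s) h (x - shift_vec m).

Lemma wavelet0E h (k : 'rV[int]_n) x : wavelet h 0 k x = h (x - map_mx intr k).
Proof. by rewrite /wavelet mulr0z !mul0r powRr0 expr0z scale1r mul1r. Qed.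

Lemma fNE psi N : fN psi N = shift_sum psi (index_iota 1 (2 * N).+1).
Proof. by apply/funext => x; apply: eq_bigr => m _; rewrite wavelet0E. Qed.

(** All these numbers lie within 2 i of the smallest of them. *)
Lemma size_near_nat (t : R) (i : nat) s : uniq s ->
  (size [seq m <- s | (`|t - m%:R| <= i%:R)%R] <= 2 * i + 1)%N.
Proof.
move=> us; set l := [seq m <- s | _].
have [l0|l0] := eqVneq l [::]; first by rewrite l0.
have [m0 m0l Hm0] : exists2 m0, m0 \in l & forall m, m \in l -> (m0 <= m)%N.
  have ex : exists m, m \in l.
    by case: {+}l l0 => // a l' _; exists a; rewrite mem_head.
  by exists (ex_minn ex); case: ex_minnP.
rewrite -(size_iota m0 (2 * i + 1)); apply: uniq_leq_size; first exact: filter_uniq.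
move=> m ml; rewrite mem_iota Hm0//=.
move: (ml) (m0l); rewrite !mem_filter => /andP[h1 _] /andP[h2 _].
have : (m%:R : R) <= m0%:R + 2 * i%:R by move: h1 h2; rewrite !ler_norml; lra.
by rewrite -natrM -natrD ler_nat; lia.
Qed.

Lemma shift_vec0 m (n0 : (0 < n)%N) : shift_vec m ord0 (Ordinal n0) = m%:R.
Proof. by rewrite !mxE. Qed.

(** The maximum norm dominates the first coordinate, along which the shifts are distinct integers;
    the count does not depend on the dimension. *)
Lemma sum_indic_shift_le (i : nat) s x : (0 < n)%N -> uniq s ->
  \sum_(m <- s) \1_[set y : 'rV[R]_n | (`|y| <= i%:R)%R] (x - shift_vec m) <= (2 * i + 1)%:R :> R.
Proof.
move=> n0 us; set t := x ord0 (Ordinal n0).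
pose c m : nat := (`|t - m%:R| <= i%:R).
have H2 : \sum_(m <- s) (c m)%:R <= (2 * i + 1)%:R :> R; last first.
  apply: le_trans H2.
  apply: ler_sum => m _; rewrite indicE; case: (boolP (_ \in _)) => // /set_mem/= H.
  rewrite ler_nat lt0b; apply: le_trans H.
  have := rV_norm_coord (x - shift_vec m) (Ordinal n0).
  by rewrite mxE [X in _ + X]mxE shift_vec0.
rewrite -natr_sum ler_nat (leq_trans _ (size_near_nat t i us))//.
by rewrite -sum1_size big_filter [leqRHS]big_mkcond/=; apply: leq_sum => m _; rewrite /c; case: ifP.
Qed.

Section bounds.
Variables (h : 'rV[R]_n -> R[i]) (b : nat -> R) (eb : envelope_seq h b).
Hypothesis n0 : (0 < n)%N.

(** After exchanging the sums, layer i is met by at most 2 i + 1 translates, which r >= 1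
    absorbs. *)
Lemma shift_sum_sup s (r : R) x : uniq s -> 1 <= r ->
  ((\sum_(m <- s) cmod (h (x - shift_vec m)))%:E <= envelope_sum h r)%E.
Proof.
move=> us r1; rewrite (envelope_sumE eb) -sumEFin.
apply: (@le_trans _ _ (\sum_(m <- s) \sum_(0 <= i <oo)
   (envelope_step b i * \1_[set y : 'rV[R]_n | (`|y| <= i%:R)%R] (x - shift_vec m))%:E)%E).
  by apply: lee_sum => m _; exact: (envelope_layers eb).
rewrite -nneseries_sum; last first.
  by move=> m i _; rewrite lee_fin mulr_ge0// (envelope_step_ge0 eb).
apply: lee_nneseries => i _.
  by move=> _; apply: sume_ge0 => m _; rewrite lee_fin mulr_ge0// (envelope_step_ge0 eb).
rewrite sumEFin lee_fin -mulr_sumr; apply: ler_wpM2l; first exact: (envelope_step_ge0 eb).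
apply: le_trans (sum_indic_shift_le i x n0 us) _.
by rewrite -{1}(powRr1 (ler0n R (2 * i + 1))) ler_powR// ler1n addn1.
Qed.

(** Layer i sits on a ball of volume (2 i)^n <= (2 i + 1)^r. *)
Lemma shift_norm1 (r : R) : cmeasurable h -> n%:R <= r ->
  (\int[mu]_x (cmod (h x))%:E <= envelope_sum h r)%E.
Proof.
move=> mh rn; rewrite (envelope_sumE eb).
apply: (@le_trans _ _ (\sum_(0 <= i <oo) (envelope_step b i * (2 * i%:R) ^+ n)%:E)%E).
  rewrite -integral_layers//; last exact: (envelope_step_ge0 eb).
  apply: ge0_le_integral => //.
  - by move=> x _; rewrite lee_fin cmod_ge0.
  - by apply/measurable_EFinP; exact: measurable_cmod.
  - apply: ge0_emeasurable_sum => [i x _ _|i _].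
      by rewrite lee_fin mulr_ge0// (envelope_step_ge0 eb).
    apply/measurable_EFinP; apply: measurable_funM => //.
    by apply: measurable_indic; exact: measurable_rV_ball.
  - by move=> x _; exact: (envelope_layers eb).
apply: lee_nneseries => i _.
  by rewrite lee_fin mulr_ge0 ?(envelope_step_ge0 eb)// exprn_ge0// mulr_ge0.
rewrite lee_fin; apply: ler_wpM2l; first exact: (envelope_step_ge0 eb).
apply: (@le_trans _ _ ((2 * i + 1)%:R `^ n%:R)).
  rewrite powR_mulrn// lerXn2r ?nnegrE ?mulr_ge0//.
  by rewrite -natrM ler_nat; lia.
by rewrite ler_powR// ler1n addn1.
Qed.

End bounds.

End shift_sums.

Section Lp_of_shift_sums.
Context {R : realType} {n : nat}.
Notation mu := (lebesgue_rV n).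
Notation rintegrable f := (mu.-integrable setT (fun x => (f x)%:E)).
Implicit Types (f g h psi : 'rV[R]_n -> R[i]) (s : seq nat).

Lemma Lp_normE (p : R) f :
  Lp_norm p f = ((\int[mu]_x (cmod (f x) `^ p)%:E) `^ p^-1)%E.
Proof.
rewrite /Lp_norm unlock; congr (_ `^ _)%E; apply: eq_integral => x _.
by rewrite /= ger0_norm ?cmod_ge0.
Qed.

Lemma Lp_norm_ge0 (p : R) f : (0 <= Lp_norm p f)%E.
Proof. exact: Lnorm_ge0. Qed.

(** Elementary interpolation: |f|^p <= W^(p-1) H pointwise and the integral of H is at most W I, so
    the p-th power of the norm is at most W^p I. *)
Lemma Lp_norm_le_sup_norm1 (p : R) f (H : 'rV[R]_n -> R) (W I : R) : 1 < p ->
  cmeasurable f -> measurable_fun setT H -> (forall x, cmod (f x) <= H x) ->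
  (forall x, H x <= W) -> (\int[mu]_x (H x)%:E <= (W * I)%:E)%E -> 0 <= I ->
  (Lp_norm p f <= (W * I `^ p^-1)%:E)%E.
Proof.
move=> p1 mf mH fH HW HI I0.
have p0 : 0 < p by rewrite (lt_trans ltr01).
have H0 x : 0 <= H x by exact: le_trans (cmod_ge0 _) (fH x).
have W0 : 0 <= W by exact: le_trans (H0 0) (HW 0).
have mcf := measurable_cmod mf.
have -> : W * I `^ p^-1 = (W `^ p * I) `^ p^-1.
  by rewrite powRM ?powR_ge0// -powRrM mulfV ?gt_eqF// powRr1.
rewrite Lp_normE -poweR_EFin; apply: gt0_ler_poweR.
- by rewrite invr_ge0 ltW.
- by rewrite in_itv/= leey andbT integral_ge0// => x _; rewrite lee_fin powR_ge0.
- by rewrite in_itv/= leey andbT lee_fin mulr_ge0 ?powR_ge0.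
apply: (@le_trans _ _ (\int[mu]_x ((W `^ (p - 1))%:E * (H x)%:E))%E).
  apply: ge0_le_integral => //.
  - by move=> x _; rewrite lee_fin powR_ge0.
  - by apply/measurable_EFinP; apply: (measurableT_comp (measurable_powR p)).
  - by apply: measurable_funeM; exact/measurable_EFinP.
  move=> x _; rewrite -EFinM lee_fin -(mulr_powRB1 (cmod_ge0 _) p0) mulrC.
  apply: ler_pM; rewrite ?powR_ge0 ?cmod_ge0//.
  apply: ge0_ler_powR; rewrite ?nnegrE ?cmod_ge0//; first by rewrite subr_ge0 ltW.
  exact: le_trans (fH x) (HW x).
rewrite ge0_integralZl//; last 3 first.
- exact/measurable_EFinP.
- by move=> x _; rewrite lee_fin.
- by rewrite lee_fin powR_ge0.
apply: (@le_trans _ _ ((W `^ (p - 1))%:E * (W * I)%:E)%E).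
  by apply: lee_wpmul2l => //; rewrite lee_fin powR_ge0.
by rewrite -EFinM mulrA [_ * W]mulrC mulr_powRB1.
Qed.

Lemma cmeasurable_shift h (k : 'rV[R]_n) : cmeasurable h -> cmeasurable (fun x => h (x - k)).
Proof.
move=> mh; have := cmeas_comp mh (@measurable_affine_rV R n 1 (- k)).
by under [X in cmeas X -> _]eq_fun do rewrite affine_rVE scale1r.
Qed.

Lemma shift_sum_cmeasurable h s : cmeasurable h -> cmeasurable (shift_sum h s).
Proof. by move=> mh; apply: cmeas_sum => m; exact: cmeasurable_shift. Qed.

Lemma ge0_integral_shift (k : 'rV[R]_n) (F : 'rV[R]_n -> R) :
  measurable_fun setT F -> (forall x, 0 <= F x) ->
  (\int[mu]_x (F (x - k))%:E = \int[mu]_x (F x)%:E)%E.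
Proof.
move=> mF F0.
have := @ge0_integral_affine R n 1 (- k) (fun x => (F x)%:E) (oner_neq0 R).
rewrite normr1 expr1n invr1 mul1e => <-//; last exact/measurable_EFinP.
by apply: eq_integral => x _; rewrite affine_rVE scale1r.
Qed.

(** The envelope sum plays both roles in the interpolation: it bounds the sum of moduli pointwise
    and the L^1 norm of each translate. *)
Lemma Lp_shift_sum h s (p r : R) : (0 < n)%N -> 1 < p -> n%:R <= r ->
  cmeasurable h -> rapid h -> uniq s ->
  (Lp_norm p (shift_sum h s) <= envelope_sum h r * ((size s)%:R `^ p^-1)%:E)%E.
Proof.
move=> n0 p1 nr mh rh us.
have [b eb] := rapid_envelope n0 rh.
have r1 : 1 <= r by rewrite (le_trans _ nr)// ler1n.
have Wf := envelope_sum_fin_num eb r.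
rewrite -(fineK Wf) -EFinM.
pose H x := \sum_(m <- s) cmod (h (x - shift_vec m)).
have mc := measurable_cmod mh.
have mHm m : measurable_fun setT (fun x : 'rV[R]_n => cmod (h (x - shift_vec m))).
  by apply: measurable_cmod; exact: cmeasurable_shift.
apply: (Lp_norm_le_sup_norm1 (H := H)) => //.
- exact: shift_sum_cmeasurable.
- by apply: measurable_sum => m; exact: mHm.
- by move=> x; exact: cmod_sum.
- by move=> x; rewrite -lee_fin fineK//; exact: (shift_sum_sup eb).
rewrite /H; under eq_integral do rewrite -sumEFin.
rewrite ge0_integral_sum//; last 2 first.
- by move=> m; exact/measurable_EFinP.
- by move=> m x _; rewrite lee_fin cmod_ge0.
rewrite EFinM fineK//.
apply: (@le_trans _ _ (\sum_(m <- s) envelope_sum h r)%E).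
  apply: lee_sum => m _; rewrite (ge0_integral_shift _ mc).
    exact: (shift_norm1 eb).
  by move=> x; exact: cmod_ge0.
have -> : (\sum_(m <- s) envelope_sum h r)%E = (\sum_(m <- s) (fine (envelope_sum h r))%:E)%E.
  by apply: eq_bigr => m _; rewrite fineK.
rewrite sumEFin -[X in (_ <= X * _)%E](fineK Wf) -EFinM lee_fin.
by rewrite big_const_seq count_predT iter_addr_0 mulr_natr.
Qed.

End Lp_of_shift_sums.

(** * Lower bounds by biorthogonality *)

Section square_integrable.
Context {R : realType} {n : nat}.
Notation mu := (lebesgue_rV n).
Notation rintegrable f := (mu.-integrable setT (fun x => (f x)%:E)).
Implicit Types (f g h : 'rV[R]_n -> R[i]).

Lemma Lp_norm2E f : Lp_norm 2 f = ((\int[mu]_x (cmod (f x) ^+ 2)%:E) `^ 2^-1)%E.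
Proof.
rewrite Lp_normE; congr (_ `^ _)%E; apply: eq_integral => x _.
by rewrite powR_mulrn// cmod_ge0.
Qed.

Lemma Lp2_rintegrable f : Lp 2 f -> rintegrable (fun x => cmod (f x) ^+ 2).
Proof.
move=> [mf]; rewrite Lp_norm2E => H.
have m2 : measurable_fun setT (fun x => cmod (f x) ^+ 2).
  by apply: measurable_funX; exact: measurable_cmod.
apply/integrableP; split; first exact/measurable_EFinP.
apply: (lty_poweRy (r := 2^-1)); first by rewrite invr_neq0.
apply: le_lt_trans H; rewrite le_eqVlt; apply/orP; left; apply/eqP.
congr (_ `^ _)%E; apply: eq_integral => x _.
by rewrite gee0_abs// lee_fin sqr_ge0.
Qed.

Lemma Lp2_inner_integrable f g : Lp 2 f -> Lp 2 g ->
  cintegrable (fun x => f x * conjc (g x)).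
Proof.
move=> Lf Lg.
have H : rintegrable (fun x => cmod (f x) ^+ 2 + cmod (g x) ^+ 2).
  exact: (integrableD measurableT (Lp2_rintegrable Lf) (Lp2_rintegrable Lg)).
apply: (cintegrable_le _ H) => [|x].
  by apply: cmeasM; [exact: Lf.1|apply: cmeasJ; exact: Lg.1].
rewrite cmodM cmodJ.
have := cmod_ge0 (f x); have := cmod_ge0 (g x).
by set a := cmod _; set b := cmod _ => a0 b0; nra.
Qed.

(** Integrability is carried along because [cint] is additive on integrable functions; sums run over
    lists, which may repeat an index. *)
Lemma inner_lincomb (I : Type) (r : seq I) (c : I -> R[i]) (e : I -> 'rV[R]_n -> R[i]) g :
  (forall l, Lp 2 (e l)) -> Lp 2 g ->
  cintegrable (fun x => (\sum_(l <- r) c l * e l x) * conjc (g x)) /\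
  inner (fun x => \sum_(l <- r) c l * e l x) g = \sum_(l <- r) c l * inner (e l) g.
Proof.
move=> Le Lg.
have E x : (\sum_(l <- r) c l * e l x) * conjc (g x) =
    \sum_(l <- r) c l * (e l x * conjc (g x)).
  by rewrite mulr_suml; apply: eq_bigr => l _; rewrite mulrA.
have Ic l : cintegrable (fun x => c l * (e l x * conjc (g x))).
  by apply: cintegrableZ; exact: Lp2_inner_integrable.
split; first by under [X in cintegrable X]eq_fun do rewrite E; exact: cintegrable_sum.
rewrite /inner; under [X in cint X]eq_fun do rewrite E.
rewrite cint_sum//; apply: eq_bigr => l _; rewrite cintZ//.
exact: Lp2_inner_integrable.
Qed.

Lemma inner_sumr (I : Type) (r : seq I) (e : I -> 'rV[R]_n -> R[i]) f :
  (forall l, cintegrable (fun x => f x * conjc (e l x))) ->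
  cintegrable (fun x => f x * conjc (\sum_(l <- r) e l x)) /\
  inner f (fun x => \sum_(l <- r) e l x) = \sum_(l <- r) inner f (e l).
Proof.
move=> Ie.
have E x : f x * conjc (\sum_(l <- r) e l x) = \sum_(l <- r) f x * conjc (e l x).
  rewrite (big_morph (@conjc R) (id1 := 0) (op1 := +%R)); last 2 first.
  - by move=> a b; apply: complex_eq; rewrite ?ReJ ?ImJ ?ReD ?ImD ?ReJ ?ImJ// opprD.
  - by rewrite /= oppr0.
  by rewrite mulr_sumr.
split; first by under [X in cintegrable X]eq_fun do rewrite E; exact: cintegrable_sum.
by rewrite /inner; under [X in cint X]eq_fun do rewrite E; rewrite cint_sum.
Qed.

(** The real part suffices, as the inner products to be bounded are natural numbers. *)
Lemma hoelder_inner f g (p q : R) : cmeasurable f -> cmeasurable g ->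
  cintegrable (fun x => f x * conjc (g x)) -> 0 < p -> 0 < q -> p^-1 + q^-1 = 1 ->
  ((complex.Re (inner f g))%:E <= Lp_norm p f * Lp_norm q g)%E.
Proof.
move=> mf mg Ifg p0 q0 pq.
have mcf := measurable_cmod mf; have mcg := measurable_cmod mg.
have := @hoelder _ _ R mu (fun x => cmod (f x)) (fun x => cmod (g x)) p q mcf mcg p0 q0 pq.
apply: le_trans; rewrite Lnorm1.
have Ir := Ifg.1.
rewrite /inner /cint/= /Rintegral fineK; last exact: integrable_fin_num.
apply: le_trans (lee_abs _) _; apply: le_trans (le_abse_integral _ _ _) _ => //.
  exact: measurable_int Ir.
apply: ge0_le_integral => //.
- by apply: measurableT_comp => //; exact: measurable_int Ir.
- have mfg : measurable_fun setT (EFin \o (fun x => cmod (f x) * cmod (g x))).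
    by apply/measurable_EFinP; exact: (measurable_funM mcf mcg).
  by apply: (measurableT_comp (f := abse)) mfg.
move=> x _; rewrite /= lee_fin; apply: le_trans (le_Re_cmod _) _.
by rewrite cmodM cmodJ ler_norm.
Qed.

End square_integrable.

Section nterm_lower_bound.
Context {R : realType} {n L : nat} (n0 : (0 < n)%N) (hL : (0 < L)%N).
Notation mu := (lebesgue_rV n).
Variables psi dpsi : 'I_L -> 'rV[R]_n -> R[i].
Hypothesis psi2 : forall l, Lp 2 (wsystem psi l).
Hypothesis dpsi2 : forall l, Lp 2 (wsystem dpsi l).
Hypothesis psi_dpsi : biorthogonal (wsystem psi) (wsystem dpsi).

Definition shift_index (m : nat) : @windex n L := (Ordinal hL, 0 : int, shift_row m).

Lemma shift_index_inj : injective shift_index.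
Proof.
move=> m m' [] /rowP/(_ (Ordinal n0)); rewrite !mxE /= => -[].
by [].
Qed.

Lemma shift_sumE (f : 'I_L -> 'rV[R]_n -> R[i]) s :
  shift_sum (f (Ordinal hL)) s = fun x => \sum_(m <- s) wsystem f (shift_index m) x.
Proof.
by apply/funext => x; apply: eq_bigr => m _; rewrite /wsystem/= wavelet0E.
Qed.

Lemma size_outside (Lam : {fset @windex n L}) N : (#|` Lam| <= N)%N ->
  (N <= size [seq m <- index_iota 1 (2 * N).+1 | shift_index m \notin Lam])%N.
Proof.
move=> LN; set s := index_iota _ _.
have sz : size s = (2 * N)%N by rewrite size_iota subn1.
have := count_predC (fun m => shift_index m \in Lam) s; rewrite sz.
rewrite size_filter.
have H : (count (fun m => shift_index m \in Lam) s <= N)%N.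
  rewrite -size_filter -(size_map shift_index); apply: leq_trans LN.
  apply: uniq_leq_size.
    by rewrite map_inj_uniq ?filter_uniq ?iota_uniq//; exact: shift_index_inj.
  by move=> _ /mapP[m + ->]; rewrite mem_filter => /andP[].
rewrite (eq_count (_ : (fun m => shift_index m \notin Lam) =1 predC (fun m => shift_index m \in Lam)))//.
by move: H; set a := count _ _; set b := count _ _; lia.
Qed.

Section residual.
Variables (s0 : seq nat) (Lam : {fset @windex n L}) (d : @windex n L -> R[i]).
Hypothesis us0 : uniq s0.

Definition residual : 'rV[R]_n -> R[i] :=
  shift_sum (psi (Ordinal hL)) s0 \- lincomb (wsystem psi) Lam d.

(** Both sums merged into one list of coefficients and indices. A shift may occur in both halves,
    which is harmless since only linearity is used. *)
Let terms : seq (R[i] * @windex n L) :=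
  [seq (1, shift_index m) | m <- s0] ++ [seq (- d l, l) | l <- Lam].

Let residualE : residual = fun x => \sum_(t <- terms) t.1 * wsystem psi t.2 x.
Proof.
apply/funext => x; rewrite /residual /terms shift_sumE /= big_cat !big_map /=.
congr (_ + _); first by apply: eq_bigr => m _; rewrite mul1r.
by rewrite /lincomb -sumrN; apply: eq_bigr => l _; rewrite mulNr.
Qed.

Lemma residual_cmeasurable : cmeasurable residual.
Proof.
rewrite residualE; apply: cmeas_sum => t; apply: cmeasM; first exact: cmeas_cst.
exact: (psi2 t.2).1.
Qed.

Lemma residual_inner_integrable g : Lp 2 g -> cintegrable (fun x => residual x * conjc (g x)).
Proof.
move=> Lg; rewrite residualE.
by have [] := inner_lincomb terms (fun t => t.1) (fun t => psi2 t.2) Lg.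
Qed.

Lemma inner_residual m : m \in s0 -> shift_index m \notin Lam ->
  inner residual (wsystem dpsi (shift_index m)) = 1.
Proof.
move=> ms mL; rewrite residualE.
have [_ ->] := inner_lincomb terms (fun t => t.1) (fun t => psi2 t.2) (dpsi2 (shift_index m)).
rewrite /terms big_cat !big_map /=.
have -> : \sum_(l <- Lam) - d l * inner (wsystem psi l) (wsystem dpsi (shift_index m)) = 0.
  rewrite big_seq big1// => l lL; rewrite psi_dpsi.
  have -> : (l == shift_index m) = false.
    by apply/negP => /eqP E; rewrite E in lL; rewrite lL in mL.
  by rewrite mulr0.
rewrite addr0 (bigD1_seq m)//= psi_dpsi eqxx mul1r big1 ?addr0// => m' m'm.
by rewrite psi_dpsi (inj_eq shift_index_inj) (negbTE m'm) mulr0.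
Qed.

(** Stated for any conjugate pair and before the dual norm is estimated, so that p = q = 2 with
    exact norms is available for orthonormal systems. *)
Lemma residual_hoelder (p q : R) s : 0 < p -> 0 < q -> p^-1 + q^-1 = 1 ->
  {subset s <= s0} -> {in s, forall m, shift_index m \notin Lam} ->
  ((size s)%:R%:E <= Lp_norm p residual * Lp_norm q (shift_sum (dpsi (Ordinal hL)) s))%E.
Proof.
move=> p0 q0 pq ss0 sL.
have Ie m : cintegrable (fun x => residual x * conjc (wsystem dpsi (shift_index m) x)).
  by apply: residual_inner_integrable; exact: dpsi2.
have [Isum E] := inner_sumr s Ie.
have <- : complex.Re (inner residual (shift_sum (dpsi (Ordinal hL)) s)) = (size s)%:R.
  rewrite shift_sumE E big_seq (eq_bigr (fun=> 1)).
    rewrite -big_seq big_const_seq count_predT iter_addr_0.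
    by elim: (size s) => // k IH; rewrite mulrS ReD IH mulrS.
  by move=> m ms; apply: inner_residual; [exact: ss0|exact: sL].
apply: hoelder_inner => //.
- exact: residual_cmeasurable.
- rewrite shift_sumE; apply: cmeas_sum => m; exact: (dpsi2 _).1.
- by rewrite shift_sumE.
Qed.

End residual.

End nterm_lower_bound.

Section nterm_error_bounds.
Context {R : realType} {n L : nat} (n0 : (0 < n)%N) (hL : (0 < L)%N).
Variables psi dpsi : 'I_L -> 'rV[R]_n -> R[i].
Hypothesis psi2 : forall l, Lp 2 (wsystem psi l).
Hypothesis dpsi2 : forall l, Lp 2 (wsystem dpsi l).
Hypothesis psi_dpsi : biorthogonal (wsystem psi) (wsystem dpsi).
Let dpsi1 := dpsi (Ordinal hL).
Hypothesis mdpsi : cmeasurable dpsi1.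
Hypothesis rdpsi : rapid dpsi1.
Variable p : R.
Hypothesis p1 : 1 < p.

Let p0 : 0 < p. Proof. exact: lt_trans ltr01 p1. Qed.
Let q : R := p / (p - 1).
Let q1 : 1 < q.
Proof. by rewrite /q ltr_pdivlMr ?subr_gt0// mul1r gtrBl. Qed.
Let q0 : 0 < q. Proof. exact: lt_trans ltr01 q1. Qed.
Let pq : p^-1 + q^-1 = 1.
Proof. by rewrite /q invf_div; field; rewrite gt_eqF. Qed.

Lemma K_L_fin_num : K_L p dpsi1 \is a fin_num.
Proof. by have [b eb] := rapid_envelope n0 rdpsi; exact: envelope_sum_fin_num eb _. Qed.

Lemma K_L_ge0 : (0 <= K_L p dpsi1)%E.
Proof. by have [b eb] := rapid_envelope n0 rdpsi; exact: envelope_sum_ge0 eb _. Qed.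

Lemma residual_K_L s0 (Lam : {fset @windex n L}) d s : uniq s0 -> uniq s -> {subset s <= s0} ->
  {in s, forall m, shift_index hL m \notin Lam} ->
  ((size s)%:R%:E <= Lp_norm p (residual hL psi s0 Lam d) *
     (K_L p dpsi1 * ((size s)%:R `^ q^-1)%:E))%E.
Proof.
move=> us0 us ss0 sL.
apply: le_trans (residual_hoelder n0 psi2 dpsi2 psi_dpsi d us0 p0 q0 pq ss0 sL) _.
apply: lee_wpmul2l; first exact: Lp_norm_ge0.
apply: Lp_shift_sum => //.
by rewrite lerDl divr_ge0// ltW.
Qed.

(** With one shift and nothing subtracted, Hoelder reads 1 <= norm times [K_L]. If [K_L] were 0 the
    right side would be 0, even for an infinite norm. *)
Lemma K_L_gt0 : (0 < K_L p dpsi1)%E.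
Proof.
rewrite lt0e K_L_ge0 andbT; apply/eqP => K0.
have := @residual_K_L [:: 0%N] fset0 (fun=> 0) [:: 0%N] isT isT (fun _ => id) (fun _ _ => isT).
by rewrite K0 mul0e mule0 lee_fin/= ler10.
Qed.

Lemma residual_lower N (Lam : {fset @windex n L}) d : (1 <= N)%N -> (#|` Lam| <= N)%N ->
  ((N%:R `^ p^-1)%:E <=
    K_L p dpsi1 * Lp_norm p (residual hL psi (index_iota 1 (2 * N).+1) Lam d))%E.
Proof.
move=> N1 LN; set s0 := index_iota _ _; set F := residual _ _ _ _ _.
pose s := [seq m <- s0 | shift_index hL m \notin Lam].
have us0 : uniq s0 by exact: iota_uniq.
have us : uniq s by exact: filter_uniq.
have ss0 : {subset s <= s0} by move=> m; rewrite mem_filter => /andP[].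
have sL : {in s, forall m, shift_index hL m \notin Lam}.
  by move=> m; rewrite mem_filter => /andP[].
have := residual_K_L d us0 us ss0 sL; rewrite -/F.
have NS : (N <= size s)%N by exact: size_outside.
have S0 : 0 < (size s)%:R :> R by rewrite ltr0n (leq_trans N1).
have K0 := K_L_gt0; have Kf := K_L_fin_num.
(* An infinite norm makes the bound trivial because [K_L] is positive. *)
have := Lp_norm_ge0 p F; case: (Lp_norm p F) => [t|_ _|//]; last first.
  by rewrite gt0_muley// leey.
rewrite -(fineK Kf) -!EFinM !lee_fin => t0.
set k := fine _ => H.
have kp : 0 < k by rewrite -lte_fin fineK.
apply: (@le_trans _ _ ((size s)%:R `^ p^-1)).
  by apply: ge0_ler_powR; rewrite ?nnegrE ?invr_ge0 ?(ltW p0)// ler_nat.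
(* Cancelling the factor of exponent 1/q from the dual norm leaves the power 1/p of the number of
   free shifts. *)
have E : (size s)%:R = (size s)%:R `^ p^-1 * (size s)%:R `^ q^-1 :> R.
  by rewrite -powRD ?pq ?powRr1//; apply/implyP => _; rewrite gt_eqF.
rewrite {1}E mulrA ler_pM2r ?powR_gt0// in H.
by rewrite mulrC.
Qed.

Lemma nterm_error_lower N : (1 <= N)%N ->
  ((K_L p dpsi1)^-1 * (N%:R `^ p^-1)%:E <= nterm_error psi N p (fN (psi (Ordinal hL)) N))%E.
Proof.
move=> N1; apply: le_ereal_inf_tmp => _ [[Lam d] /= LN <-].
rewrite fNE; have := residual_lower d N1 LN; rewrite /residual.
have K0 := K_L_gt0; have Kf := K_L_fin_num.
set k := K_L p dpsi1 in K0 Kf *; rewrite -(fineK Kf).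
have kp : 0 < fine k by rewrite -lte_fin fineK.
rewrite inver gt_eqF// => H.
by rewrite lee_pdivrMl.
Qed.

End nterm_error_bounds.

(** * Exact error for orthonormal systems *)

Section orthonormal_case.
Context {R : realType}.
Variable psi : 'rV[R]_1 -> R[i].
Let e := wsystem (fun _ : 'I_1 => psi).
Hypothesis basis : orthonormal_basis e.

Let e2 l : Lp 2 (e l). Proof. exact: basis.1.1. Qed.
Let I0 : (0 < 1)%N := isT.

(** Pythagoras, obtained by pairing the residual with empty [Lam] with itself. *)
Lemma Lp_norm2_shift_sum s : uniq s ->
  Lp_norm 2 (shift_sum psi s) = ((size s)%:R `^ 2^-1)%:E.
Proof.
move=> us; have [_ ee] := basis.
pose F := residual I0 (fun=> psi) s fset0 (fun=> 0).
have FE : F = shift_sum psi s.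
  by apply/funext => x; rewrite /F /residual/= /lincomb big_nil subr0.
have Ie m : cintegrable (fun x => F x * conjc (e (shift_index (n := 1) I0 m) x)).
  exact: (residual_inner_integrable I0 e2 _ _ _ (e2 _)).
have [Isum E] := inner_sumr s Ie.
have GE : (fun x => \sum_(m <- s) e (shift_index (n := 1) I0 m) x) = F.
  by rewrite FE (shift_sumE I0 (fun=> psi)).
have inn : inner F F = (size s)%:R.
  rewrite -{2}GE E big_seq (eq_bigr (fun=> 1)).
    rewrite -big_seq big_const_seq count_predT iter_addr_0; by [].
  by move=> m ms; exact: (@inner_residual R 1 1 I0 I0 (fun=> psi) (fun=> psi) e2 e2 ee s fset0 (fun=> 0) us m ms isT).
have {}Isum : cintegrable (fun x => F x * conjc (F x)).
  move: Isum; congr cintegrable; apply/funext => x; congr (_ * conjc _).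
  exact: (congr1 (fun f => f x) GE).
rewrite -FE Lp_norm2E -poweR_EFin; congr (_ `^ _)%E.
have Ir := Isum.1.
have Re2 x : complex.Re (F x * conjc (F x)) = cmod (F x) ^+ 2.
  by rewrite ReM ReJ ImJ sqr_cmod; ring.
transitivity (complex.Re (inner F F))%:E.
  rewrite /inner /cint/= /Rintegral fineK; last exact: integrable_fin_num.
  by apply: eq_integral => x _; rewrite Re2.
by rewrite inn; congr EFin; elim: (size s) => // k IH; rewrite mulrS ReD IH mulrS.
Qed.

Lemma orthonormal_nterm_error N : (1 <= N)%N ->
  nterm_error (fun _ : 'I_1 => psi) N 2 (fN psi N) =
    ((2 `^ (- 2^-1))%:E * Lp_norm 2 (fN psi N))%E.
Proof.
move=> N1; have [_ ee] := basis.
rewrite fNE Lp_norm2_shift_sum ?iota_uniq// size_iota subn1/=.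
have two : 0 < 2 :> R by [].
have -> : ((2 `^ (- 2^-1))%:E * ((2 * N)%:R `^ 2^-1)%:E = (N%:R `^ 2^-1)%:E :> \bar R)%E.
  rewrite -EFinM natrM powRM// mulrA -powRD ?addNr ?powRr0 ?mul1r//.
  by apply/implyP => _.
apply/eqP; rewrite eq_le; apply/andP; split.
  apply: ge_ereal_inf.
  (* Removing the first half with coefficients 1 leaves N orthonormal shifts, of norm N^(1/2) =
     2^(-1/2) (2N)^(1/2). *)
  pose s1 := index_iota 1 N.+1; pose s2 := index_iota N.+1 (2 * N).+1.
  pose Lam : {fset @windex 1 1} := [fset l in [seq shift_index (n := 1) I0 m | m <- s1]]%fset.
  have us1 : uniq [seq shift_index (n := 1) I0 m | m <- s1].
    by rewrite map_inj_uniq ?iota_uniq//; exact: shift_index_inj.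
  have PL : perm_eq Lam [seq shift_index (n := 1) I0 m | m <- s1].
    by apply: uniq_perm => // l; rewrite inE.
  exists (Lp_norm 2 (shift_sum psi s2)).
    exists (Lam, fun=> 1) => /=.
      by rewrite (perm_size PL) size_map size_iota subn1.
    congr Lp_norm; apply/funext => x; rewrite /= /lincomb (perm_big _ PL)/= big_map.
    rewrite !(shift_sumE I0 (fun=> psi)) (@big_cat_nat _ _ _ N.+1)//=; last by lia.
    rewrite [X in _ - X](eq_bigr (fun m => e (shift_index (n := 1) I0 m) x)).
      by rewrite addrAC subrr add0r.
    by move=> m _; rewrite mul1r.
  rewrite Lp_norm2_shift_sum ?iota_uniq// size_iota lee_fin.
  by rewrite (_ : ((2 * N).+1 - N.+1)%N = N)//; lia.
apply: le_ereal_inf_tmp => _ [[Lam d] /= LN <-].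
set s0 := index_iota _ _.
pose s := [seq m <- s0 | shift_index (n := 1) I0 m \notin Lam].
have us0 : uniq s0 by exact: iota_uniq.
have us : uniq s by exact: filter_uniq.
have ss0 : {subset s <= s0} by move=> m; rewrite mem_filter => /andP[].
have sL : {in s, forall m, shift_index (n := 1) I0 m \notin Lam}.
  by move=> m; rewrite mem_filter => /andP[].
have half : 2^-1 + 2^-1 = 1 :> R by field.
(* Cauchy-Schwarz against the shifts outside [Lam], whose sum has norm exactly the square root of
   their number. *)
have := residual_hoelder I0 e2 e2 ee d us0 two two half ss0 sL.
rewrite Lp_norm2_shift_sum// /residual.
have NS : (N <= size s)%N by exact: size_outside.
have S0 : 0 < (size s)%:R :> R by rewrite ltr0n (leq_trans N1).
have E : (size s)%:R = (size s)%:R `^ 2^-1 * (size s)%:R `^ 2^-1 :> R.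
  by rewrite -powRD ?half ?powRr1//; apply/implyP => _; rewrite gt_eqF.
set t := Lp_norm 2 _ => H; apply: (@le_trans _ _ ((size s)%:R `^ 2^-1)%:E).
  by rewrite lee_fin; apply: ge0_ler_powR; rewrite ?nnegrE ?invr_ge0// ler_nat.
by rewrite {1}E EFinM lee_pmul2r// ?lte_fin ?powR_gt0// in H.
Qed.

End orthonormal_case.

(** * Besov norms of sums of translates *)

Lemma finite_int_ball (M : int) : finite_set [set i : int | `|i| <= M].
Proof.
apply: (@sub_finite_set _ _ ((fun k : nat => k%:Z - M) @` `I_(`|M|.*2.+1))).
  by move=> i /= iM; exists `|(i + M)%R|%N; rewrite /=; lia.
exact: finite_image.
Qed.

(** An integrable function pairs with the sup norm alone, so the seminorm of order 0 is enough. *)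
Lemma regular_tempered (R : realType) n (f : 'rV[R]_n -> R[i]) : cintegrable f -> tempered (regular f).
Proof.
move=> If; have mf := cintegrable_meas If.
have Ig g : schwartz g -> cintegrable (fun x => f x * g x).
  move=> sg; have [B HB] := rapid_bounded (schwartz_rapid sg).
  apply: (cintegrable_le _ (rintegrableZ B (rintegrable_cmod If))) => [|x].
    by apply: cmeasM => //; apply: continuous_cmeasurable; exact: schwartz_ccontinuous.
  by rewrite cmodM mulrC ler_wpM2r ?cmod_ge0.
split.
  move=> z g h sg sh; rewrite /regular.
  have I1 := Ig g sg; have I2 := Ig h sh.
  rewrite -(cintZ z I1) -(cintD (cintegrableZ z I1) I2).
  by congr cint; apply/funext => x; rewrite mulrDr mulrCA.
exists (2 * \int[lebesgue_rV n]_x cmod (f x)), 0%N => g B sg HB.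
rewrite /regular -mulrA [_ * B]mulrC -RintegralZl//; last exact: rintegrable_cmod.
apply: le_cmod_cint; first exact: Ig.
  by apply: rintegrableZ; exact: rintegrable_cmod.
move=> x; rewrite cmodM mulrC ler_wpM2r ?cmod_ge0//.
by have := HB [::] x isT; rewrite expr0 mul1r.
Qed.

Section besov_bounds.
Context {R : realType} {n : nat} (n0 : (0 < n)%N).
Notation mu := (lebesgue_rV n).
Variables (a b c1 c2 s p q : R) (phi psi : 'rV[R]_n -> R[i]).
Hypotheses (a0 : 0 < a) (ab : a < b) (c10 : 0 < c1) (c12 : c1 < c2).
Hypotheses (p1 : 1 < p) (q0 : 0 < q).
Hypothesis lp : littlewood_paley c1 c2 phi.
Hypothesis bl : band_limited a b psi.
Let M := band_radius a b c1 c2.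

Let p0 : 0 < p. Proof. exact: lt_trans ltr01 p1. Qed.
Let sphi : schwartz phi. Proof. by case: lp. Qed.
Let cphi : ccontinuous phi. Proof. exact: schwartz_ccontinuous. Qed.
Let rphi : rapid phi. Proof. exact: schwartz_rapid. Qed.
Let mphi : cmeasurable phi. Proof. exact: continuous_cmeasurable. Qed.
Let Iphi : cintegrable phi. Proof. exact: rapid_cintegrable. Qed.
Let mpsi : cmeasurable psi. Proof. by apply: continuous_cmeasurable; case: bl. Qed.
Let rpsi : rapid psi. Proof. exact: band_limited_rapid n0 lp bl. Qed.
Let Ipsi : cintegrable psi. Proof. exact: rapid_cintegrable. Qed.
Let mdya j : cmeasurable (dyadic phi j).
Proof. by apply: continuous_cmeasurable; exact: dyadic_ccontinuous. Qed.
Let rdya j : rapid (dyadic phi j). Proof. exact: dyadic_rapid. Qed.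

Let cnv j := Defs.conv (dyadic phi j) psi.

Let mcnv j : cmeasurable (cnv j). Proof. exact: conv_cmeasurable. Qed.
Let rcnv j : rapid (cnv j). Proof. exact: conv_rapid. Qed.

Lemma two_expz_le_log (j : int) (x : R) : 0 < x -> (2 : R) ^ j <= x ->
  j%:~R <= ln x / ln 2 :> R.
Proof.
move=> x0 H; have l2 : 0 < ln 2 :> R by rewrite ln_gt0// ltr1n.
rewrite ler_pdivlMr// -ln_powR powR_intmul//.
by rewrite ler_ln// posrE exprz_gt0.
Qed.

Lemma band_radius_ge0 : 0 <= M.
Proof. by rewrite /M /band_radius ceil_ge0 (lt_le_trans (ltrN10 _))// le_max lexx orbT. Qed.

(** The origin of [band_radius]: a common point xi of the annuli satisfies 2^j c1 <= |xi| <= b and a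
    <= |xi| <= 2^j c2, hence 2^j <= b / c1 and 2^(-j) <= c2 / a; logarithms bound |j|. *)
Lemma fourier_dyadic_disjoint j xi : ~~ (`|j| <= M) ->
  fourier (dyadic phi j) xi * fourier psi xi = 0.
Proof.
move=> jM; have [_ _ _ sup_phi _] := lp; have [_ _ _ sup_psi] := bl.
rewrite fourier_dyadic//; apply/eqP; rewrite mulf_eq0; apply: contrapT.
move=> /negP; rewrite negb_or => /andP[/sup_phi h1 /sup_psi h2].
move: jM; apply/negP; rewrite negbK.
have r0 := two_expz_gt0 (R := R) j.
have ri : (2 : R) ^ (- j) = ((2 : R) ^ j)^-1 by rewrite invr_expz.
move: h1; rewrite enormZ ?ri ?invr_ge0 ?(ltW r0)// => /andP[h1 h1'].
case/andP: h2 => h2 h2'; set E := enorm xi in h1 h1' h2 h2' *.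
have E0 : 0 < E by exact: lt_le_trans a0 h2.
have b0 : 0 < b by exact: lt_trans a0 ab.
have c20 : 0 < c2 by exact: lt_trans c10 c12.
have H1 : (2 : R) ^ j <= b / c1.
  rewrite ler_pdivlMr//; apply: le_trans h2'.
  by rewrite -ler_pdivlMl.
have H2 : (2 : R) ^ (- j) <= c2 / a.
  rewrite ler_pdivlMr// ri; apply: le_trans h1'.
  by rewrite ler_wpM2l// invr_ge0 ltW.
have K1 := two_expz_le_log (divr_gt0 b0 c10) H1.
have K2 := two_expz_le_log (divr_gt0 c20 a0) H2.
pose mx := Num.max (Num.max (ln (b / c1) / ln 2) (ln (c2 / a) / ln 2)) 0.
have MM : mx <= M%:~R by exact: Num.Theory.ceil_ge.
rewrite ler_norml; apply/andP; split.
  rewrite lerNl -(ler_int R); apply: le_trans K2 (le_trans _ MM).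
  by rewrite !le_max lexx orbT.
rewrite -(ler_int R); apply: le_trans K1 (le_trans _ MM).
by rewrite !le_max lexx.
Qed.

Lemma conv_dyadic_eq0 j x : ~~ (`|j| <= M) -> cnv j x = 0.
Proof.
move=> jM; have [kappa H] := band_limited_inversion n0 lp.
apply: (conv_eq0 (mdya j) (rdya j) _ (H _ _ _ bl)).
  exact: test_function_cintegrable (band_limited_test bl).
by move=> xi; exact: fourier_dyadic_disjoint.
Qed.

(** Convolution commutes with translations, so each block is again a sum of translates and
    [Lp_shift_sum] applies to it. *)
Lemma block_shift_sum j l : block phi j (regular (shift_sum psi l)) = shift_sum (cnv j) l.
Proof.
apply/funext => x; rewrite /block /regular /shift_sum.
have E y : (\sum_(m <- l) psi (y - shift_vec m)) * dyadic phi j (x - y) =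
    \sum_(m <- l) dyadic phi j (x - y) * psi (y - shift_vec m).
  by rewrite mulr_suml; apply: eq_bigr => m _; rewrite mulrC.
under [X in cint X]eq_fun do rewrite E.
rewrite cint_sum.
  by apply: eq_bigr => m _; rewrite conv_shift.
move=> m; apply: cintegrable_conv_integrand => //.
have := cintegrable_affine (- shift_vec m) (oner_neq0 R) Ipsi.
by under [X in cintegrable X]eq_fun do rewrite affine_rVE scale1r.
Qed.

Let KU j := K_U p (cnv j).

Lemma K_U_ge0 j : (0 <= KU j)%E.
Proof. by have [e eb] := rapid_envelope n0 (rcnv j); exact: envelope_sum_ge0 eb _. Qed.

Lemma K_U_fin_num j : KU j \is a fin_num.
Proof. by have [e eb] := rapid_envelope n0 (rcnv j); exact: envelope_sum_fin_num eb _. Qed.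

Let Keta := K_eta p phi psi M.

Lemma K_U_le_K_eta j : `|j| <= M -> (KU j <= Keta)%E.
Proof. by move=> jM; apply: ereal_sup_ubound; exists j. Qed.

Lemma K_eta_ge0 : (0 <= Keta)%E.
Proof.
apply: le_trans (K_U_ge0 0) (K_U_le_K_eta _).
by rewrite normr0 band_radius_ge0.
Qed.

(** The supremum runs over finitely many finite values, hence lies below their sum. *)
Lemma K_eta_fin_num : Keta \is a fin_num.
Proof.
rewrite ge0_fin_numE ?K_eta_ge0//.
have /finite_seqP[l lE]  := finite_int_ball M.
apply: (@le_lt_trans _ _ (\sum_(j <- l) fine (KU j))%:E); last exact: ltry.
apply: ge_ereal_sup => _ [j jM <-].
have jl : j \in l by have : [set` l] j by rewrite -lE.
rewrite -/(KU j) -(fineK (K_U_fin_num j)) lee_fin (big_rem j jl)/= lerDl.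
by apply: sumr_ge0 => i _; apply: fine_ge0; exact: K_U_ge0.
Qed.

Lemma besov_norm_shift_sum l : uniq l ->
  (besov_norm phi s p q (regular (shift_sum psi l)) <=
   (C_band s q M)%:E * Keta * ((size l)%:R `^ p^-1)%:E)%E.
Proof.
move=> ul; set S := (size l)%:R `^ p^-1.
have S0 : 0 <= S by exact: powR_ge0.
have Kf := K_eta_fin_num; have K0 := K_eta_ge0.
rewrite -(fineK Kf); set e := fine Keta.
have e0 : 0 <= e by exact: fine_ge0.
have r_ge : n%:R <= n%:R + n%:R / (p / (p - 1)) :> R.
  by rewrite lerDl divr_ge0// divr_ge0// ?subr_ge0 ltW.
pose T := (e * S) `^ q.
have T0 : 0 <= T by exact: powR_ge0.
rewrite /besov_norm /C_band.
set D := [set i : int | `|i| <= M]; have fD : finite_set D  := finite_int_ball M.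
pose w (j : int) : R := 2 `^ (j%:~R * s * q).
have w0 j : 0 <= w j by exact: powR_ge0.
(* The bound common to all blocks is moved inside the power 1/q, so that the two sums can be
   compared term by term. *)
have -> : (((\sum_(i \in D) w i) `^ q^-1)%:E * e%:E * S%:E = (\sum_(i \in D) (w i * T)%:E) `^ q^-1)%E.
  rewrite (fsumEFin _ fD) poweR_EFin -!EFinM; congr EFin.
  rewrite -mulr_fsuml powRM ?T0//; last by apply: fsumr_ge0.
  by rewrite /T -powRrM mulfV ?gt_eqF// powRr1 ?mulr_ge0// mulrA.
apply: gt0_ler_poweR.
- by rewrite invr_ge0 ltW.
- by rewrite in_itv/= leey andbT esum_ge0// => j _; rewrite mule_ge0 ?lee_fin ?poweR_ge0.
- by rewrite in_itv/= leey andbT; apply: fsume_ge0 => j _; rewrite lee_fin mulr_ge0.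
(* The finite sum is extended by zero to all scales, matching the vanishing blocks with |j| > M. *)
rewrite -esum_fset//; last by move=> j _; rewrite lee_fin mulr_ge0.
rewrite [leRHS]esum_mkcond; apply: le_esum => j _.
rewrite block_shift_sum; case: ifPn => [/set_mem jM|/negP jM].
  rewrite EFinM; apply: lee_wpmul2l; first by rewrite lee_fin.
  rewrite /T -poweR_EFin; apply: gt0_ler_poweR.
  - exact: ltW.
  - by rewrite in_itv/= leey andbT Lp_norm_ge0.
  - by rewrite in_itv/= leey andbT lee_fin mulr_ge0.
  apply: le_trans (Lp_shift_sum n0 p1 r_ge (mcnv j) (rcnv j) ul) _.
  rewrite EFinM /e fineK//; apply: lee_wpmul2r; first by rewrite lee_fin.
  exact: K_U_le_K_eta.
have -> : shift_sum (cnv j) l = cst 0.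
  apply/funext => x; rewrite /shift_sum big1// => m _; apply: conv_dyadic_eq0.
  by apply/negP => jM'; apply: jM; apply/mem_set.
have -> : Lp_norm p (cst 0 : 'rV[R]_n -> R[i]) = 0%E.
  rewrite /Lp_norm -[RHS](@Lnorm0 _ _ R mu p%:E); last by rewrite eqe gt_eqF.
  by apply: eq_Lnorm => x; congr EFin; exact: cmod0.
by rewrite poweR0r ?gt_eqF// mule0.
Qed.

Lemma shift_sum_Lp_besov l : uniq l -> Lp_besov phi s p q (shift_sum psi l).
Proof.
move=> ul; split; first split.
- exact: shift_sum_cmeasurable.
- have [e eb] := rapid_envelope n0 rpsi.
  apply: le_lt_trans (Lp_shift_sum n0 p1 (lexx n%:R) mpsi rpsi ul) _.
  by rewrite -(fineK (envelope_sum_fin_num eb _)) -EFinM ltry.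
split.
  apply: regular_tempered; apply: cintegrable_sum => m.
  have := cintegrable_affine (- shift_vec m) (oner_neq0 R) Ipsi.
  by under [X in cintegrable X]eq_fun do rewrite affine_rVE scale1r.
apply: le_lt_trans (besov_norm_shift_sum ul) _.
by rewrite -(fineK K_eta_fin_num) -!EFinM ltry.
Qed.

End besov_bounds.

(** * Combining the bounds *)

Lemma exists_nat_powR_gt (R : realType) (kappa D : R) : 0 < kappa ->
  exists2 N : nat, (1 <= N)%N & D < N%:R `^ kappa.
Proof.
move=> k0; exists (Num.truncn (`|D| `^ kappa^-1)).+1 => //.
apply: le_lt_trans (ler_norm D) _.
have {1}-> : `|D| = (`|D| `^ kappa^-1) `^ kappa.
  by rewrite -powRrM mulVf ?gt_eqF// powRr1.
by apply: gt0_ltr_powR; rewrite ?nnegrE ?powR_ge0// truncnS_gt.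
Qed.

Lemma lower_bound_of_besov_bound (R : realType) (k e c S2 S bes : R) (t : \bar R) :
  0 < k -> 0 <= e -> 0 <= c -> 0 < S2 -> 0 <= S ->
  (0 <= bes%:E)%E -> (bes%:E <= c%:E * e%:E * (S2 * S)%:E)%E ->
  (k%:E^-1 * S%:E <= t)%E ->
  ((S2%:E * k%:E * e%:E * c%:E)^-1 * bes%:E <= t)%E.
Proof.
move=> k0 e0 c0 s0 S0 bes0 besle tge.
have t0 : (0 <= t)%E.
  apply: le_trans tge; rewrite mule_ge0 ?lee_fin//.
  by rewrite inver gt_eqF// lee_fin invr_ge0 ltW.
(* In this degenerate case the inverse is +oo, but the Besov norm is 0 and the product is 0 by
   convention. *)
have [X0|X0] := eqVneq (e * c) 0.
  have -> : bes = 0.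
    apply/eqP; rewrite eq_le; move: bes0; rewrite lee_fin => ->; rewrite andbT.
    by move: besle; rewrite -!EFinM lee_fin (mulrC c) X0 mul0r.
  by rewrite mule0.
have e1 : 0 < e by rewrite lt0r e0 andbT; apply: contra X0 => /eqP->; rewrite mul0r.
have c1 : 0 < c by rewrite lt0r c0 andbT; apply: contra X0 => /eqP->; rewrite mulr0.
apply: le_trans tge; rewrite -!EFinM in besle *.
have P : 0 < S2 * k * e * c by rewrite !mulr_gt0.
rewrite !inver !gt_eqF// -!EFinM !lee_fin in besle *.
rewrite ler_pdivrMl//; apply: le_trans besle _.
rewrite [leRHS](_ : _ = c * e * (S2 * S))//.
by field; rewrite gt_eqF.
Qed.

Theorem mainTheorem5 (R : realType) :
  (forall (n L : nat) (hn : (0 < n)%N) (hL : (0 < L)%N)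
     (a b c1 c2 s p q : R) (phi : 'rV[R]_n -> R[i])
     (psi dpsi : 'I_L -> 'rV[R]_n -> R[i]),
   0 < a -> a < b -> 0 < c1 -> c1 < c2 -> 0 < s -> 1 < p -> 0 < q ->
   littlewood_paley c1 c2 phi ->
   biorthogonal_wavelets a b psi dpsi ->
   let psi1 := psi (Ordinal hL) in
   let M := band_radius a b c1 c2 in
   let CM := (C_band s q M)%:E in
   let KL := K_L p (dpsi (Ordinal hL)) in
   let Keta := K_eta p phi psi1 M in
   let besovn f := besov_norm phi s p q (regular f) in
   (forall N : nat, (1 <= N)%N ->
     [/\ Lp_besov phi s p q (fN psi1 N),
         (KL^-1 * (N%:R `^ p^-1)%:E <= nterm_error psi N p (fN psi1 N))%E,
         (besovn (fN psi1 N) <= CM * Keta * ((2 * N)%:R `^ p^-1)%:E)%E &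
         (((2 `^ p^-1)%:E * KL * Keta * CM)^-1 * besovn (fN psi1 N) <=
            nterm_error psi N p (fN psi1 N))%E]) /\
   ~ (exists kappa C : R, 0 < kappa /\
        forall f, Lp_besov phi s p q f -> forall N : nat, (1 <= N)%N ->
          (nterm_error psi N p f <= (C * N%:R `^ (- kappa))%:E * besovn f)%E))
  /\
  (forall (nu : R -> R) (psi : 'rV[R]_1 -> R[i]),
   meyer_wavelet nu psi ->
   orthonormal_basis (wsystem (fun _ : 'I_1 => psi)) ->
   forall N : nat, (1 <= N)%N ->
     nterm_error (fun _ : 'I_1 => psi) N 2 (fN psi N) =
       ((2 `^ (- 2^-1))%:E * Lp_norm 2 (fN psi N))%E).
Proof.
split; last first.
  by move=> nu psi _ basis N N1; exact: orthonormal_nterm_error.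
move=> n L hn hL a b c1 c2 s p q phi psi dpsi a0 ab c10 c12 _ p1 q0 lp bw psi1 M CM KL Keta besovn.
have [blim [[psi2 _] _] [[dpsi2 _] _] biorth _] := bw.
have [bl dbl] := blim (Ordinal hL).
have mdpsi : cmeasurable (dpsi (Ordinal hL)) by apply: continuous_cmeasurable; case: dbl.
have rdpsi : rapid (dpsi (Ordinal hL)) := band_limited_rapid hn lp dbl.
have KL0 : (0 < KL)%E by exact: (K_L_gt0 hn psi2 dpsi2 biorth).
have KLf : KL \is a fin_num by exact: K_L_fin_num.
have Ke0 : (0 <= Keta)%E by exact: (K_eta_ge0 hn p lp bl).
have Kef : Keta \is a fin_num by exact: (K_eta_fin_num hn p lp bl).
pose k := fine KL; pose e := fine Keta; pose c := C_band s q M.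
have k0 : 0 < k by rewrite -lte_fin fineK.
have e0 : 0 <= e by exact: fine_ge0.
have c0 : 0 <= c by exact: powR_ge0.
have two0 : 0 < 2 `^ p^-1 :> R by rewrite powR_gt0.
have mem N : Lp_besov phi s p q (fN psi1 N).
  by rewrite fNE; exact: (shift_sum_Lp_besov hn s a0 ab c10 c12 p1 q0 lp bl (iota_uniq _ _)).
have low N : (1 <= N)%N -> (KL^-1 * (N%:R `^ p^-1)%:E <= nterm_error psi N p (fN psi1 N))%E.
  by move=> N1; exact: (nterm_error_lower hn psi2 dpsi2 biorth).
have up N : (besovn (fN psi1 N) <= CM * Keta * ((2 * N)%:R `^ p^-1)%:E)%E.
  have := @besov_norm_shift_sum _ _ hn _ _ _ _ s p q _ _ a0 ab c10 c12 p1 q0 lp bl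
    (index_iota 1 (2 * N).+1) (iota_uniq _ _).
  by rewrite size_iota subn1 -fNE.
have bes0 N : (0 <= besovn (fN psi1 N))%E by exact: poweR_ge0.
have besf N : besovn (fN psi1 N) \is a fin_num.
  by rewrite ge0_fin_numE//; have [_ []] := mem N.
have pow2 N : (2 * N)%:R `^ p^-1 = 2 `^ p^-1 * N%:R `^ p^-1 :> R by rewrite natrM powRM.
have comb N : (1 <= N)%N -> (((2 `^ p^-1)%:E * KL * Keta * CM)^-1 * besovn (fN psi1 N) <=
    nterm_error psi N p (fN psi1 N))%E.
  move=> N1; rewrite -(fineK KLf) -(fineK Kef) -(fineK (besf N)).
  apply: (lower_bound_of_besov_bound (S := N%:R `^ p^-1)); [exact: k0|exact: e0|exact: c0|exact: two0|exact: powR_ge0|..].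
  - by rewrite fineK.
  - by rewrite !fineK// -pow2; exact: up.
  - by rewrite fineK//; exact: low.
split; first by move=> N N1; split; [exact: mem|exact: low|exact: up|exact: comb].
move=> [kappa [C [kappa0 HC]]].
(* The two bounds on f_N and the assumed rate give N^(1/p) / k <= |C| N^(-kappa) c e (2N)^(1/p);
   cancelling N^(1/p) bounds N^kappa by this constant. *)
have [N N1] := exists_nat_powR_gt (k * `|C| * (c * e * 2 `^ p^-1)) kappa0.
have N0 : 0 < N%:R :> R by rewrite ltr0n.
have S0 : 0 < N%:R `^ p^-1 :> R by rewrite powR_gt0.
have T0 : 0 < N%:R `^ kappa :> R by rewrite powR_gt0.
have H := le_trans (low N N1) (HC _ (mem N) N N1).
have U := up N; move: H U; rewrite -(fineK (besf N)) -(fineK KLf) -(fineK Kef).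
rewrite inver gt_eqF// -!EFinM !lee_fin -/k -/e -/c pow2 powRN => H U.
have B0 : 0 <= fine (besovn (fN psi1 N)) by exact: fine_ge0.
set B := fine _ in H U B0; set S := _ `^ p^-1 in H U S0 *; set T := _ `^ kappa in H T0 *.
set t := 2 `^ p^-1 in U two0 *.
rewrite ltNge => /negP; apply.
(* [C] may be negative; with |C| the upper bound on the Besov norm can be inserted. *)
have H1 : k^-1 * S <= `|C| / T * (c * e * (t * S)).
  apply: le_trans H _; apply: (@le_trans _ _ (`|C| / T * B)).
    by rewrite ler_wpM2r// ler_wpM2r ?ler_norm// invr_ge0 ltW.
  by rewrite ler_wpM2l// divr_ge0// ltW.
(* Multiplying the goal by S and by 1 / (k T) turns it into [H1]. *)
rewrite -(ler_pM2l S0) -(ler_pM2l (_ : 0 < k^-1 / T)); last by rewrite divr_gt0// invr_gt0.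
have -> : k^-1 / T * (S * T) = k^-1 * S by field; rewrite !gt_eqF.
apply: le_trans H1 _; rewrite le_eqVlt; apply/orP; left; apply/eqP.
by field; rewrite !gt_eqF.
Qed.
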